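(* Let $b>0$, $T>0$, $H>0$ be fixed constants, and let $\hat H,\widehat M\ge 1$ be two fixed constants. Let $h\in C([0,T])$ be a given strictly positive function satisfying $\|h\|_\infty\le \hat H$, and let $u_0,\widetilde u_0\in H^1(0,b)$ satisfy $$0\le u_0(x)\le H(b-x),\qquad 0\le \widetilde u_0(x)\le H(b-x),\qquad 0\le x\le b,$$ $$\|u_0\|_{H^1(0,b)}\le \widehat M,\qquad \|\widetilde u_0\|_{H^1(0,b)}\le \widehat M .$$ Let $(u,s)$ and $(\widetilde u,\widetilde s)$ be the solutions of the one-phase Stefan problem (defined in the context) with boundary flux $h$ and with initial conditions $u_0$ and $\widetilde u_0$ respectively, so that $s$ and $\widetilde s$ are the corresponding free boundaries. Then there exist constants $\varepsilon_0=\varepsilon_0(\widehat M,b,T,\hat H,u_0)>0$ and $C=C(\widehat M,b,T,\hat H,u_0)>0$ such that if $\|s-\widetilde s\|_{W^{1,\infty}}<\varepsilon_0$, then $$\|u_0-\widetilde u_0\|_{L^2(0,b)}\le \frac{C}{\left|\ln\left(\left|\ln\left(\|s-\widetilde s\|_{W^{1,\infty}}\right)\right|\right)\right|^{1/4}} .$$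
   Context: The one-phase Stefan problem with data $(h,u_0)$, where $h\in C([0,T])$, $h>0$ on $[0,T]$, and $u_0\in C([0,b])$ with $0\le u_0(x)\le H(b-x)$ on $[0,b]$, consists in finding $s\in C^1((0,T])\cap C([0,T])$ with $s>0$, and $u\in C(\overline{Q_{s,T}})\cap C^{2,1}(Q_{s,T})$, where $Q_{s,T}=\{(x,t): 0<x<s(t),\ 0<t<T\}$, such that $$u_t-u_{xx}=0 \ \text{ in } Q_{s,T},\qquad -u_x(0,t)=h(t)\ (0<t<T),\qquad u(x,0)=u_0(x)\ (0<x<b),$$ $$-u_x(s(t),t)=\dot s(t)\ (0<t<T),\qquad u(s(t),t)=0\ (0<t<T),\qquad s(0)=b.$$ Under these assumptions the problem has a unique solution $(u,s)$ (known result), and $0\le \dot s(t)\le \max\{\|h\|_\infty,H\}$ on $(0,T]$. The function $s$ is called the free boundary. Elements of $H^1(0,b)$ are identified with their continuous representatives. $\|\cdot\|_{W^{1,\infty}}$ is the norm of $W^{1,\infty}(0,T)$, and $\|\cdot\|_\infty$ is the sup norm on $[0,T]$. The constant $H$ is fixed throughout, so dependence of constants on $H$ is not listed. When $s=\widetilde s$ the right-hand side of the estimate is read as its limiting value $0$. *)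

(* Defs.v *)
From mathcomp Require Import all_boot all_order all_algebra.
From mathcomp Require Import all_classical all_reals all_analysis.
Import Order.TTheory GRing.Theory Num.Theory.
Import numFieldNormedType.Exports.

Set Implicit Arguments.
Unset Strict Implicit.
Unset Printing Implicit Defensive.

Local Open Scope classical_set_scope.
Local Open Scope ring_scope.

(* Functions on an interval are total functions on R of which only the values
   on that interval are used.  Functions of (x, t) are functions of a pair. *)

Section Sobolev.
Context {R : realType}.
Implicit Types (a b : R) (f g phi : R -> R).

Definition test_function a b phi : Prop :=
  [/\ forall n x, derivable (derive1n n phi) x 1,
      compact (closure [set x | phi x != 0]) &
      closure [set x | phi x != 0] `<=` `]a, b[].

Definition is_weak_deriv a b f g : Prop :=
  [/\ locally_integrable `]a, b[ f, locally_integrable `]a, b[ g &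
      forall phi, test_function a b phi ->
        \int[lebesgue_measure]_(x in `]a, b[) (f x * phi^`()%classic x) =
        - \int[lebesgue_measure]_(x in `]a, b[) (g x * phi x)].

(* Weak derivatives are unique only up to null sets, and this picks one of
   them; it is meaningful only when f has a weak derivative on ]a, b[. *)
Definition weak_deriv a b f : R -> R :=
  xget (cst 0) [set g | is_weak_deriv a b f g].

Definition Lp_norm (p : \bar R) a b f : \bar R :=
  'N[lebesgue_measure]_p[EFin \o (f \_ `]a, b[)]%E.

Definition in_L2 a b f : Prop :=
  measurable_fun `]a, b[ f /\ (Lp_norm 2%:E a b f < +oo)%E.

Definition in_H1 a b f : Prop :=
  in_L2 a b f /\ exists g, is_weak_deriv a b f g /\ in_L2 a b g.

Definition H1_norm a b f : \bar R :=
  ((Lp_norm 2%:E a b f `^ 2 + Lp_norm 2%:E a b (weak_deriv a b f) `^ 2)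
     `^ 2^-1)%E.

Definition W1oo_norm a b f : \bar R :=
  (Lp_norm +oo a b f + Lp_norm +oo a b (weak_deriv a b f))%E.

Definition sup_norm a b f : R := sup [set `|f x| | x in `[a, b]].

End Sobolev.

Section Stefan.
Context {R : realType}.

(* Derivative relative to a set; one-sided at the endpoints of an interval. *)
Definition has_deriv_within (A : set R) (f : R -> R) (x l : R) : Prop :=
  (f y - f x) / (y - x) @[y --> within A x^'] --> l.

Definition C1_on (A : set R) (f : R -> R) : Prop :=
  exists df : R -> R, {within A, continuous df} /\
    forall x, A x -> has_deriv_within A f x (df x).

Definition partial_x (u : R * R -> R) : R * R -> R :=
  fun p => (fun x => u (x, p.2))^`()%classic p.1.

Definition partial_t (u : R * R -> R) : R * R -> R :=
  fun p => (fun t => u (p.1, t))^`()%classic p.2.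

Definition C21_on (Q : set (R * R)) (u : R * R -> R) : Prop :=
  (forall p, Q p ->
     [/\ derivable (fun x => u (x, p.2)) p.1 1,
         derivable (fun x => partial_x u (x, p.2)) p.1 1 &
         derivable (fun t => u (p.1, t)) p.2 1]) /\
  [/\ {within Q, continuous u},
      {within Q, continuous (partial_x u)},
      {within Q, continuous (partial_x (partial_x u))} &
      {within Q, continuous (partial_t u)}].

Definition stefan_domain (s : R -> R) (T : R) : set (R * R) :=
  [set p | 0 < p.1 < s p.2 /\ 0 < p.2 < T].

Record stefan_solution (b T : R) (h u0 : R -> R) (u : R * R -> R)
    (s : R -> R) : Prop := {
  stefan_s_C1 : C1_on `]0, T] s;
  stefan_s_cont : {within `[0, T], continuous s};
  stefan_s_gt0 : forall t, 0 <= t <= T -> 0 < s t;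
  stefan_u_cont : {within closure (stefan_domain s T), continuous u};
  stefan_u_C21 : C21_on (stefan_domain s T) u;
  stefan_heat : forall p, stefan_domain s T p ->
    partial_t u p - partial_x (partial_x u) p = 0;
  stefan_flux : forall t, 0 < t < T ->
    has_deriv_within `[0, s t] (fun x => u (x, t)) 0 (- h t);
  stefan_init : forall x, 0 < x < b -> u (x, 0) = u0 x;
  stefan_front : forall t, 0 < t < T ->
    has_deriv_within `[0, s t] (fun x => u (x, t)) (s t) (- s^`()%classic t);
  stefan_dirichlet : forall t, 0 < t < T -> u (s t, t) = 0;
  stefan_s_init : s 0 = b
}.

(* The value 0 at d = 0 is the limit of the expression as d tends to 0. *)
Definition loglog_rate (C d : R) : R :=
  if d == 0 then 0 else C / (`|ln `|ln d| | `^ 4^-1).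

End Stefan.

(* Main.v *)
Require Import Defs.
From mathcomp Require Import all_boot all_order all_algebra.
From mathcomp Require Import all_classical all_reals all_analysis.
From mathcomp Require Import measurable_realfun ess_sup_inf.
From mathcomp Require Import ring lra.
Import Order.TTheory GRing.Theory Num.Theory.
Import numFieldNormedType.Exports.

(** The free boundary alone determines the exponential moments of the initial
    datum. If [c'' = lam^2 c] and [c' 0 = 0], that is, if [c] is a multiple of
    [cosh (lam x)], then Green's formula under the front gives

      d/dt (e^(-lam^2 t) (int_0^(s t) u c dx + c' (s t) / lam^2))
        = e^(-lam^2 t) (h t * c 0 - c' (s t)),

    because [u = 0] and [- u_x = s'] on the front ([enthalpy_identity]). For two
    solutions with the same flux [h] the terms in [h] cancel. Integrated between
    time 0 and a fixed time [tf], this bounds the moment of [u0 - u0'] against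
    [cosh (lam x)] by two terms: one is the distance [d] between the fronts times
    a factor of order [(1 + lam^2) e^(lam S)], where [S] bounds both fronts; the
    other comes from time [tf] and is of order [e^(lam S - lam^2 tf)], which is
    tiny for large [lam] since the diffusion factor wins ([moment_estimate]).

    From moments to values. For [m >= e^(lam S)] the function
    [1 - (1 - e^(lam (x - a)) / m)^m] is within [e^(-lam |x - a|)] of the indicator
    of [x > a] on [[0, S]], and by the binomial formula it is a combination of the
    exponentials [e^(k lam x)], [1 <= k <= m]. So the integral of [u0 - u0'] over [[a, S]] is
    [O(1 / lam)], plus the sum of the moment bounds. In that sum the first term
    above is still tiny, while [d] gets multiplied by [exp (exp (lam (S + 1)))]
    ([tail_of_moments]): this double exponential is where the double logarithm of
    the theorem originates.

    Initial data bounded in [H^1] are Hoelder continuous with exponent 1/2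
    ([H1_hoelder]). Averaging over an interval of length [kappa^-2], with
    [lam = kappa^3], turns the tail bound into a pointwise bound [O(1 / kappa)]
    that holds as soon as [d <= exp (- exp (kappa^4))] ([sup_of_moments]). When
    equality holds here, [kappa] is the fourth root of [ln |ln d|]. If the fronts
    agree, every large [kappa] is allowed and the data are equal.

    Making Green's formula legitimate is most of the work, since the boundary
    conditions only hold as one-sided derivatives at each time and nothing is known
    about [u_x] up to the boundary. The maximum principle gives
    [0 <= u <= K (s - x)] and hence [0 <= s' <= K] ([temp_ge0], [temp_le]). Green's
    formula is applied to [u] times a smooth cutoff; what the derivatives of the
    cutoff pick up in layers of width [eps] converges to the boundary fluxes at each
    time ([flux_layer_cvg]). To pass to the limit under the time integral, these
    layers must be bounded uniformly in time. At the front the bound on [u] does it;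
    at [x = 0] it follows from a Lipschitz estimate obtained by doubling the space
    variable ([lipschitz_at_flux_boundary]). *)

Set Implicit Arguments.
Unset Strict Implicit.
Unset Printing Implicit Defensive.

Local Open Scope classical_set_scope.
Local Open Scope ring_scope.

Ltac lin := clear; lra.

Ltac order_lra :=
  repeat match goal with
  | H : ?P |- _ =>
    lazymatch P with
    | is_true _ => fail
    | @eq (Real.sort _) _ _ => fail
    | _ => clear H
    end
  end; lra.

(** * Integrals over compact intervals *)

Section Integrals.
Context {R : realType}.
Implicit Types (f g F : R -> R) (a b p q m : R).
Notation mu := (@lebesgue_measure R).

Lemma integrable_within a b f : {within `[a, b], continuous f} ->
  mu.-integrable `[a, b] (EFin \o f).
Proof.
by move=> cf; apply: continuous_compact_integrable => //; exact: segment_compact.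
Qed.

Lemma integrable_cont a b f : continuous f -> mu.-integrable `[a, b] (EFin \o f).
Proof. by move=> cf; apply: integrable_within; exact: continuous_subspaceT. Qed.

Lemma Rintegral_cst_itv a b m : a <= b -> \int[mu]_(x in `[a, b]) m = m * (b - a).
Proof.
move=> ab; rewrite Rintegral_cst//= lebesgue_measure_itv/= lte_fin.
by case: ltgtP ab => //= ->; rewrite ?subrr ?mulr0.
Qed.

Lemma FTC2_within f F a b : a <= b ->
  {within `[a, b], continuous f} -> {within `[a, b], continuous F} ->
  (forall x : R, a < x < b -> is_derive x 1 F (f x)) ->
  \int[mu]_(x in `[a, b]) f x = F b - F a.
Proof.
rewrite le_eqVlt => /predU1P[-> _ _ _|ab cf cF dF].
  by rewrite set_itv1 Rintegral_set1 subrr.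
rewrite /Rintegral (@continuous_FTC2 _ _ F)//.
- have /(continuous_within_itvP _ ab)[? ? ?] := cF; split => // x.
  by rewrite in_itv/= => /dF [].
- by move=> x; rewrite in_itv/= => /dF h; rewrite derive1E derive_val.
Qed.

Lemma FTC2_cont f F a b : a <= b -> continuous f ->
  (forall x : R, is_derive x 1 F (f x)) ->
  \int[mu]_(x in `[a, b]) f x = F b - F a.
Proof.
move=> ab cf dF; apply: FTC2_within => //.
- exact: continuous_subspaceT.
- apply: continuous_subspaceT => x; apply: differentiable_continuous.
  by apply/derivable1_diffP; have [] := dF x.
Qed.

Lemma Rintegral_cat a b c f : a <= c -> c <= b -> continuous f ->
  \int[mu]_(x in `[a, b]) f x = \int[mu]_(x in `[a, c]) f x + \int[mu]_(x in `[c, b]) f x.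
Proof.
move=> ac cb cf; have := @Rintegral_itvB R f (BLeft a) (BRight b) c (integrable_cont a b cf).
rewrite !bnd_simp => /(_ ac cb) h.
rewrite -(@Rintegral_itv_obnd_cbnd R c) -?h; first by rewrite addrC subrK.
apply: integrableS (integrable_cont c b cf) => //.
by apply: subset_itvr; rewrite bnd_simp.
Qed.

Lemma Rintegral_subitv_support a b p q f : a <= p -> p <= q -> q <= b ->
  continuous f -> (forall x, a <= x <= b -> x <= p \/ q <= x -> f x = 0) ->
  \int[mu]_(x in `[a, b]) f x = \int[mu]_(x in `[p, q]) f x.
Proof.
move=> ap pq qb cf f0.
have z c d : a <= c -> c <= d -> d <= b -> (d <= p \/ q <= c) ->
    \int[mu]_(x in `[c, d]) f x = 0.
  move=> ac cd db h; rewrite -[RHS](mul0r (d - c)) -(Rintegral_cst_itv 0 cd).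
  apply: eq_Rintegral => x /[!inE]/= /[!in_itv]/= /andP[cx xd].
  by apply: f0; [lra|case: h => h; [left|right]; lra].
rewrite (Rintegral_cat (le_trans ap pq) qb cf) (Rintegral_cat ap pq cf).
rewrite (z a p) ?(z q b) ?add0r ?addr0//; first [lra|by left|by right].
Qed.

Lemma Rintegral_norm_le a b m f : a <= b -> {within `[a, b], continuous f} ->
  (forall x, a <= x <= b -> `|f x| <= m) ->
  `|\int[mu]_(x in `[a, b]) f x| <= m * (b - a).
Proof.
move=> ab cf fm; rewrite -(Rintegral_cst_itv m ab).
have cn : {within `[a, b], continuous (fun x => `|f x|)}.
  by move=> x; apply: continuous_comp; [exact: cf|exact: norm_continuous].
apply: le_trans (le_normr_Rintegral _ (integrable_within cf)) _ => //.
apply: le_Rintegral => //.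
- exact: integrable_within cn.
- by apply: integrable_cont => x; exact: cvg_cst.
Qed.

Lemma Rintegral_layer_le a b p q m f : a <= p -> p <= q -> q <= b ->
  continuous f -> (forall x, a <= x <= b -> x <= p \/ q <= x -> f x = 0) ->
  (forall x, p <= x <= q -> `|f x| <= m) ->
  `|\int[mu]_(x in `[a, b]) f x| <= m * (q - p).
Proof.
move=> ap pq qb cf f0 fm; rewrite (Rintegral_subitv_support ap pq qb)//.
by apply: Rintegral_norm_le => //; exact: continuous_subspaceT.
Qed.

Lemma Rintegral_left_layer_le a b q m f : a <= q -> q <= b -> continuous f ->
  (forall x, q <= x <= b -> f x = 0) -> (forall x, a <= x <= q -> `|f x| <= m) ->
  `|\int[mu]_(x in `[a, b]) f x| <= m * (q - a).
Proof.
move=> aq qb cf f0 fm; rewrite (Rintegral_cat aq qb cf).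
rewrite (_ : \int[mu]_(x in `[q, b]) f x = 0) ?addr0.
  by apply: Rintegral_norm_le => //; exact: continuous_subspaceT.
rewrite -[RHS](mul0r (b - q)) -(Rintegral_cst_itv 0 qb).
by apply: eq_Rintegral => x /[!inE]/= /[!in_itv]/=; exact: f0.
Qed.

Lemma RintegralD_cont a b f g : {within `[a, b], continuous f} -> {within `[a, b], continuous g} ->
  \int[mu]_(x in `[a, b]) (f x + g x) =
  \int[mu]_(x in `[a, b]) f x + \int[mu]_(x in `[a, b]) g x.
Proof. by move=> cf cg; apply: RintegralD => //; exact: integrable_within. Qed.

Lemma RintegralB_cont a b f g : {within `[a, b], continuous f} -> {within `[a, b], continuous g} ->
  \int[mu]_(x in `[a, b]) (f x - g x) =
  \int[mu]_(x in `[a, b]) f x - \int[mu]_(x in `[a, b]) g x.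
Proof. by move=> cf cg; apply: RintegralB => //; exact: integrable_within. Qed.

Lemma RintegralZ_cont a b f m : {within `[a, b], continuous f} ->
  \int[mu]_(x in `[a, b]) (m * f x) = m * \int[mu]_(x in `[a, b]) f x.
Proof. by move=> cf; apply: RintegralZl => //; exact: integrable_within. Qed.

Lemma Rintegral_dominated a b f g : continuous f -> continuous g ->
  (forall x, a <= x <= b -> `|f x| <= g x) ->
  `|\int[mu]_(x in `[a, b]) f x| <= \int[mu]_(x in `[a, b]) g x.
Proof.
move=> cf cg fg; have cn : continuous (fun x => `|f x|).
  by move=> x; apply: continuous_comp; [exact: cf|exact: norm_continuous].
apply: le_trans (le_normr_Rintegral _ (integrable_cont a b cf)) _ => //.
by apply: le_Rintegral => //; exact: integrable_cont.
Qed.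

Lemma Rintegral_sum_cont a b n (F : nat -> R -> R) : (forall i, continuous (F i)) ->
  \int[mu]_(x in `[a, b]) (\sum_(i < n) F i x) = \sum_(i < n) \int[mu]_(x in `[a, b]) F i x.
Proof.
move=> cF; have cS (m : nat) : continuous (fun x => \sum_(i < m) F i x).
  elim: m => [|m IH] x; first by under eq_fun do rewrite big_ord0; exact: cvg_cst.
  by under eq_fun do rewrite big_ord_recr/=; apply: cvgD; [exact: IH|exact: cF].
elim: n => [|n IH].
  by under eq_Rintegral do rewrite big_ord0; rewrite Rintegral_cst//= mul0r big_ord0.
under eq_Rintegral do rewrite big_ord_recr/=.
rewrite RintegralD_cont; last 2 first.
- by apply: continuous_subspaceT; exact: cS.
- by apply: continuous_subspaceT; exact: cF.
by rewrite IH big_ord_recr.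
Qed.

End Integrals.

(** * Continuity and derivatives in epsilon-delta form *)

Section EpsilonDelta.
Context {R : realType}.
Implicit Types (f g F : R -> R) (a b x y l e r : R).

Lemma is_derive_eps f x l : is_derive x 1 f l -> forall e, 0 < e ->
  exists2 d : R, 0 < d & forall y, `|y - x| < d -> `|f y - f x - l * (y - x)| <= e * `|y - x|.
Proof.
move=> [df <-] e e0.
have := df; rewrite /derivable -/(derive f x 1) => /cvgrPdist_le /(_ e e0).
rewrite near_withinE => /nbhs_ballP [d /= d0 H]; exists d => // y yd.
have [->|yx] := eqVneq y x; first by rewrite !subrr mulr0 subrr normr0 mulr0.
have yx0 : y - x != 0 by rewrite subr_eq0.
have := H (y - x); rewrite /ball/= sub0r normrN => /(_ yd yx0).
have e1 : (y - x) *: 1 + x = y by rewrite /GRing.scale/= mulr1 subrK.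
rewrite e1 => h.
rewrite -ler_pdivrMr ?normr_gt0// -normf_div mulrBl mulfK// distrC.
by move: h; rewrite /GRing.scale/= [_ * (f y - _)]mulrC.
Qed.

Lemma has_deriv_within_eps A f x l : has_deriv_within A f x l -> forall e, 0 < e ->
  exists2 d : R, 0 < d & forall y, A y -> `|y - x| < d ->
    `|f y - f x - l * (y - x)| <= e * `|y - x|.
Proof.
move=> /cvgrPdist_le df e e0; have := df e e0.
rewrite !near_withinE => /nbhs_ballP [d /= d0 H]; exists d => // y Ay yd.
have [->|yx] := eqVneq y x; first by rewrite !subrr mulr0 subrr normr0 mulr0.
have yx0 : y - x != 0 by rewrite subr_eq0.
have := H y; rewrite /ball/= distrC => /(_ yd yx Ay) h.
by rewrite -ler_pdivrMr ?normr_gt0// -normf_div mulrBl mulfK// distrC.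
Qed.

Lemma is_derive_of_eps f x l : (forall e, 0 < e ->
  exists2 d : R, 0 < d & forall y, `|y - x| < d -> `|f y - f x - l * (y - x)| <= e * `|y - x|) ->
  is_derive x 1 f l.
Proof.
move=> H.
have cv : h^-1 *: (f (h *: 1 + x) - f x) @[h --> 0^'] --> l.
  apply/cvgrPdist_le => e e0; have [d d0 Hd] := H e e0.
  rewrite near_withinE; apply/nbhs_ballP; exists d => //= h.
  rewrite /ball/= sub0r normrN => hd h0.
  have := Hd (h + x); rewrite addrK => /(_ hd).
  rewrite /GRing.scale/= mulr1 => h1.
  rewrite distrC -[X in _ - X](mulKf h0) -mulrBr normrM normfV.
  by rewrite ler_pdivrMl ?normr_gt0// [h * l]mulrC [_ * e]mulrC.
apply: DeriveDef; first by apply/cvg_ex; exists l.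
exact: cvg_lim cv.
Qed.

Lemma continuous_eps f x : {for x, continuous f} <-> forall e, 0 < e ->
  exists2 d : R, 0 < d & forall y, `|y - x| < d -> `|f y - f x| < e.
Proof.
split=> [/cvgrPdist_lt H e /H /nbhs_ballP [d /= d0 Hd]|H].
  by exists d => // y yd; rewrite distrC; apply: Hd; rewrite /ball/= distrC.
apply/cvgrPdist_lt => e /H [d d0 Hd]; apply/nbhs_ballP; exists d => //= y.
by rewrite /ball/= distrC => /Hd; rewrite distrC.
Qed.

Lemma within_continuous_eps (A : set R) f : {within A, continuous f} <-> forall x, A x ->
  forall e, 0 < e ->
  exists2 d : R, 0 < d & forall y, A y -> `|y - x| < d -> `|f y - f x| < e.
Proof.
split=> [/subspace_continuousP H x Ax e e0|H].
  have /cvgrPdist_lt /(_ e e0) := H x Ax.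
  rewrite near_withinE => /nbhs_ballP [d /= d0 Hd].
  by exists d => // y Ay yd; rewrite distrC; apply: Hd => //; rewrite /ball/= distrC.
apply/subspace_continuousP => x Ax; apply/cvgrPdist_lt => e e0.
have [d d0 Hd] := H x Ax e e0.
rewrite near_withinE; apply/nbhs_ballP; exists d => //= y.
by rewrite /ball/= distrC => yd Ay; rewrite distrC; apply: Hd.
Qed.

Lemma within2_continuous_eps (A : set (R * R)) (f : R * R -> R) :
  {within A, continuous f} <-> forall x t, A (x, t) ->
  forall e, 0 < e -> exists2 d : R, 0 < d & forall y tau, A (y, tau) ->
    `|y - x| < d -> `|tau - t| < d -> `|f (y, tau) - f (x, t)| < e.
Proof.
split=> [/subspace_continuousP H x t Ax e e0|H].
  have /cvgrPdist_lt /(_ e e0) := H (x, t) Ax.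
  rewrite near_withinE => /nbhs_ballP [d /= d0 Hd].
  exists d => // y tau Ay yd td; rewrite distrC; apply: Hd => //.
  by split; rewrite /ball/= distrC.
apply/subspace_continuousP => -[x t] Ax; apply/cvgrPdist_lt => e e0.
have [d d0 Hd] := H x t Ax e e0.
rewrite near_withinE; apply/nbhs_ballP; exists d => //= -[y tau].
by rewrite /ball/= => -[/= yd td] Ay; rewrite distrC; apply: Hd => //; rewrite distrC.
Qed.

Lemma continuous2_eps (f : R * R -> R) x t : {for (x, t), continuous f} <->
  forall e, 0 < e -> exists2 d : R, 0 < d & forall y tau,
    `|y - x| < d -> `|tau - t| < d -> `|f (y, tau) - f (x, t)| < e.
Proof.
split=> [/cvgrPdist_lt H e e0|H].
  have /nbhs_ballP [d /= d0 Hd] : nbhs ((x, t) : R * R) [set p | `|f (x, t) - f p| < e] := H e e0.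
  exists d => // y tau yd td; rewrite distrC; apply: (Hd (y, tau)).
  by split; rewrite /ball/= distrC.
apply/cvgrPdist_lt => e /H [d d0 Hd].
suff : nbhs ((x, t) : R * R) [set p | `|f (x, t) - f p| < e] by [].
apply/nbhs_ballP; exists d => //= -[y tau].
by rewrite /ball/= => -[/= yd td]; rewrite distrC; apply: Hd; rewrite distrC.
Qed.

Lemma derive_continuous_for f x l : is_derive x 1 f l -> {for x, continuous f}.
Proof.
move=> df; apply: differentiable_continuous.
by apply/derivable1_diffP; have [] := df.
Qed.

Lemma is_derive_continuous f g : (forall x, is_derive x 1 f (g x)) -> continuous f.
Proof. by move=> df x; exact: derive_continuous_for (df x). Qed.

Lemma within_continuous_for a b f : (forall x, a <= x <= b -> {for x, continuous f}) ->
  {within `[a, b], continuous f}.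
Proof.
move=> cf; apply/within_continuous_eps => x; rewrite /= in_itv/= => xab e e0.
have /continuous_eps /(_ e e0) [d d0 Hd] := cf x xab.
by exists d => // y _; exact: Hd.
Qed.

Lemma continuous_slicel (U : R -> R -> R) t : continuous (fun p : R * R => U p.1 p.2) ->
  continuous (U^~ t).
Proof.
move=> cU x; apply/continuous_eps => e e0.
have /continuous2_eps /(_ e e0) [d d0 Hd] := cU (x, t).
by exists d => // y yd; apply: (Hd y t) => //; rewrite subrr normr0.
Qed.

Lemma continuous_slicer (U : R -> R -> R) x : continuous (fun p : R * R => U p.1 p.2) ->
  continuous (U x).
Proof.
move=> cU t; apply/continuous_eps => e e0.
have /continuous2_eps /(_ e e0) [d d0 Hd] := cU (x, t).
by exists d => // y yd; apply: (Hd x y) => //; rewrite subrr normr0.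
Qed.

(** Only earlier points are compared, so that the lemma applies at the last time of
    a closed interval. *)
Lemma left_min_derive_le0 f x l r : 0 < r -> is_derive x 1 f l ->
  (forall y, x - r < y < x -> f x <= f y) -> l <= 0.
Proof.
move=> r0 df H; rewrite leNgt; apply/negP => l0.
have [|d d0 Hd] := is_derive_eps df (e := l / 2); first lra.
have m0 : 0 < Num.min d r / 2 by rewrite divr_gt0// lt_min d0 r0.
set m := Num.min d r in m0.
have md : m <= d by rewrite ge_min lexx.
have mr : m <= r by rewrite ge_min lexx orbT.
have := Hd (x - m / 2); have := H (x - m / 2).
have -> : x - m / 2 - x = - (m / 2) by ring.
rewrite normrN (gtr0_norm m0) => h1 h2.
have {}h1 := h1 ltac:(lra); have {}h2 := h2 ltac:(lra).
have : l / 2 * (m / 2) > 0 by apply: mulr_gt0 => //; lra.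
by move: h2 h1; rewrite ler_norml => /andP[]; nra.
Qed.

(** The first derivative vanishes at [x]; were [l] negative, it would be negative
    just to the right of [x], and the mean value theorem would push [f] below its
    minimum. *)
Lemma second_derive_min f f1 x l r : 0 < r ->
  (forall y, `|y - x| < r -> is_derive y 1 f (f1 y)) -> is_derive x 1 f1 l ->
  (forall y, `|y - x| < r -> f x <= f y) -> 0 <= l.
Proof.
move=> r0 df df1 H; rewrite leNgt; apply/negP => l0.
have f10 : f1 x = 0.
  have xx : x \in `]x - r, x + r[ by rewrite in_itv/=; apply/andP; split; lra.
  have inr y : y \in `]x - r, x + r[ -> `|y - x| < r.
    by rewrite in_itv/= ltr_norml => /andP[? ?]; apply/andP; split; lra.
  have D := @derive1_at_min R f (x - r) (x + r) x ltac:(lra)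
    (fun t tI => @ex_derive _ _ _ _ _ _ _ (df t (inr t tI))) xx (fun t tI => H t (inr t tI)).
  have D1 : is_derive x 1 f (f1 x) by apply: df; rewrite subrr normr0.
  by rewrite -[LHS](derive_val (is_derive := D1)) (derive_val (is_derive := D)).
have [|d d0 Hd] := is_derive_eps df1 (e := - l / 2); first lra.
set m := Num.min d r; have m0 : 0 < m by rewrite lt_min d0 r0.
have md : m <= d by rewrite ge_min lexx.
have mr : m <= r by rewrite ge_min lexx orbT.
have xm : x < x + m / 2 by lra.
have dd y : x <= y <= x + m / 2 -> `|y - x| < m.
  by move=> ?; rewrite ger0_norm; lra.
have dfI z : x <= z <= x + m / 2 -> is_derive z 1 f (f1 z).
  by move=> zI; apply: df; apply: lt_le_trans mr; exact: dd.
have [||c] := @MVT R f f1 x (x + m / 2) xm.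
- by move=> z; rewrite in_itv/= => /andP[? ?]; apply: dfI; apply/andP; split; exact: ltW.
- by apply: derivable_within_continuous => z /[!in_itv]/= /dfI [].
rewrite in_itv/= => cI eq1.
have /andP[cI1 cI2] := cI.
have h1 : f x <= f (x + m / 2) by apply: H; apply: lt_le_trans mr; apply: dd; lra.
have : `|f1 c - f1 x - l * (c - x)| <= - l / 2 * `|c - x|.
  by apply: Hd; apply: lt_le_trans md; apply: dd; lra.
rewrite f10 subr0 [`|c - x|]ger0_norm; last lra.
rewrite ler_norml => /andP[_ h].
have : f1 c <= l / 2 * (c - x) by nra.
have : l / 2 * (c - x) < 0 by rewrite nmulr_rlt0; lra.
by nra.
Qed.

Lemma clamp_id a b x : a <= x <= b -> Num.max a (Num.min x b) = x.
Proof. by move=> /andP[ax xb]; rewrite (min_l xb) (max_r ax). Qed.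

Lemma clamp_itv a b x : a <= b -> a <= Num.max a (Num.min x b) <= b.
Proof. by move=> ab; rewrite le_max lexx ge_max ab ge_min lexx orbT. Qed.

Lemma clamp_lip a b x y :
  `|Num.max a (Num.min x b) - Num.max a (Num.min y b)| <= `|x - y|.
Proof.
rewrite ler_norml; have := ler_norm (x - y); have := ler_norm (- (x - y)).
rewrite normrN /Num.max /Num.min.
by case: (ltP x b) => ?; case: (ltP y b) => ?; case: ltP => ?; case: ltP => ? ? ?;
  apply/andP; split; lra.
Qed.

Lemma clamp_continuous a b f : a <= b -> {within `[a, b], continuous f} ->
  continuous (fun x => f (Num.max a (Num.min x b))).
Proof.
move=> ab /within_continuous_eps H x; apply/continuous_eps => e e0.
have [|d d0 Hd] := H (Num.max a (Num.min x b)) _ e e0.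
  by rewrite /= in_itv/= clamp_itv.
exists d => // y yd; apply: Hd; first by rewrite /= in_itv/= clamp_itv.
by apply: le_lt_trans yd; exact: clamp_lip.
Qed.

End EpsilonDelta.

(** * Compactness and integrals with a parameter *)

Section Compactness.
Context {R : realType}.

(** Tychonoff's theorem for two factors, by the tube argument: coverings near a
    compact set are handled one factor at a time. *)
Lemma compact_prod (T U : topologicalType) (A : set T) (B : set U) :
  compact A -> compact B -> compact (A `*` B).
Proof.
rewrite !compact_near_coveringP => cA cB I F P FF H.
pose Q (i : I) (x : T) := forall y, B y -> P i (x, y).
suff : \forall i \near F, A `<=` Q i.
  by apply: filterS => i AQ [x y] [/= Ax By]; exact: AQ.
apply: cA => x Ax.
pose G : set_system (T * I) := filter_prod (nbhs x) F.
suff : \forall ti \near G, B `<=` (fun y => P ti.2 (ti.1, y)).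
  by [].
apply: (cB _ G (fun ti y => P ti.2 (ti.1, y))) => y By.
have [[V W] /= [VN WF] VW] := H (x, y) (conj Ax By).
have [[V1 V2] /= [V1x V2y] VV] := VN.
exists (V2, V1 `*` W) => /=.
  by split => //; exists (V1, W).
move=> [y' [x' i]] [/= Vy' [Vx' Wi]].
by apply: (VW ((x', y'), i)); split => //; apply: VV.
Qed.

Lemma continuous_compact_ubound (T : topologicalType) (A : set T) (f : T -> R) :
  compact A -> {within A, continuous f} -> exists2 M : R, 0 <= M & forall x, A x -> `|f x| <= M.
Proof.
move=> cA cf; have [[x0 Ax0]|A0] := pselect (exists x, A x); last first.
  by exists 0 => // x Ax; case: A0; exists x.
have cn : {within A, continuous (fun x => `|f x|)}.
  by move=> x; apply: continuous_comp; [exact: cf|exact: norm_continuous].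
have [|c _ cM] := compact_EVT_max _ cA cn; first by exists x0.
by exists `|f c| => // x Ax; apply: cM; exact/mem_set.
Qed.

Lemma bounded_of_support (f : R -> R) : continuous f -> (forall x, x <= 1 \/ 2 <= x -> f x = 0) ->
  exists C, forall x, `|f x| <= C.
Proof.
move=> cf f0; have [C C0 HC] := continuous_compact_ubound (@segment_compact _ (1:R) 2) (continuous_subspaceT cf).
exists C => x; have [x1|x1] := lerP x 1; first by rewrite f0 ?normr0//; left.
have [x2|x2] := lerP 2 x; first by rewrite f0 ?normr0//; right.
by apply: HC; rewrite /= in_itv/= !ltW.
Qed.

Notation mu := (@lebesgue_measure R).

(** On a compact neighbourhood of the time [t] the continuous function [dk] is
    bounded, and this constant dominates the difference quotients. *)
Lemma Rintegral_param_derive (k dk : R -> R -> R) (S u v : R) : 0 <= S ->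
  (forall t x, u < t < v -> 0 <= x <= S -> is_derive t 1 (k^~ x) (dk t x)) ->
  (forall t, u < t < v -> continuous (k t)) ->
  (forall t x, u < t < v -> 0 <= x <= S ->
     {for (t, x), continuous (fun p : R * R => dk p.1 p.2)}) ->
  forall t, u < t < v ->
  is_derive t 1 (fun t => \int[mu]_(x in `[0, S]) k t x) (\int[mu]_(x in `[0, S]) dk t x) /\
  {for t, continuous (fun t => \int[mu]_(x in `[0, S]) dk t x)}.
Proof.
move=> S0 dkk ck cdk t /andP[ut tv].
pose r := Num.min (t - u) (v - t) / 2.
have r0 : 0 < r by rewrite divr_gt0// lt_min; apply/andP; split; lra.
have r1 : r <= (t - u) / 2 by rewrite /r ler_pM2r// ge_min lexx.
have r2 : r <= (v - t) / 2 by rewrite /r ler_pM2r// ge_min lexx orbT.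
have rI tau : t - r <= tau <= t + r -> u < tau < v by move=> /andP[? ?]; apply/andP; split; lra.
pose A : set (R * R) := `[t - r, t + r] `*` `[0, S].
have [|M M0 HM] := @continuous_compact_ubound _ A (fun p => dk p.1 p.2)
    (compact_prod (@segment_compact _ _ _) (@segment_compact _ _ _)).
  apply/subspace_continuousP => -[tau x] [/=]; rewrite !in_itv/= => h1 h2.
  by apply: cvg_within_filter; apply: cdk => //; exact: rI.
pose I : set R := `]t - r, t + r[%classic; pose B : set R := `[0, S]%classic.
have tI : I t by rewrite /I/= in_itv/=; apply/andP; split; lra.
have oc tau : I tau -> t - r <= tau <= t + r.
  by rewrite /I/= in_itv/= => /andP[? ?]; apply/andP; split; exact: ltW.
have intM : mu.-integrable `[0, S] (EFin \o cst M).
  by apply: integrable_cont => x; exact: cvg_cst.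
have d1E tau y : I tau -> B y -> partial1of2 k tau y = dk tau y.
  move=> /oc /rI h1; rewrite /B/= in_itv/= => h2.
  by rewrite /partial1of2 derive1E; have := dkk tau y h1 h2 => H; rewrite derive_val.
have intk tau : I tau -> mu.-integrable `[0, S] (EFin \o k tau).
  by move=> /oc /rI h; apply: integrable_cont; exact: ck.
have dk1 tau y : I tau -> B y -> derivable (k^~ y) tau 1.
  by move=> /oc /rI h1; rewrite /B/= in_itv/= => h2; have [] := dkk tau y h1 h2.
have ub tau y : I tau -> B y -> `|partial1of2 k tau y| <= cst M y.
  move=> h1 h2; rewrite d1E//; apply: (HM (tau, y)); split => //=.
  by rewrite in_itv/=; exact: oc.
split.
  apply: DeriveDef; first by apply: (derivable_under_integral _ tI intk dk1 _ intM ub).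
  rewrite -derive1E (differentiation_under_integral _ tI intk dk1 _ intM ub)//.
  by apply: eq_Rintegral => y /[!inE] yS; rewrite /= -/(partial1of2 k t y) d1E.
have /= := @continuity_under_integral R _ _ mu dk `[0, S] _ (t - r) (t + r) _ _ (cst M) intM.
move=> H; apply: H; last by rewrite inE.
- by [].
- move=> tau /oc tauI; apply: integrable_within; apply/within_continuous_eps => x; rewrite /= in_itv/= => xS e e0.
  have /continuous2_eps /(_ e e0) [d d0 Hd] := cdk tau x (rI _ tauI) xS.
  by exists d => // y _ yd; apply: Hd => //; rewrite subrr normr0.
- apply: aeW => y; rewrite /= in_itv/= => yS tau /set_mem /oc tauI.
  apply/continuous_eps => e e0.
  have /continuous2_eps /(_ e e0) [d d0 Hd] := cdk tau y (rI _ tauI) yS.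
  by exists d => // z zd; apply: Hd => //; rewrite subrr normr0.
- move=> tau h1; apply: aeW => y h2; rewrite -d1E//; exact: ub.
Qed.

End Compactness.

(** * A smooth cutoff *)

Section SmoothStep.
Context {R : realType}.
Implicit Types (f g : R -> R) (n : nat).

Lemma is_derive_local f g (x l r : R) : 0 < r ->
  (forall y : R, `|y - x| < r -> f y = g y) -> is_derive x 1 g l -> is_derive x 1 f l.
Proof.
move=> r0 fg dg; apply: is_derive_of_eps => e e0.
have [d d0 Hd] := is_derive_eps dg e0.
exists (Num.min d r); first by rewrite lt_min d0 r0.
move=> y; rewrite lt_min => /andP[yd yr].
by rewrite !fg ?subrr ?normr0//; exact: Hd.
Qed.

(** Nested existence of derivatives: unlike a statement on the iterated derivatives
    of [f], this passes through sums, products and inverses by a direct induction. *)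
Fixpoint smooth_upto n f : Prop :=
  if n is m.+1 then
    exists2 f', forall x : R, is_derive x 1 f (f' x) & smooth_upto m f'
  else True.

Lemma smooth_uptoW n f : smooth_upto n.+1 f -> smooth_upto n f.
Proof.
elim: n f => // n IH f [f' df sf'].
by exists f' => //; exact: IH.
Qed.

Lemma eq_smooth_upto n f g : f =1 g -> smooth_upto n f -> smooth_upto n g.
Proof. by move=> /funext ->. Qed.

Lemma smooth_upto_cst n c : smooth_upto n (fun=> c : R).
Proof. by elim: n c => // n IH c; exists (fun=> 0) => // x; exact: is_derive_cst. Qed.

Lemma smooth_uptoD n f g : smooth_upto n f -> smooth_upto n g ->
  smooth_upto n (fun x => f x + g x).
Proof.
elim: n f g => // n IH f g [f' df sf] [g' dg sg].
exists (fun x => f' x + g' x); last exact: IH.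
by move=> x; have := df x; have := dg x => ? ?; exact: is_deriveD.
Qed.

Lemma smooth_uptoM n f g : smooth_upto n f -> smooth_upto n g ->
  smooth_upto n (fun x => f x * g x).
Proof.
elim: n f g => // n IH f g /[dup] /smooth_uptoW sf0 [f' df sf] /[dup] /smooth_uptoW sg0 [g' dg sg].
exists (fun x => f x * g' x + g x * f' x); last by apply: smooth_uptoD; exact: IH.
move=> x; have := df x; have := dg x => ? ?.
exact: is_deriveM.
Qed.

Lemma smooth_uptoV n f : (forall x, f x != 0) -> smooth_upto n f ->
  smooth_upto n (fun x => (f x)^-1).
Proof.
move=> f0; elim: n => // n IH /[dup] /smooth_uptoW sf0 [f' df sf].
exists (fun x => (f x)^-1 * ((f x)^-1 * (-1 * f' x))).
  move=> x; apply: (is_derive_eq (@is_deriveV _ f x (f' x) 1 (f0 x) (df x))).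
  by rewrite /GRing.scale/= expr2 invfM; ring.
do 2 apply: smooth_uptoM (IH sf0) _.
by apply: smooth_uptoM => //; exact: smooth_upto_cst.
Qed.

Lemma smooth_upto_affine n f (a c : R) : smooth_upto n f ->
  smooth_upto n (fun x => f (a * x + c)).
Proof.
elim: n f => // n IH f [f' df sf].
exists (fun x => a * f' (a * x + c)).
  move=> x; have := df (a * x + c) => ?.
  have d2 : is_derive x 1 (fun x => a * x + c) a.
    by apply: is_derive_eq; rewrite /GRing.scale/=; ring.
  by apply: (is_derive_eq (@is_derive1_comp _ f (fun x => a * x + c) _ _ _ _ d2)); rewrite mulrC.
by apply: smooth_uptoM; [exact: smooth_upto_cst|exact: IH].
Qed.

(** The classical flat function [exp (- 1 / x)] is the case [n = 0]; the powers of
    [1 / x] make the family stable under differentiation. *)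
Definition flat n (x : R) : R := if 0 < x then x^-1 ^+ n * expR (- x^-1) else 0.

(** One factor [z^-1] is kept in reserve: it makes [flat n] differentiable at 0. *)
Lemma expn_expRN_le n (z : R) : 0 < z -> z ^+ n * expR (- z) <= (n.+1)`!%:R * z^-1.
Proof.
move=> z0; have h := expR_ge1Dxn n (ltW z0).
have f0 : 0 < (n.+1)`!%:R :> R by rewrite ltr0n fact_gt0.
have {}h : z ^+ n.+1 <= (n.+1)`!%:R * expR z.
  by rewrite mulrC -ler_pdivrMr//; apply: le_trans h; rewrite lerDr.
rewrite expRN ler_pdivrMr ?expR_gt0// mulrAC ler_pdivlMr//.
by rewrite -exprSr.
Qed.

Lemma is_derive_flat n (x : R) :
  is_derive x 1 (flat n) (- n%:R * flat n.+1 x + flat n.+2 x).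
Proof.
have [x0|x0|->] := ltgtP x 0.
- apply: (@is_derive_local _ (fun=> 0) _ _ (- x)); first lra.
    move=> y; rewrite ltr_norml => /andP[? ?].
    by rewrite /flat ifF//; apply/negbTE; rewrite -leNgt; lra.
  rewrite /flat (lt_gtF x0) mulr0 add0r; exact: is_derive_cst.
- pose g := fun y : R => y^-1 ^+ n * expR (- y^-1).
  apply: (@is_derive_local _ g _ _ x x0).
    move=> y; rewrite ltr_norml => /andP[? ?].
    by rewrite /flat ifT//; lra.
  have xN0 : x != 0 by rewrite gt_eqF.
  have dV : is_derive x 1 (fun y : R => y^-1) (- x ^- 2).
    apply: (is_derive_eq (@is_deriveV _ id x 1 1 xN0 (is_derive_id _ _))).
    by rewrite /GRing.scale/= mulr1.
  have dX : is_derive x 1 (fun y : R => y^-1 ^+ n) (n%:R * x^-1 ^+ n.-1 * - x ^- 2).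
    have -> : (fun y : R => y^-1 ^+ n) = (fun y : R => y^-1) ^+ n by rewrite exprfctE.
    apply: (is_derive_eq (@is_deriveX _ _ (fun y : R => y^-1) n x 1 _ dV)).
    by rewrite /GRing.scale/= mulr_natl.
  have dN : is_derive x 1 (fun y : R => - y^-1) (x ^- 2).
    by apply: (is_derive_eq (@is_deriveN _ _ _ (fun y : R => y^-1) x 1 _ dV)); rewrite opprK.
  have dE : is_derive x 1 (fun y : R => expR (- y^-1)) (expR (- x^-1) * x ^- 2).
    exact: (@is_derive1_comp _ expR (fun y : R => - y^-1)).
  apply: (is_derive_eq (@is_deriveM _ _ (fun y : R => y^-1 ^+ n) (fun y : R => expR (- y^-1)) x 1 _ _ dX dE)).
  rewrite /flat x0 /GRing.scale/= -!exprVn.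
  case: n {g dX} => [|n] /=; first by rewrite !mul0r mulr0 oppr0 mul0r !expr0; ring.
  by rewrite !exprS expr0; ring.
- have -> : - n%:R * flat n.+1 0 + flat n.+2 0 = 0 :> R by rewrite /flat ltxx mulr0 addr0.
  apply: is_derive_of_eps => e e0.
  have c0 : 0 < (n.+2)`!%:R :> R by rewrite ltr0n fact_gt0.
  exists (e / (n.+2)`!%:R); first exact: divr_gt0.
  move=> y; rewrite !subr0 mul0r subr0 {2}/flat ltxx subr0 /flat.
  case: ifPn => y0 yd; last by rewrite normr0 mulr_ge0// ltW.
  have V0 : 0 < y^-1 by rewrite invr_gt0.
  rewrite ger0_norm; last by rewrite mulr_ge0 ?exprn_ge0 ?expR_ge0// ltW.
  move: yd; rewrite gtr0_norm// ltr_pdivlMr// => yd.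
  have := expn_expRN_le n.+1 V0; rewrite invrK exprS -mulrA.
  set X := _ ^+ n * _ => h.
  rewrite -(ler_pM2l V0); apply: le_trans h _.
  by rewrite mulrCA mulVf ?mulr1 1?mulrC ?ltW// gt_eqF.
Qed.

Lemma smooth_flat m n : smooth_upto m (flat n).
Proof.
elim: m n => // m IH n.
exists (fun x => - n%:R * flat n.+1 x + flat n.+2 x); first exact: is_derive_flat.
by apply: smooth_uptoD => //; apply: smooth_uptoM => //; exact: smooth_upto_cst.
Qed.

Lemma flat0_gt0 (x : R) : 0 < x -> 0 < flat 0 x.
Proof. by move=> x0; rewrite /flat x0 expr0 mul1r expR_gt0. Qed.

Lemma flat_eq0 n (x : R) : x <= 0 -> flat n x = 0.
Proof. by move=> x0; rewrite /flat ltNge x0. Qed.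

Lemma flat0_ge0 (x : R) : 0 <= flat 0 x.
Proof. by case: (lerP x 0) => [/(flat_eq0 0)->//|/flat0_gt0/ltW]. Qed.

Definition step (x : R) : R := flat 0 x / (flat 0 x + flat 0 (1 - x)).

Let den_gt0 (x : R) : 0 < flat 0 x + flat 0 (1 - x).
Proof.
have [x0|x0] := lerP x 0; first by rewrite ltr_wpDl ?flat0_ge0// flat0_gt0//; lra.
by rewrite ltr_pwDl ?flat0_ge0// flat0_gt0.
Qed.

Lemma step_eq0 x : x <= 0 -> step x = 0.
Proof. by move=> x0; rewrite /step flat_eq0// mul0r. Qed.

Lemma step_eq1 x : 1 <= x -> step x = 1.
Proof.
move=> x1; rewrite /step (@flat_eq0 0 (1 - x)) ?addr0 ?divff//; last lra.
by rewrite gt_eqF// flat0_gt0//; lra.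
Qed.

Lemma step_itv x : 0 <= step x <= 1.
Proof.
have d0 := den_gt0 x; rewrite /step divr_ge0 ?flat0_ge0 ?(ltW d0)//=.
by rewrite ler_pdivrMr// mul1r lerDl flat0_ge0.
Qed.

Lemma smooth_step n : smooth_upto n step.
Proof.
apply: smooth_uptoM; first exact: smooth_flat.
apply: smooth_uptoV; first by move=> x; rewrite gt_eqF.
apply: smooth_uptoD; first exact: smooth_flat.
apply: eq_smooth_upto (smooth_upto_affine (-1) 1 (smooth_flat n 0)) => x /=.
by congr (flat 0 _); ring.
Qed.

Lemma smooth_upto_derive1n f : (forall n, smooth_upto n f) ->
  forall n x, derivable (derive1n n f) x 1.
Proof.
move=> sf n; elim: n f sf => [|n IH] f sf x.
  by have [f' df _] := sf 1%N; have [] := df x.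
rewrite /derive1n iterSr; apply: IH => m.
have [f' df sf'] := sf m.+1.
rewrite (_ : f^`()%classic = f')//; apply/funext => y.
by rewrite derive1E; have := df y => ?; rewrite derive_val.
Qed.

(** The values of both derivatives at the end points 1 and 2 themselves are needed
    by the layers below, where they come from continuity. *)
Lemma cutoff_exists : exists Z Z1 Z2 : R -> R,
  [/\ forall n, smooth_upto n Z, forall x : R, 0 <= Z x <= 1 &
  [/\ forall x : R, is_derive x 1 Z (Z1 x), forall x : R, is_derive x 1 Z1 (Z2 x),
      continuous Z2,
      (forall x : R, x <= 1 -> [/\ Z x = 0, Z1 x = 0 & Z2 x = 0]) &
      (forall x : R, 2 <= x -> [/\ Z x = 1, Z1 x = 0 & Z2 x = 0])]].
Proof.
have sm n := smooth_upto_affine 1 (-1) (smooth_step n).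
move: (sm 3); move=> [Z1 dZ [Z2 dZ1 [Z3 dZ2 _]]].
exists (fun x => step (1 * x - 1)), Z1, Z2.
have uniq f (x l l' : R) : is_derive x 1 f l -> is_derive x 1 f l' -> l = l'.
  by move=> [_ <-] [_ <-].
have locconst f f' (c x : R) : (forall x : R, is_derive x 1 f (f' x)) ->
    (exists2 r : R, 0 < r & forall y : R, `|y - x| < r -> f y = c) -> f' x = 0.
  move=> df [r r0 fc]; apply: (uniq f x) => //.
  exact: (@is_derive_local f (fun=> c) x 0 r r0 fc (is_derive_cst _ _ _)).
have limconst f f' (c x : R) (s : bool) : (forall x : R, is_derive x 1 f (f' x)) ->
    (forall y, (if s then y < x else x < y) -> f y = c) -> f x = c.
  move=> df fc; apply/eqP; rewrite -subr_eq0 -normr_le0; apply/ler_addgt0Pl => e e0.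
  have /continuous_eps /(_ e e0) [d d0 Hd] := (derive_continuous_for (df x)).
  pose y := if s then x - d / 2 else x + d / 2.
  have yd : `|y - x| < d by rewrite /y ltr_norml; apply/andP; case: (s); split; lra.
  have := Hd y yd; rewrite fc; last by rewrite /y; case: (s); lra.
  by rewrite distrC addr0 => /ltW.
split => //; first by move=> x; exact: step_itv.
split => //; first exact: is_derive_continuous dZ2.
- have a : forall x, x < 1 -> Z1 x = 0.
    move=> x x1; apply: (locconst _ _ 0 _ dZ); exists (1 - x); first lra.
    by move=> y; rewrite ltr_norml => /andP[? ?]; apply: step_eq0; lra.
  have b : forall x, x < 1 -> Z2 x = 0.
    move=> x x1; apply: (locconst _ _ 0 _ dZ1); exists (1 - x); first lra.
    by move=> y; rewrite ltr_norml => /andP[? ?]; apply: a; lra.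
  move=> x xle; split; first by apply: step_eq0; lra.
  + by move: xle; rewrite le_eqVlt => /predU1P[->|/a//]; exact: (limconst _ _ 0 1 true dZ1 a).
  + by move: xle; rewrite le_eqVlt => /predU1P[->|/b//]; exact: (limconst _ _ 0 1 true dZ2 b).
- have a : forall x, 2 < x -> Z1 x = 0.
    move=> x x1; apply: (locconst _ _ 1 _ dZ); exists (x - 2); first lra.
    by move=> y; rewrite ltr_norml => /andP[? ?]; apply: step_eq1; lra.
  have b : forall x, 2 < x -> Z2 x = 0.
    move=> x x1; apply: (locconst _ _ 0 _ dZ1); exists (x - 2); first lra.
    by move=> y; rewrite ltr_norml => /andP[? ?]; apply: a; lra.
  move=> x xle; split; first by apply: step_eq1; lra.
  + by move: xle; rewrite le_eqVlt => /predU1P[<-|/a//]; exact: (limconst _ _ 0 2 false dZ1 a).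
  + by move: xle; rewrite le_eqVlt => /predU1P[<-|/b//]; exact: (limconst _ _ 0 2 false dZ2 b).
Qed.

End SmoothStep.

(** * Sobolev functions are Hoelder continuous *)

Section H1Hoelder.
Context {R : realType}.
Implicit Types (f g phi : R -> R) (b M x y : R).
Notation mu := (@lebesgue_measure R).

Lemma smooth_upto_continuous f : smooth_upto 1 f -> continuous f.
Proof. by move=> [f' df _]; exact: is_derive_continuous df. Qed.

(** The derivative chosen inside [H1_norm] is a genuine one as soon as some weak
    derivative exists. *)
Lemma H1_norm_weak_deriv b f M : in_H1 0 b f -> (H1_norm 0 b f <= M%:E)%E ->
  is_weak_deriv 0 b f (weak_deriv 0 b f) /\ (Lp_norm 2%:E 0 b (weak_deriv 0 b f) <= M%:E)%E.
Proof.
move=> [_ [g [gw _]]] fM; split.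
  exact: (@xgetPex _ (cst 0) [set g | is_weak_deriv 0 b f g] (ex_intro _ g gw)).
set B := Lp_norm _ _ _ _; apply: le_trans fM; rewrite /H1_norm -/B.
have B0 : (0 <= B)%E by exact: Lnorm_ge0.
rewrite [leLHS](_ : _ = ((B `^ 2) `^ 2^-1)%E); last by rewrite -poweRrM mulfV// poweRe1.
apply: gt0_ler_poweR; rewrite ?in_itv/= ?leey ?andbT ?poweR_ge0 ?adde_ge0//; try exact: poweR_ge0.
by rewrite leeDr// poweR_ge0.
Qed.

(** Stated with a support inside [[p, q]], so that it serves a test function
    concentrated on a short interval as well as a bounded function on the whole one. *)
Lemma L2_norm_le (a b p q m : R) (f : R -> R) : 0 <= m -> p <= q -> measurable_fun `]a, b[ f ->
  (forall z, a < z < b -> `|f z| <= m) -> (forall z, a < z < b -> z <= p \/ q <= z -> f z = 0) ->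
  (Lp_norm 2%:E a b f <= (m * Num.sqrt (q - p))%:E)%E.
Proof.
move=> m0 pq mf fm f0; pose I : set R := `]a, b[%classic.
have mI : measurable I by exact: measurable_itv.
have mF : measurable_fun setT (f \_ I) by exact/(measurable_restrictT _ _).1.
have pw (z : R) : ((`|(f \_ I) z| `^ 2)%:E <= (m ^+ 2 * \1_(`[p, q]%classic : set R) z)%:E)%E.
  rewrite lee_fin indicE patchE; case: ifPn => [|_]; last first.
    by rewrite normr0 powR0 ?mulr_ge0 ?sqr_ge0// ler0n.
  rewrite inE /I/= in_itv/= => zI.
  have [zpq|zpq] := boolP (z \in (`[p, q]%classic : set R)).
    rewrite mulr1 -powR_mulrn//; apply: ge0_ler_powR; rewrite ?nnegrE//.
    exact: fm.
  rewrite f0// ?normr0 ?powR0 ?mulr0//.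
  move: zpq; rewrite notin_setE/= in_itv/= => /negP; rewrite negb_and -!ltNge.
  by case/orP => ?; [left|right]; exact: ltW.
rewrite /Lp_norm unlock /=.
have -> : (m * Num.sqrt (q - p))%:E = (((m ^+ 2 * (q - p))%:E) `^ 2^-1)%E.
  rewrite poweR_EFin powR12_sqrt ?mulr_ge0 ?sqr_ge0 ?subr_ge0//.
  by rewrite sqrtrM ?sqr_ge0// sqrtr_sqr ger0_norm.
apply: gt0_ler_poweR; rewrite ?in_itv/= ?leey ?andbT ?lee_fin ?mulr_ge0 ?sqr_ge0 ?subr_ge0//.
  by apply: integral_ge0 => z _; rewrite ?lee_fin; exact: powR_ge0.
have E : mu `[p, q]%classic = (q - p)%:E.
  by rewrite lebesgue_measure_itv/= lte_fin; case: ltgtP pq => //= ->; rewrite ?subrr.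
have -> : ((m ^+ 2 * (q - p))%:E = \int[mu]_z (m ^+ 2 * \1_(`[p, q]%classic : set R) z)%:E)%E.
  under eq_integral do rewrite EFinM.
  by rewrite ge0_integralZl_EFin ?sqr_ge0// ?EFinM -?E ?integral_indic ?setIT//; exact/measurable_EFinP/measurable_indic.
apply: ge0_le_integral => //.
- by apply/measurable_EFinP; apply: (measurableT_comp (measurable_powR 2)); exact: measurableT_comp.
- by apply/measurable_EFinP; apply: measurable_funM => //; exact: measurable_indic.
Qed.

Lemma L2_test_le b M g phi x y : 0 <= M -> 0 < x -> x <= y -> y < b ->
  measurable_fun `]0, b[ g -> (Lp_norm 2%:E 0 b g <= M%:E)%E ->
  continuous phi -> (forall z, `|phi z| <= 1) -> (forall z, z <= x \/ y <= z -> phi z = 0) ->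
  `|\int[mu]_(z in `]0, b[) (g z * phi z)| <= M * Num.sqrt (y - x).
Proof.
move=> M0 x0 xy yb mg gM cphi phi1 phi0.
pose I : set R := `]0, b[%classic.
have mI : measurable I by exact: measurable_itv.
have mG : measurable_fun setT (g \_ I) by exact/(measurable_restrictT _ _).1.
have mphi : measurable_fun setT phi by exact: continuous_measurable_fun.
have mP : measurable_fun setT (phi \_ I).
  by apply/(measurable_restrictT _ _).1 => //; exact: measurable_funTS.
have H := @hoelder _ _ R mu (g \_ I) (phi \_ I) 2 2 mG mP.
have p2 : 0 < 2 :> R by lra.
have pq : 2^-1 + 2^-1 = 1 :> R by lra.
have {}H := H p2 p2 pq.
have E1 : ('N[mu]_1[EFin \o ((g \_ I) \* (phi \_ I))%R] = \int[mu]_(z in I) `|(g z * phi z)%:E|)%E.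
  rewrite Lnorm1 [RHS]integral_mkcond; apply: eq_integral => z _ /=.
  by rewrite !patchE; case: ifPn => //; rewrite mul0r normr0.
have N2 : ('N[mu]_2%:E[EFin \o (phi \_ I)] <= (Num.sqrt (y - x))%:E)%E.
  rewrite -[X in (_ <= X%:E)%E]mul1r; apply: L2_norm_le => //; first exact: measurable_funTS.
  by move=> z _; exact: phi0.
have le2 : (\int[mu]_(z in I) `|(g z * phi z)%:E| <= (M * Num.sqrt (y - x))%:E)%E.
  by rewrite -E1; apply: le_trans H _; rewrite EFinM lee_pmul// Lnorm_ge0.
have intg : mu.-integrable I (EFin \o (fun z => g z * phi z)).
  apply/integrableP; split; last by apply: le_lt_trans le2 _; rewrite ltry.
  by apply/measurable_EFinP; apply: measurable_funM => //; exact: measurable_funTS.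
rewrite -lee_fin EFin_normr_Rintegral//; apply: le_trans le2.
by apply: le_abse_integral => //; exact: (measurable_int mu).
Qed.

Lemma Rintegral_oo_cc a b f : continuous f ->
  \int[mu]_(z in `]a, b[) f z = \int[mu]_(z in `[a, b]) f z.
Proof.
move=> cf; have ci := integrable_cont a b cf.
rewrite (@Rintegral_itv_obnd_cbnd R a (BLeft b)); last first.
  by apply: integrableS ci => //; exact: subset_itv_oo_cc.
apply: Rintegral_itv_bndo_bndc.
by apply: integrableS ci => //; exact: subset_itv_co_cc.
Qed.

(** Test the weak derivative against a smooth trapezoid between [x] and [y]: its two
    steep sides, of width [d], recover [f x] and [f y] up to the modulus of
    continuity of [f], and the Cauchy-Schwarz inequality bounds the other side by
    the square root of the length. *)
Lemma H1_hoelder b f M x y : 0 <= M -> {within `[0, b], continuous f} -> in_H1 0 b f ->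
  (H1_norm 0 b f <= M%:E)%E -> 0 < x -> x < y -> y < b ->
  `|f y - f x| <= M * Num.sqrt (y - x).
Proof.
move=> M0 cf f1 fM x0 xy yb.
have [[_ [mg _ _] wd] gM] := H1_norm_weak_deriv f1 fM.
set g := weak_deriv 0 b f in mg wd gM.
have [Z [Z1 [Z2 [smZ Z01 [dZ dZ1 cZ2 Zl Zr]]]]] := @cutoff_exists R.
have cZ : continuous Z := smooth_upto_continuous (smZ 1%N).
have cZ1 : continuous Z1 := is_derive_continuous dZ1.
have b0 : 0 <= b by order_lra.
pose fb z := f (Num.max 0 (Num.min z b)).
have cfb : continuous fb by exact: clamp_continuous.
have fbE (z : R) : 0 <= z <= b -> fb z = f z by move=> h; rewrite /fb clamp_id.
have [|C HC] := @bounded_of_support _ Z1 cZ1; first by move=> z [/Zl|/Zr] [].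
have C0 : 0 <= C := le_trans (normr_ge0 _) (HC 0).
apply/ler_addgt0Pl => e e0.
pose eta := e / (2 * (C + 1)).
have eta0 : 0 < eta by rewrite divr_gt0// mulr_gt0//; order_lra.
have [d1 d10 Hd1] := (continuous_eps fb x).1 (cfb x) eta eta0.
have [d2 d20 Hd2] := (continuous_eps fb y).1 (cfb y) eta eta0.
pose m := Num.min (Num.min d1 d2) (y - x); have [d dE] : exists d : R, d = m / 4 by exists (m / 4).
have m0 : 0 < m by rewrite !lt_min d10 d20/= subr_gt0.
have md1 : m <= d1 by rewrite /m !ge_min lexx.
have md2 : m <= d2 by rewrite /m !ge_min lexx orbT.
have mxy : m <= y - x by rewrite /m !ge_min lexx orbT.
have d0 : 0 < d by order_lra.
(* The sides of the trapezoid are [[x + d, x + 2 d]] and [[y - 2 d, y - d]]; the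
   bound on [m] keeps them disjoint. *)
pose phi (z : R) := Z ((z - x) / d) + Z ((y - z) / d) - 1.
pose dphi (z : R) := Z1 ((z - x) / d) / d - Z1 ((y - z) / d) / d.
have mulgd (u z : R) : (u <= z / d) = (u * d <= z) by rewrite ler_pdivlMr.
have muldg (u z : R) : (z / d <= u) = (z <= u * d) by rewrite ler_pdivrMr.
have dl1 (z : R) : is_derive z 1 (fun z : R => (z - x) / d) d^-1.
  by apply: is_derive_eq; rewrite /GRing.scale/=; ring.
have dl2 (z : R) : is_derive z 1 (fun z : R => (y - z) / d) (- d^-1).
  by apply: is_derive_eq; rewrite /GRing.scale/=; ring.
have dp1 (z : R) : is_derive z 1 (fun z : R => Z ((z - x) / d)) (Z1 ((z - x) / d) / d).
  exact: (@is_derive1_comp _ Z (fun z : R => (z - x) / d) z _ _ (dZ _) (dl1 z)).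
have dp2 (z : R) : is_derive z 1 (fun z : R => Z ((y - z) / d)) (- (Z1 ((y - z) / d) / d)).
  by rewrite -mulrN; exact: (@is_derive1_comp _ Z (fun z : R => (y - z) / d) z _ _ (dZ _) (dl2 z)).
have dphiE (z : R) : is_derive z 1 phi (dphi z).
  apply: is_derive_eq; last by rewrite /dphi subr0.
have smphi n : smooth_upto n phi.
  have -> : phi = fun z => (Z (d^-1 * z + - x / d) + Z (- d^-1 * z + y / d)) + -1.
    by apply/funext => z; rewrite /phi; congr (Z _ + Z _ + _); ring.
  apply: smooth_uptoD; last exact: smooth_upto_cst.
  by apply: smooth_uptoD; apply: smooth_upto_affine; exact: smZ.
have cphi : continuous phi := smooth_upto_continuous (smphi 1%N).
have phiout (z : R) : z <= x + d \/ y - d <= z -> phi z = 0.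
  case=> h; rewrite /phi.
    have [-> _ _] := @Zl ((z - x) / d) ltac:(by rewrite muldg; order_lra).
    have [-> _ _] := @Zr ((y - z) / d) ltac:(by rewrite mulgd; order_lra).
    by rewrite add0r subrr.
  have [-> _ _] := @Zr ((z - x) / d) ltac:(by rewrite mulgd; order_lra).
  have [-> _ _] := @Zl ((y - z) / d) ltac:(by rewrite muldg; order_lra).
  by rewrite addr0 subrr.
have phi1 (z : R) : `|phi z| <= 1.
  have /andP[a1 a2] := Z01 ((z - x) / d); have /andP[a3 a4] := Z01 ((y - z) / d).
  by rewrite ler_norml /phi; apply/andP; split; order_lra.
have suppI : closure [set z | phi z != 0] `<=` `[x + d, y - d]%classic.
  rewrite closureE => z; apply; split; first exact: itv_closed.
  move=> w /= w0; rewrite in_itv/=; apply/andP; split; rewrite leNgt; apply/negP => h;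
    by move/eqP: w0; apply; apply: phiout; first [by left; rewrite ltW|by right; rewrite ltW].
have tphi : test_function 0 b phi.
  split; first exact: smooth_upto_derive1n.
    apply: (subclosed_compact _ (@segment_compact _ (x + d) (y - d))) => //.
    exact: closed_closure.
  move=> z /suppI; rewrite /= !in_itv/= => /andP[? ?]; apply/andP; split; order_lra.
have cdl c : continuous (fun z : R => Z1 ((z - c) / d) / d).
  move=> z; apply: cvgMl; apply: (continuous_comp (f := fun z : R => (z - c) / d)); last exact: cZ1.
  by apply: cvgMl; apply: cvgB; [exact: cvg_id|exact: cvg_cst].
have cdr c : continuous (fun z : R => Z1 ((c - z) / d) / d).
  move=> z; apply: cvgMl; apply: (continuous_comp (f := fun z : R => (c - z) / d)); last exact: cZ1.
  by apply: cvgMl; apply: cvgB; [exact: cvg_cst|exact: cvg_id].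
pose A z := fb z * (Z1 ((z - x) / d) / d); pose B z := fb z * (Z1 ((y - z) / d) / d).
have cA : continuous A by move=> z; apply: cvgM; [exact: cfb|exact: cdl].
have cB : continuous B by move=> z; apply: cvgM; [exact: cfb|exact: cdr].
have lay c (h : R -> R) (p q : R) : continuous h -> 0 <= p -> q = p + d -> q <= b ->
    (forall z, z <= p \/ q <= z -> h z = 0) ->
    (forall z, p <= z <= q -> `|fb z - c| <= eta) -> (forall z, `|h z| <= C / d) ->
    \int[mu]_(z in `[0, b]) h z = 1 ->
    `|\int[mu]_(z in `[0, b]) (fb z * h z) - c| <= eta * C.
  move=> ch p0 qp qb h0 fc hC h1.
  rewrite -[X in _ - X]mulr1 -h1 -RintegralZ_cont; last exact: continuous_subspaceT.
  rewrite -RintegralB_cont; last 2 first.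
  - by apply: continuous_subspaceT => z; apply: cvgM; [exact: cfb|exact: ch].
  - by apply: continuous_subspaceT => z; apply: cvgM; [exact: cvg_cst|exact: ch].
  have -> : eta * C = eta * (C / d) * (q - p) by rewrite qp; field; rewrite gt_eqF.
  apply: Rintegral_layer_le => //; first by rewrite qp; order_lra.
  - by move=> z; apply: cvgB; apply: cvgM; try exact: ch; [exact: cfb|exact: cvg_cst].
  - by move=> z _ hz; rewrite h0// !mulr0 subrr.
  - by move=> z hz; rewrite -mulrBl normrM ler_pM// fc.
have Z1d z : `|Z1 z / d| <= C / d.
  by rewrite normrM [`|d^-1|]gtr0_norm ?invr_gt0// ler_wpM2r// invr_ge0 ltW.
have IA : `|\int[mu]_(z in `[0, b]) A z - fb x| <= eta * C.
  apply: (lay _ _ (x + d) (x + 2 * d)); [exact: cdl|order_lra|ring|order_lra| | | |].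
  - move=> z [] h.
      by have [_ -> _] := @Zl ((z - x) / d) ltac:(by rewrite muldg; order_lra); rewrite mul0r.
    by have [_ -> _] := @Zr ((z - x) / d) ltac:(by rewrite mulgd; order_lra); rewrite mul0r.
  - by move=> z hz; apply: ltW; apply: Hd1; rewrite ger0_norm; order_lra.
  - by move=> z; exact: Z1d.
  - rewrite (FTC2_cont b0 (cdl x) dp1).
    have [-> _ _] := @Zr ((b - x) / d) ltac:(by rewrite mulgd; order_lra).
    have [-> _ _] := @Zl ((0 - x) / d) ltac:(by rewrite muldg; order_lra).
    by rewrite subr0.
have IB : `|\int[mu]_(z in `[0, b]) B z - fb y| <= eta * C.
  apply: (lay _ _ (y - 2 * d) (y - d)); [exact: cdr|order_lra|ring|order_lra| | | |].
  - move=> z [] h.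
      by have [_ -> _] := @Zr ((y - z) / d) ltac:(by rewrite mulgd; order_lra); rewrite mul0r.
    by have [_ -> _] := @Zl ((y - z) / d) ltac:(by rewrite muldg; order_lra); rewrite mul0r.
  - by move=> z hz; apply: ltW; apply: Hd2; rewrite distrC ger0_norm; order_lra.
  - by move=> z; exact: Z1d.
  - have dp2' (z : R) : is_derive z 1 (fun z : R => - Z ((y - z) / d)) (Z1 ((y - z) / d) / d).
      by rewrite -[X in is_derive _ _ _ X]opprK; exact: is_deriveN.
    rewrite (FTC2_cont b0 (cdr y) dp2').
    have [-> _ _] := @Zl ((y - b) / d) ltac:(by rewrite muldg; order_lra).
    have [-> _ _] := @Zr ((y - 0) / d) ltac:(by rewrite mulgd; order_lra).
    by rewrite opprK oppr0 add0r.
have key : \int[mu]_(z in `]0, b[) (f z * phi^`()%classic z) =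
    \int[mu]_(z in `[0, b]) A z - \int[mu]_(z in `[0, b]) B z.
  rewrite -RintegralB_cont; [|exact: continuous_subspaceT..].
  rewrite -Rintegral_oo_cc; last by move=> z; apply: cvgB; [exact: cA|exact: cB].
  apply: eq_Rintegral => z /[!inE]/= /[!in_itv]/= /andP[z0 zb].
  rewrite derive1E (derive_val (is_derive := dphiE z)) /A /B -mulrBr fbE//.
  by rewrite !ltW.
have := L2_test_le M0 x0 (ltW xy) yb mg gM cphi phi1 _.
move=> /(_ ltac:(by move=> z [] h; apply: phiout; [left|right]; order_lra)).
have := wd phi tphi; rewrite key => kk.
rewrite -normrN -kk => fin.
have -> : f y = fb y by rewrite fbE//; order_lra.
have -> : f x = fb x by rewrite fbE//; order_lra.
have eE : eta * C <= e / 2.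
  rewrite /eta invfM mulrA -mulrA ler_piMr//; first by rewrite ltW// divr_gt0.
  by rewrite mulrC ler_pdivrMr; order_lra.
set a := Rintegral _ _ _ in IA kk fin; set a' := Rintegral _ _ _ in IB kk fin.
rewrite distrC; have -> : fb x - fb y = (a - a') - (a - fb x) + (a' - fb y) by ring.
apply: le_trans (ler_normD _ _) _; apply: le_trans (lerD (ler_normB _ _) (lexx _)) _.
by order_lra.
Qed.

End H1Hoelder.

(** * Boundary layers of the cutoff *)

Section Layers.
Context {R : realType}.
Notation mu := (@lebesgue_measure R).

Lemma cvg_Rintegral_bounded (f_ : nat -> R -> R) (f : R -> R) (a b M : R) : a <= b ->
  (forall n, {within `[a, b], continuous (f_ n)}) -> {within `[a, b], continuous f} ->
  (forall n x, a <= x <= b -> `|f_ n x| <= M) ->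
  (forall x, a <= x <= b -> f_ n x @[n --> \oo] --> f x) ->
  \int[mu]_(x in `[a, b]) f_ n x @[n --> \oo] --> \int[mu]_(x in `[a, b]) f x.
Proof.
move=> ab cf_ cf fM f_f.
have intM : mu.-integrable `[a, b] (EFin \o cst M).
  by apply: integrable_cont => x; exact: cvg_cst.
have := @dominated_cvg _ _ _ mu `[a, b]%classic (measurable_itv _) (fun n x => (f_ n x)%:E)
  (EFin \o f) (EFin \o cst M) _ _ _ intM _.
move=> H; apply: fine_cvg; rewrite fineK; last first.
  exact: integrable_fin_num (integrable_within cf).
apply: H => //.
- by move=> n; exact: measurable_int (integrable_within (cf_ n)).
- move=> x /=; rewrite in_itv/= => xab.
  by apply: cvg_EFin; [exact: nearW|exact: f_f].
Qed.

Lemma affine_continuous (g : R -> R) (p q : R) : continuous g ->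
  continuous (fun x => g (p + q * x)).
Proof.
move=> cg x; apply: (continuous_comp (f := fun x : R => p + q * x)); last exact: cg.
by apply: cvgD; [exact: cvg_cst|apply: cvgMr; exact: cvg_id].
Qed.

Lemma layer_continuous (k : R -> R) (eps p sg : R) : continuous k ->
  continuous (fun x => k (sg * (x - p) / eps)).
Proof.
move=> ck x; rewrite (_ : (fun x => _) = fun x => k (- (sg * p / eps) + sg / eps * x)).
  exact: affine_continuous.
by apply/funext => y; congr k; ring.
Qed.

Lemma layer_le (S eps p sg eta C : R) (g k : R -> R) :
  continuous g -> continuous k -> 0 < eps -> sg = 1 \/ sg = -1 ->
  0 <= p <= S -> 0 <= p + sg * (2 * eps) <= S ->
  (forall x, x <= 1 \/ 2 <= x -> k x = 0) -> (forall x, `|k x| <= C) ->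
  (forall x, 0 <= x <= S -> 0 <= sg * (x - p) <= 2 * eps -> `|g x| <= eta) ->
  `|\int[mu]_(x in `[0, S]) (g x * k (sg * (x - p) / eps))| <= 2 * eps * eta * C.
Proof.
move=> cg ck e0 sg1 pS pS2 k0 kC gle.
have cgk : continuous (fun x => g x * k (sg * (x - p) / eps)).
  by move=> x; apply: cvgM; [exact: cg|exact: layer_continuous].
have supp x : sg * (x - p) <= 0 \/ 2 * eps <= sg * (x - p) -> k (sg * (x - p) / eps) = 0.
  case=> h; apply: k0; [left; rewrite ler_pdivrMr//|right; rewrite ler_pdivlMr//].
  by move: h e0; lin.
have pt x : 0 <= x <= S -> 0 <= sg * (x - p) <= 2 * eps ->
    `|g x * k (sg * (x - p) / eps)| <= eta * C.
  by move=> xS xp; rewrite normrM ler_pM// gle.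
have -> : 2 * eps * eta * C = eta * C * (2 * eps) by ring.
case: sg1 => s1; subst sg.
  have -> : 2 * eps = (p + 2 * eps) - p by ring.
  apply: Rintegral_layer_le => //; try by move: pS pS2 e0; lin.
    by move=> x xS xx; rewrite supp ?mulr0//; case: xx => xx; [left|right]; move: xx; lin.
  by move=> x xx; apply: pt; move: xx pS pS2; lin.
have -> : 2 * eps = p - (p - 2 * eps) by ring.
apply: Rintegral_layer_le => //; try by move: pS pS2 e0; lin.
  by move=> x xS xx; rewrite supp ?mulr0//; case: xx => xx; [right|left]; move: xx; lin.
by move=> x xx; apply: pt; move: xx pS pS2; lin.
Qed.

Variables (Z Z1 Z2 : R -> R) (C1 C2 : R).
Hypothesis dZ : forall x : R, is_derive x 1 Z (Z1 x).
Hypothesis dZ1 : forall x : R, is_derive x 1 Z1 (Z2 x).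
Hypothesis cZ2 : continuous Z2.
Hypothesis Zl : forall x : R, x <= 1 -> [/\ Z x = 0, Z1 x = 0 & Z2 x = 0].
Hypothesis Zr : forall x : R, 2 <= x -> [/\ Z x = 1, Z1 x = 0 & Z2 x = 0].
Hypothesis C1P : forall x : R, `|Z1 x| <= C1.
Hypothesis C2P : forall x : R, `|Z2 x| <= C2.

Let cZ1 : continuous Z1 := is_derive_continuous dZ1.

Let dy (eps p sg x : R) : is_derive x 1 (fun x : R => sg * (x - p) / eps) (sg / eps).
Proof. by apply: is_derive_eq; rewrite /GRing.scale/=; ring. Qed.

Let dZs (eps p sg x : R) : is_derive x 1 (fun x : R => Z (sg * (x - p) / eps))
  (Z1 (sg * (x - p) / eps) * (sg / eps)).
Proof.
exact: (@is_derive1_comp _ Z (fun x : R => sg * (x - p) / eps) x _ _ (dZ _) (dy eps p sg x)).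
Qed.

Let dZ1s (eps p sg x : R) : is_derive x 1 (fun x : R => Z1 (sg * (x - p) / eps))
  (Z2 (sg * (x - p) / eps) * (sg / eps)).
Proof.
exact: (@is_derive1_comp _ Z1 (fun x : R => sg * (x - p) / eps) x _ _ (dZ1 _) (dy eps p sg x)).
Qed.

Let ends (S eps p sg : R) : 0 < eps -> sg = 1 \/ sg = -1 -> 0 <= p <= S ->
  0 <= p + sg * (2 * eps) <= S -> (sg = 1 -> p = 0) ->
  [/\ Z1 (sg * (S - p) / eps) = 0, Z1 (sg * (0 - p) / eps) = 0 &
      Z (sg * (S - p) / eps) - Z (sg * (0 - p) / eps) = sg].
Proof.
move=> e0 sg1 pS pS2 p0; case: sg1 => s1; subst sg.
  rewrite (p0 erefl) in pS2 *.
  have [|-> -> _] := @Zr (1 * (S - 0) / eps); first by rewrite ler_pdivlMr//; move: pS2; lra.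
  have [|-> -> _] := @Zl (1 * (0 - 0) / eps); first by rewrite ler_pdivrMr//; lra.
  by rewrite subr0.
have [|-> -> _] := @Zl (-1 * (S - p) / eps); first by rewrite ler_pdivrMr//; lra.
have [|-> -> _] := @Zr (-1 * (0 - p) / eps); first by rewrite ler_pdivlMr//; lra.
by rewrite sub0r.
Qed.

(** The second derivative of the rescaled cutoff annihilates constants and has first
    moment [-1]: it reads off the slope of [w] at [p], taken into the interval. The
    sign [sg] tells on which side of [p] the interval lies; a layer at a left end
    point only occurs at [p = 0]. *)
Lemma layer2 (S eps p sg l w0 eta : R) (w : R -> R) :
  continuous w -> 0 < eps -> sg = 1 \/ sg = -1 ->
  0 <= p <= S -> 0 <= p + sg * (2 * eps) <= S ->
  (sg = 1 -> p = 0) -> (forall x, 0 <= x <= S -> 0 <= sg * (x - p) <= 2 * eps ->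
     `|w x - w0 - l * (sg * (x - p))| <= eta * (sg * (x - p))) ->
  `|\int[mu]_(x in `[0, S]) (w x * (Z2 (sg * (x - p) / eps) / eps ^+ 2)) + l| <= 4 * eta * C2.
Proof.
move=> cw e0 sg1 pS pS2 p0 wl.
have eN0 : eps != 0 by rewrite gt_eqF.
have S0 : 0 <= S by case/andP: pS => *; lra.
have sg2 : sg * sg = 1 by case: sg1 => ->; ring.
pose lin x := w0 + l * (sg * (x - p)).
have clin : continuous lin.
  move=> x; apply: cvgD; first exact: cvg_cst.
  by apply: cvgMr; apply: cvgMr; apply: cvgB; [exact: cvg_id|exact: cvg_cst].
have ck : continuous (fun x : R => Z2 (sg * (x - p) / eps) / eps ^+ 2).
  by move=> x; apply: cvgMl; exact: layer_continuous.
(* An antiderivative of [lin x * Z2 (y x) / eps ^+ 2], where [y x] is the rescaled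
   variable: integrate by parts once. *)
pose G x := sg * (w0 * (Z1 (sg * (x - p) / eps) / eps) +
  l * (sg * (x - p) / eps * Z1 (sg * (x - p) / eps) - Z (sg * (x - p) / eps))).
have dG (x : R) : is_derive x 1 G (lin x * (Z2 (sg * (x - p) / eps) / eps ^+ 2)).
  have d0 := dZs eps p sg x; have d1 := dZ1s eps p sg x; have d2 := dy eps p sg x.
  apply: is_derive_eq; rewrite /GRing.scale/= /lin.
  set z2 := Z2 _; set z1 := Z1 _.
  transitivity ((sg * sg) * (w0 * z2 / eps ^+ 2 + l * (sg * (x - p)) * z2 / eps ^+ 2)).
    by field.
  by rewrite sg2; ring.
have IG : \int[mu]_(x in `[0, S]) (lin x * (Z2 (sg * (x - p) / eps) / eps ^+ 2)) = - l.
  rewrite (FTC2_cont S0 _ dG); last by move=> x; apply: cvgM; [exact: clin|exact: ck].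
  have [z1 z2 z3] := ends e0 sg1 pS pS2 p0; rewrite /G z1 z2.
  transitivity (- (sg * l * (Z (sg * (S - p) / eps) - Z (sg * (0 - p) / eps)))); first by ring.
  by rewrite z3 mulrAC sg2 mul1r.
rewrite -[X in _ + X]opprK -IG -RintegralB_cont; last 2 first.
- by apply: continuous_subspaceT => x; apply: cvgM; [exact: cw|exact: ck].
- by apply: continuous_subspaceT => x; apply: cvgM; [exact: clin|exact: ck].
have eta0 : 0 <= eta.
  have := wl (p + sg * (2 * eps)) pS2; have -> : sg * (p + sg * (2 * eps) - p) = 2 * eps.
    by rewrite addrAC subrr add0r mulrA sg2 mul1r.
  move=> h; have /(le_trans (normr_ge0 _)) := h ltac:(lra).
  by rewrite pmulr_lge0//; lra.
have cg : continuous (fun x => (w x - lin x) / eps ^+ 2).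
  by move=> x; apply: cvgMl; apply: cvgB; [exact: cw|exact: clin].
have -> : 4 * eta * C2 = 2 * eps * (eta * (2 * eps) / eps ^+ 2) * C2 by field.
under eq_Rintegral do rewrite -mulrBl mulrA mulrAC.
apply: (layer_le cg cZ2) => //; first by move=> x [/Zl|/Zr] [].
move=> x xS xp; rewrite normrM [`|_^-1|]ger0_norm ?invr_ge0 ?exprn_ge0 ?(ltW e0)//.
rewrite ler_wpM2r ?invr_ge0 ?exprn_ge0 ?(ltW e0)// /lin opprD addrA.
apply: le_trans (wl x xS xp) _.
by apply: ler_wpM2l => //; case/andP: xp.
Qed.

(** The first derivative of the rescaled cutoff has unit mass. *)
Lemma layer1 (S eps p sg w0 eta : R) (w : R -> R) :
  continuous w -> 0 < eps -> sg = 1 \/ sg = -1 ->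
  0 <= p <= S -> 0 <= p + sg * (2 * eps) <= S ->
  (sg = 1 -> p = 0) -> (forall x, 0 <= x <= S -> 0 <= sg * (x - p) <= 2 * eps ->
     `|w x - w0| <= eta) ->
  `|\int[mu]_(x in `[0, S]) (w x * (Z1 (sg * (x - p) / eps) / eps)) - w0| <= 2 * eta * C1.
Proof.
move=> cw e0 sg1 pS pS2 p0 wl.
have eN0 : eps != 0 by rewrite gt_eqF.
have S0 : 0 <= S by case/andP: pS => *; lra.
have sg2 : sg * sg = 1 by case: sg1 => ->; ring.
have ck : continuous (fun x : R => Z1 (sg * (x - p) / eps) / eps).
  by move=> x; apply: cvgMl; exact: layer_continuous.
pose G x := sg * (w0 * Z (sg * (x - p) / eps)).
have dG (x : R) : is_derive x 1 G (w0 * (Z1 (sg * (x - p) / eps) / eps)).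
  have d0 := dZs eps p sg x; apply: is_derive_eq; rewrite /GRing.scale/=.
  set z1 := Z1 _; transitivity ((sg * sg) * (w0 * z1 / eps)); first by ring.
  by rewrite sg2; ring.
have cwk : continuous (fun x => w0 * (Z1 (sg * (x - p) / eps) / eps)).
  by move=> x; apply: cvgM; [exact: cvg_cst|exact: ck].
have IG : \int[mu]_(x in `[0, S]) (w0 * (Z1 (sg * (x - p) / eps) / eps)) = w0.
  rewrite (FTC2_cont S0 cwk dG); have [_ _ z3] := ends e0 sg1 pS pS2 p0; rewrite /G.
  by rewrite -mulrBr -mulrBr z3 mulrCA sg2 mulr1.
rewrite -[X in _ - X]IG -RintegralB_cont; last 2 first.
- by apply: continuous_subspaceT => x; apply: cvgM; [exact: cw|exact: ck].
- exact: continuous_subspaceT.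
have cg : continuous (fun x => (w x - w0) / eps).
  by move=> x; apply: cvgMl; apply: cvgB; [exact: cw|exact: cvg_cst].
have -> : 2 * eta * C1 = 2 * eps * (eta / eps) * C1 by field.
under eq_Rintegral do rewrite -mulrBl mulrA mulrAC.
apply: (layer_le cg cZ1) => //; first by move=> x [/Zl|/Zr] [].
move=> x xS xp; rewrite normrM [`|_^-1|]ger0_norm ?invr_ge0 ?(ltW e0)//.
by rewrite ler_wpM2r ?invr_ge0 ?(ltW e0)// wl.
Qed.

End Layers.

(** * Green's formula and the enthalpy identity *)

(** What Green's formula needs of a solution, on the whole plane so that integrals
    have fixed bounds: [U] is the temperature continued by 0 beyond the front, and
    time is frozen outside [[0, theta]]. The boundary conditions keep their
    pointwise first-order form; [ext_lipschitz] adds the uniformity in time that the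
    one at [x = 0] lacks. *)
Record extended_solution {R : realType} (b theta K S : R) (h u0 : R -> R)
    (U Ux Uxx : R -> R -> R) (s ds : R -> R) : Prop := {
  ext_b_gt0 : 0 < b;
  ext_K_ge0 : 0 <= K;
  ext_U_cont : continuous (fun p : R * R => U p.1 p.2);
  ext_s_cont : continuous s;
  ext_h_cont : continuous h;
  ext_s_bound : forall t : R, b <= s t <= S;
  ext_U_beyond : forall x t : R, s t <= x -> U x t = 0;
  ext_U_bound : forall x t : R, 0 <= x <= s t -> 0 <= U x t <= K * (s t - x);
  ext_U_t : forall x t : R, 0 < t < theta -> 0 < x < s t -> is_derive t 1 (U x) (Uxx x t);
  ext_U_x : forall x t : R, 0 < t < theta -> 0 < x < s t -> is_derive x 1 (U^~ t) (Ux x t);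
  ext_U_xx : forall x t : R, 0 < t < theta -> 0 < x < s t -> is_derive x 1 (Ux^~ t) (Uxx x t);
  ext_Uxx_cont : forall x t : R, 0 < t < theta -> 0 < x < s t ->
    {for (x, t), continuous (fun p : R * R => Uxx p.1 p.2)};
  ext_s_t : forall t : R, 0 < t < theta -> is_derive t 1 s (ds t);
  ext_ds_cont : forall t : R, 0 < t < theta -> {for t, continuous ds};
  ext_ds_bound : forall t : R, 0 < t < theta -> 0 <= ds t <= K;
  ext_flux : forall t : R, 0 < t < theta -> forall e : R, 0 < e ->
    exists2 d : R, 0 < d & forall x : R, 0 <= x < d -> `|U x t - U 0 t + h t * x| <= e * x;
  ext_front : forall t : R, 0 < t < theta -> forall e : R, 0 < e ->
    exists2 d : R, 0 < d & forall y : R, 0 <= y < d -> `|U (s t - y) t - ds t * y| <= e * y;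
  ext_init : forall x : R, 0 < x < b -> U x 0 = u0 x;
  ext_lipschitz : forall t1 t2 : R, 0 < t1 <= t2 -> t2 < theta -> exists L d : R, 0 < d /\
    forall x t : R, t1 <= t <= t2 -> 0 <= x <= d -> `|U x t - U 0 t| <= L * x
}.

Lemma ext_temp_le {R : realType} (b theta K S : R) (h u0 : R -> R)
    (U Ux Uxx : R -> R -> R) (s ds : R -> R) (x t : R) :
  extended_solution b theta K S h u0 U Ux Uxx s ds -> 0 <= x <= S -> 0 <= U x t <= K * S.
Proof.
move=> sol /andP[x0 xS]; have K0 := ext_K_ge0 sol.
have [sx|xs] := lerP (s t) x.
  by rewrite (ext_U_beyond sol sx) lexx mulr_ge0// (le_trans x0).
have /andP[-> u1] := ext_U_bound sol (x := x) (t := t) ltac:(by rewrite x0 ltW).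
apply: le_trans u1 _; rewrite ler_wpM2l//.
by have /andP[_] := ext_s_bound sol t; move: x0; lin.
Qed.

Section Green.
Context {R : realType}.
Notation mu := (@lebesgue_measure R).
Variables (b theta K S : R) (h u0 : R -> R) (U Ux Uxx : R -> R -> R) (s ds : R -> R).
Hypothesis sol : extended_solution b theta K S h u0 U Ux Uxx s ds.

Let b0 : 0 < b.
Proof. exact: (ext_b_gt0 sol). Qed.
Let K0 : 0 <= K.
Proof. exact: (ext_K_ge0 sol). Qed.
Let cU : continuous (fun p : R * R => U p.1 p.2).
Proof. exact: ext_U_cont sol. Qed.
Let cs : continuous s.
Proof. exact: ext_s_cont sol. Qed.
Let sb t : b <= s t.
Proof. by have /andP[] := ext_s_bound sol t. Qed.
Let sS t : s t <= S.
Proof. by have /andP[] := ext_s_bound sol t. Qed.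
Let bS : b <= S.
Proof. exact: (le_trans (sb 0) (sS 0)). Qed.

Let S0 : 0 <= S.
Proof. exact: le_trans (ltW b0) bS. Qed.

Let cUx t : continuous (U^~ t).
Proof. exact: continuous_slicel cU. Qed.

Let U_le x t : 0 <= x <= S -> `|U x t| <= K * S.
Proof. by move=> xS; have /andP[v0 v1] := ext_temp_le t sol xS; rewrite ger0_norm. Qed.

Variables (lam2 : R) (c c1 : R -> R).
Hypothesis lam20 : 0 < lam2.
Hypothesis dc : forall x : R, is_derive x 1 c (c1 x).
Hypothesis dc1 : forall x : R, is_derive x 1 c1 (lam2 * c x).
Hypothesis c10 : c1 0 = 0.

Let cc : continuous c.
Proof. exact: (is_derive_continuous dc). Qed.
Let cc1 : continuous c1.
Proof. exact: (is_derive_continuous dc1). Qed.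

Variables (Z Z1 Z2 : R -> R) (C1 C2 : R).
Hypothesis dZ : forall x : R, is_derive x 1 Z (Z1 x).
Hypothesis dZ1 : forall x : R, is_derive x 1 Z1 (Z2 x).
Hypothesis cZ2 : continuous Z2.
Hypothesis Zl : forall x : R, x <= 1 -> [/\ Z x = 0, Z1 x = 0 & Z2 x = 0].
Hypothesis Zr : forall x : R, 2 <= x -> [/\ Z x = 1, Z1 x = 0 & Z2 x = 0].
Hypothesis C1P : forall x : R, `|Z1 x| <= C1.
Hypothesis C2P : forall x : R, `|Z2 x| <= C2.

Let cZ1 : continuous Z1.
Proof. exact: (is_derive_continuous dZ1). Qed.
Let cZ : continuous Z.
Proof. exact: (is_derive_continuous dZ). Qed.

Let cbound : exists2 C : R, 0 <= C & forall x : R, 0 <= x <= S -> `|c x| <= C /\ `|c1 x| <= C.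
Proof.
have [A A0 HA] := continuous_compact_ubound (@segment_compact _ 0 S) (continuous_subspaceT cc).
have [B B0 HB] := continuous_compact_ubound (@segment_compact _ 0 S) (continuous_subspaceT cc1).
exists (A + B); first exact: addr_ge0.
move=> x xS; split.
  by apply: le_trans (HA x _) _; rewrite ?lerDl//= in_itv.
by apply: le_trans (HB x _) _; rewrite ?lerDr//= in_itv.
Qed.

Section FixedEps.
Variable eps : R.
Hypothesis e0 : 0 < eps.
Hypothesis eb : 4 * eps <= b.

(** A cutoff of the segment under the front: it vanishes within [eps] of both ends
    and is 1 at distance [2 eps] from them. *)
Definition cut t x := Z (x / eps) + Z ((s t - x) / eps) - 1.
Definition cut1 t x := Z1 (x / eps) / eps - Z1 ((s t - x) / eps) / eps.
Definition cut2 t x := Z2 (x / eps) / eps ^+ 2 + Z2 ((s t - x) / eps) / eps ^+ 2.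
Definition phi t x := c x * cut t x.
Definition phi1 t x := c1 x * cut t x + c x * cut1 t x.
Definition phi2 t x := lam2 * (c x * cut t x) + 2 * (c1 x * cut1 t x) + c x * cut2 t x.
Definition cut_density t x := U x t * phi t x.
Definition cut_density_t t x := Uxx x t * phi t x + U x t * (c x * (Z1 ((s t - x) / eps) * (ds t / eps))).

Lemma cut_vanish t x : x <= eps \/ s t - eps <= x ->
  [/\ cut t x = 0, cut1 t x = 0, cut2 t x = 0 & Z1 ((s t - x) / eps) = 0].
Proof.
have e0' := e0; have eb' := eb; have b0' := b0; have bS' := bS.
move=> h0; rewrite /cut /cut1 /cut2; have := sb t.
case: h0 => h0 sbt.
  have [-> -> ->] := @Zl (x / eps) ltac:(by rewrite ler_pdivrMr//; lra).
  have [-> -> ->] := @Zr ((s t - x) / eps) ltac:(by rewrite ler_pdivlMr//; lra).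
  by rewrite !mul0r subr0 addr0 add0r subrr.
have [-> -> ->] := @Zr (x / eps) ltac:(by rewrite ler_pdivlMr//; lra).
have [-> -> ->] := @Zl ((s t - x) / eps) ltac:(by rewrite ler_pdivrMr//; lra).
by rewrite !mul0r !subr0 !addr0 subrr.
Qed.

(* At every point either the equation is available, or the cutoff vanishes
   identically nearby. *)
Let trichotomy t x : 0 < x < s t \/ exists2 r : R, 0 < r & forall tau y : R,
  `|tau - t| < r -> `|y - x| < r -> y <= eps \/ s tau - eps <= y.
Proof.
have e0' := e0; have eb' := eb; have b0' := b0; have bS' := bS.
have [x0|x0] := lerP x 0.
  right; exists eps => // tau y _; rewrite ltr_norml => /andP[_ ?]; left; lra.
have [xs|xs] := ltrP x (s t); first by left; apply/andP.
right; have eps2 : 0 < eps / 2 by lra.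
have /continuous_eps /(_ _ eps2) [d d0 Hd] := @cs t.
exists (Num.min d (eps / 2)); first by rewrite lt_min d0 eps2.
move=> tau y; rewrite !lt_min => /andP[/Hd h1 _] /andP[_ h2]; right.
by move: h1 h2; rewrite !ltr_norml => /andP[? ?] /andP[? ?]; lra.
Qed.

Let d_left (x : R) : is_derive x 1 (fun x : R => x / eps) eps^-1.
Proof. by apply: is_derive_eq; rewrite /GRing.scale/=; ring. Qed.

Let d_right (t x : R) : is_derive x 1 (fun x : R => (s t - x) / eps) (- eps^-1).
Proof. by apply: is_derive_eq; rewrite /GRing.scale/=; ring. Qed.

Let dX (t x : R) : is_derive x 1 (cut t) (cut1 t x).
Proof.
have d1 := @is_derive1_comp _ Z (fun x : R => x / eps) x _ _ (dZ _) (d_left x).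
have d2 := @is_derive1_comp _ Z (fun x : R => (s t - x) / eps) x _ _ (dZ _) (d_right t x).
have := is_deriveB (is_deriveD d1 d2) (@is_derive_cst R R R (1 : R) x 1).
by move=> d3; apply: (is_derive_eq d3); rewrite /cut1; ring.
Qed.

Let dX1 (t x : R) : is_derive x 1 (cut1 t) (cut2 t x).
Proof.
have d1 := @is_derive1_comp _ Z1 (fun x : R => x / eps) x _ _ (dZ1 _) (d_left x).
have d2 := @is_derive1_comp _ Z1 (fun x : R => (s t - x) / eps) x _ _ (dZ1 _) (d_right t x).
have -> : cut1 t = (fun y => eps^-1 *: ((Z1 \o (fun x : R => x / eps)) \- (Z1 \o (fun x : R => (s t - x) / eps))) y).
  by apply/funext => y; rewrite /cut1 /GRing.scale/=; ring.
have := is_deriveZ eps^-1 (is_deriveB d1 d2).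
by move=> d3; apply: (is_derive_eq d3); rewrite /cut2 /GRing.scale/= -!exprVn; ring.
Qed.

Let dphi (t x : R) : is_derive x 1 (phi t) (phi1 t x).
Proof.
have := is_deriveM (dc x) (dX t x).
by move=> d3; apply: (is_derive_eq d3); rewrite /phi1 /GRing.scale/=; ring.
Qed.

Let dphi1 (t x : R) : is_derive x 1 (phi1 t) (phi2 t x).
Proof.
have := is_deriveD (is_deriveM (dc1 x) (dX t x)) (is_deriveM (dc x) (dX1 t x)).
by move=> d3; apply: (is_derive_eq d3); rewrite /phi2 /GRing.scale/=; ring.
Qed.

Let dphi_t (t x : R) : 0 < t < theta ->
  is_derive t 1 (phi^~ x) (c x * (Z1 ((s t - x) / eps) * (ds t / eps))).
Proof.
move=> tt; have dst := ext_s_t sol tt.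
have d1 : is_derive t 1 (fun t : R => (s t - x) / eps) (ds t / eps).
  by apply: is_derive_eq; rewrite /GRing.scale/=; ring.
have d2 := @is_derive1_comp _ Z (fun t : R => (s t - x) / eps) t _ _ (dZ _) d1.
have -> : phi^~ x = (fun tau => c x *: ((Z \o (fun t : R => (s t - x) / eps)) tau + (Z (x / eps) - 1))).
  by apply/funext => tau; rewrite /phi /cut /GRing.scale/=; ring.
have := is_deriveZ (c x) (is_deriveD d2 (@is_derive_cst R R R (Z (x / eps) - 1) t 1)).
by move=> d3; apply: (is_derive_eq d3); rewrite /GRing.scale/= addr0.
Qed.

Let d_cut_density (t x : R) : 0 < t < theta -> is_derive t 1 (cut_density^~ x) (cut_density_t t x).
Proof.
move=> tt; have [xs|[r r0 Hr]] := trichotomy t x.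
  have := is_deriveM (ext_U_t sol tt xs) (dphi_t x tt).
  by move=> d3; apply: (is_derive_eq d3); rewrite /cut_density_t /GRing.scale/=; ring.
have z tau : `|tau - t| < r -> [/\ cut tau x = 0, cut1 tau x = 0, cut2 tau x = 0 & Z1 ((s tau - x) / eps) = 0].
  by move=> taur; apply: cut_vanish; apply: Hr => //; rewrite subrr normr0.
have [z1 _ _ z2] : [/\ cut t x = 0, cut1 t x = 0, cut2 t x = 0 & Z1 ((s t - x) / eps) = 0].
  by apply: z; rewrite subrr normr0.
rewrite /cut_density_t /phi z1 z2 mul0r !mulr0 addr0.
apply: (is_derive_local r0 (g := cst (0 : R))).
by move=> tau /z [z3 _ _ _]; rewrite /cut_density /phi z3 !mulr0.
Qed.

Let cpair (f : R -> R) (g : R * R -> R) p : continuous f -> {for p, continuous g} ->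
  {for p, continuous (fun p => f (g p))}.
Proof. by move=> cf cg; apply: (continuous_comp (f := g)) => //; exact: cf. Qed.

Let c_fst p : {for p, continuous (fun p : R * R => p.1)}.
Proof. exact: cvg_fst. Qed.
Let c_snd p : {for p, continuous (fun p : R * R => p.2)}.
Proof. exact: cvg_snd. Qed.

Let c_rgt p : {for p, continuous (fun p : R * R => (s p.1 - p.2) / eps)}.
Proof.
apply: cvgMl; apply: cvgB; last exact: c_snd.
by apply: (@cpair s (fun p : R * R => p.1)) => //; exact: c_fst.
Qed.

Let c_phi p : {for p, continuous (fun p : R * R => phi p.1 p.2)}.
Proof.
apply: cvgM; first by apply: (@cpair c (fun p : R * R => p.2)) => //; exact: c_snd.
apply: cvgB; last exact: cvg_cst.
apply: cvgD; last exact: (@cpair Z _ p cZ (@c_rgt p)).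
by apply: (@cpair Z (fun p : R * R => p.2 / eps)) => //; apply: cvgMl; exact: c_snd.
Qed.

Let c_Uphi (t x : R) : 0 < t < theta -> {for (t, x), continuous (fun p : R * R => Uxx p.2 p.1 * phi p.1 p.2)}.
Proof.
move=> tt; have [xs|[r r0 Hr]] := trichotomy t x.
  apply: cvgM; last exact: c_phi.
  apply/(continuous2_eps (fun p : R * R => Uxx p.2 p.1)) => e ep.
  have /continuous2_eps /(_ e ep) [d d0 Hd] := ext_Uxx_cont sol tt xs.
  by exists d => // y tau h1 h2; exact: Hd.
apply/(continuous2_eps (fun p : R * R => Uxx p.2 p.1 * phi p.1 p.2)) => e ep.
have z tau y : `|tau - t| < r -> `|y - x| < r -> phi tau y = 0.
  by move=> h1 h2; have [z1 _ _ _] := cut_vanish (Hr tau y h1 h2); rewrite /phi z1 mulr0.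
exists r => // tau y h1 h2 /=.
by rewrite z// (z t x) ?subrr ?normr0// !mulr0 subrr normr0.
Qed.

Let c_cut_density_t (t x : R) : 0 < t < theta -> {for (t, x), continuous (fun p : R * R => cut_density_t p.1 p.2)}.
Proof.
move=> tt; apply: cvgD; first exact: c_Uphi.
apply: cvgM.
  apply/(continuous2_eps (fun p : R * R => U p.2 p.1)) => e ep.
  have /continuous2_eps /(_ e ep) [d d0 Hd] := @cU (x, t).
  by exists d => // y tau h1 h2; exact: Hd.
apply: cvgM; first by apply: (@cpair c (fun p : R * R => p.2)) => //; exact: c_snd.
apply: cvgM; first exact: (@cpair Z1 _ (t, x) cZ1 (@c_rgt (t, x))).
apply: cvgMl.
apply: (@continuous_comp _ _ _ (fun p : R * R => p.1) ds (t, x)); first exact: c_fst.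
exact: (ext_ds_cont sol tt).
Qed.

Let c_slice (g : R -> R -> R) t : (forall x : R, {for (t, x), continuous (fun p : R * R => g p.1 p.2)}) ->
  continuous (g t).
Proof.
move=> H x; apply/continuous_eps => e ep.
have /continuous2_eps /(_ e ep) [d d0 Hd] := H x.
by exists d => // y yd; apply: (Hd t y) => //; rewrite subrr normr0.
Qed.

Let c_cut_density t : continuous (cut_density t).
Proof. by move=> x; apply: cvgM; [exact: cUx|exact: is_derive_continuous (dphi t) x]. Qed.

Let cX t : continuous (cut t) := is_derive_continuous (dX t).
Let cX1 t : continuous (cut1 t) := is_derive_continuous (dX1 t).
Let cX2 t : continuous (cut2 t).
Proof.
move=> x; apply: cvgD; apply: cvgMl.
  by apply: (continuous_comp (f := fun x : R => x / eps)); [apply: cvgMl; exact: cvg_id|exact: cZ2].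
apply: (continuous_comp (f := fun x : R => (s t - x) / eps)); last exact: cZ2.
by apply: cvgMl; apply: cvgB; [exact: cvg_cst|exact: cvg_id].
Qed.

Let c_phi2 t : continuous (phi2 t).
Proof.
move=> x; apply: cvgD.
  apply: cvgD; first by apply: cvgMr; apply: cvgM; [exact: cc|exact: cX].
  by apply: cvgMr; apply: cvgM; [exact: cc1|exact: cX1].
by apply: cvgM; [exact: cc|exact: cX2].
Qed.

(** Green's formula in [x]; the cutoff removes all boundary terms. *)
Let ibp t : 0 < t < theta ->
  \int[mu]_(x in `[0, S]) (Uxx x t * phi t x) = \int[mu]_(x in `[0, S]) (U x t * phi2 t x).
Proof.
have e0' := e0; have eb' := eb; have b0' := b0; have bS' := bS.
move=> tt; apply/eqP; rewrite -subr_eq0; apply/eqP.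
have cA : continuous (fun x => Uxx x t * phi t x).
  by apply: (@c_slice (fun t x => Uxx x t * phi t x)) => x; exact: c_Uphi.
have cB : continuous (fun x => U x t * phi2 t x).
  by move=> x; apply: cvgM; [exact: cUx|exact: c_phi2].
rewrite -RintegralB_cont; [|exact: continuous_subspaceT..].
have S0' := S0.
have dPsi (x : R) : is_derive x 1 (fun x : R => Ux x t * phi t x - U x t * phi1 t x) (Uxx x t * phi t x - U x t * phi2 t x).
  have [xs|[r r0 Hr]] := trichotomy t x.
    have := is_deriveB (is_deriveM (ext_U_xx sol tt xs) (dphi t x)) (is_deriveM (ext_U_x sol tt xs) (dphi1 t x)).
    by move=> d3; apply: (is_derive_eq d3); rewrite /GRing.scale/=; ring.
  have z y : `|y - x| < r -> [/\ cut t y = 0, cut1 t y = 0, cut2 t y = 0 & Z1 ((s t - y) / eps) = 0].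
    by move=> yr; apply: cut_vanish; apply: Hr => //; rewrite subrr normr0.
  have [z1 z2 z3 _] : [/\ cut t x = 0, cut1 t x = 0, cut2 t x = 0 & Z1 ((s t - x) / eps) = 0].
    by apply: z; rewrite subrr normr0.
  rewrite /phi2 /phi z1 z2 z3 !mulr0 !addr0 mulr0 subr0.
  apply: (is_derive_local r0 (g := cst (0 : R))).
  by move=> y /z [z4 z5 _ _]; rewrite /phi1 z4 z5 !mulr0 addr0 mulr0 subr0.
rewrite (FTC2_cont S0 _ dPsi); last by move=> x; apply: cvgB; [exact: cA|exact: cB].
have [a1 a2 _ _] : [/\ cut t 0 = 0, cut1 t 0 = 0, cut2 t 0 = 0 & Z1 ((s t - 0) / eps) = 0].
  by apply: cut_vanish; left; exact: ltW.
have [a3 a4 _ _] : [/\ cut t S = 0, cut1 t S = 0, cut2 t S = 0 & Z1 ((s t - S) / eps) = 0].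
  by apply: cut_vanish; right; have := sS t; lra.
by rewrite /phi1 /phi a1 a2 a3 a4 !mulr0 !addr0 !mulr0 !subr0.
Qed.

(** What Green's formula and the motion of the cutoff leave in the two layers. *)
Definition flux_layer t := \int[mu]_(x in `[0, S]) (U x t *
  (2 * (c1 x * cut1 t x) + c x * cut2 t x + c x * (Z1 ((s t - x) / eps) * (ds t / eps)))).

(** Differentiating under the integral and applying Green's formula; the heat
    equation and [c'' = lam2 c] reproduce the moment, and all the rest sits in the
    layers. *)
Lemma moment_derive t : 0 < t < theta ->
  is_derive t 1 (fun t => \int[mu]_(x in `[0, S]) cut_density t x)
    (lam2 * (\int[mu]_(x in `[0, S]) cut_density t x) + flux_layer t) /\
  {for t, continuous flux_layer}.
Proof.
have e0' := e0; have eb' := eb; have b0' := b0; have bS' := bS.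
have S0' := S0.
have key tau : 0 < tau < theta -> \int[mu]_(x in `[0, S]) cut_density_t tau x =
    lam2 * (\int[mu]_(x in `[0, S]) cut_density tau x) + flux_layer tau.
  move=> tt; rewrite /cut_density_t.
  have cV : continuous (fun x => U x tau * (c x * (Z1 ((s tau - x) / eps) * (ds tau / eps)))).
    move=> x; apply: cvgM; first exact: cUx.
    apply: cvgM; first exact: cc.
    apply: cvgMl; apply: (continuous_comp (f := fun x : R => (s tau - x) / eps)); last exact: cZ1.
    by apply: cvgMl; apply: cvgB; [exact: cvg_cst|exact: cvg_id].
  have cA : continuous (fun x => Uxx x tau * phi tau x).
    by apply: (@c_slice (fun t x => Uxx x t * phi t x)) => x; exact: c_Uphi.
  have cB : continuous (fun x => U x tau * phi2 tau x).
    by move=> x; apply: cvgM; [exact: cUx|exact: c_phi2].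
  rewrite RintegralD_cont; [|exact: continuous_subspaceT..].
  rewrite ibp// -RintegralD_cont; [|exact: continuous_subspaceT..].
  rewrite -RintegralZ_cont; last exact: continuous_subspaceT.
  have cF : continuous (fun x => U x tau * (2 * (c1 x * cut1 tau x) + c x * cut2 tau x +
     c x * (Z1 ((s tau - x) / eps) * (ds tau / eps)))).
    have -> : (fun x => U x tau * (2 * (c1 x * cut1 tau x) + c x * cut2 tau x +
     c x * (Z1 ((s tau - x) / eps) * (ds tau / eps)))) = (fun x => (U x tau * phi2 tau x +
      U x tau * (c x * (Z1 ((s tau - x) / eps) * (ds tau / eps)))) - lam2 * cut_density tau x).
      by apply/funext => x; rewrite /phi2 /cut_density /phi; ring.
    move=> x; apply: cvgB; first by apply: cvgD; [exact: cB|exact: cV].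
    by apply: cvgMr; exact: c_cut_density.
  rewrite /flux_layer -RintegralD_cont; last 2 first.
  - by apply: continuous_subspaceT => x; apply: cvgMr; exact: c_cut_density.
  - exact: continuous_subspaceT.
  by apply: eq_Rintegral => x _; rewrite /phi2 /cut_density /phi; ring.
move=> tt.
have [d1 cd] := @Rintegral_param_derive _ cut_density cut_density_t S 0 theta S0
  (fun t x tt _ => d_cut_density x tt) (fun t _ => @c_cut_density t) (fun t x tt _ => @c_cut_density_t t x tt) t tt.
split; first by rewrite -key.
apply/continuous_eps => e ep.
have cd2 : {for t, continuous (fun tau => \int[mu]_(x in `[0, S]) cut_density_t tau x -
    lam2 * (\int[mu]_(x in `[0, S]) cut_density tau x))}.
  apply: cvgB => //; apply: cvgMr; apply: differentiable_continuous.
  by apply/derivable1_diffP; have [] := d1.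
have /continuous_eps /(_ e ep) [d d0 Hd] := cd2.
have [tt1 tt2] := andP tt.
exists (Num.min d (Num.min t (theta - t))).
  by rewrite !lt_min d0 tt1 subr_gt0.
move=> tau; rewrite !lt_min => /and3P[td h1 h2].
have ttau : 0 < tau < theta.
  by move: h1 h2; rewrite !ltr_norml => /andP[? ?] /andP[? ?]; apply/andP; split; lra.
have := Hd tau td; rewrite !key//.
by congr (`|_| < _); ring.
Qed.

End FixedEps.

(** Five layers: the two with a second derivative of the cutoff read off the slopes
    of [U c] at the ends, and the three with a first derivative are controlled by
    the size, near the ends, of the function that multiplies it. *)
Lemma flux_layer_est (eps t h0 l eta eta1 : R) : 0 < eps -> 4 * eps <= b ->
  (forall x, 0 <= x <= 2 * eps -> `|U x t * c x - U 0 t * c 0 + h0 * x| <= eta * x) ->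
  (forall x, 0 <= x <= 2 * eps -> `|2 * (U x t * c1 x)| <= eta1) ->
  (forall y, 0 <= y <= 2 * eps -> `|U (s t - y) t * c (s t - y) - l * y| <= eta * y) ->
  (forall y, 0 <= y <= 2 * eps -> `|2 * (U (s t - y) t * c1 (s t - y))| <= eta1) ->
  (forall y, 0 <= y <= 2 * eps -> `|ds t * (U (s t - y) t * c (s t - y))| <= eta1) ->
  `|flux_layer eps t - (h0 - l)| <= 8 * eta * C2 + 6 * eta1 * C1.
Proof.
move=> e0 eb H1 H2 H3 H4 H5.
have b0' := b0; have bS' := bS; have sb' := sb t; have sS' := sS t.
have cy p q : continuous (fun x : R => Z1 (q * (x - p) / eps) / eps).
  move=> x; apply: cvgMl; apply: (continuous_comp (f := fun x : R => q * (x - p) / eps)); last exact: cZ1.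
  by apply: cvgMl; apply: cvgMr; apply: cvgB; [exact: cvg_id|exact: cvg_cst].
have cy2 p q : continuous (fun x : R => Z2 (q * (x - p) / eps) / eps ^+ 2).
  move=> x; apply: cvgMl; apply: (continuous_comp (f := fun x : R => q * (x - p) / eps)); last exact: cZ2.
  by apply: cvgMl; apply: cvgMr; apply: cvgB; [exact: cvg_id|exact: cvg_cst].
pose w1 x := 2 * (U x t * c1 x); pose w2 x := U x t * c x; pose w3 x := ds t * (U x t * c x).
have cw1 : continuous w1 by move=> x; apply: cvgMr; apply: cvgM; [exact: cUx|exact: cc1].
have cw2 : continuous w2 by move=> x; apply: cvgM; [exact: cUx|exact: cc].
have cw3 : continuous w3 by move=> x; apply: cvgMr; apply: cvgM; [exact: cUx|exact: cc].
pose f1 x := w1 x * (Z1 (1 * (x - 0) / eps) / eps).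
pose f2 x := w1 x * (Z1 (-1 * (x - s t) / eps) / eps).
pose f3 x := w2 x * (Z2 (1 * (x - 0) / eps) / eps ^+ 2).
pose f4 x := w2 x * (Z2 (-1 * (x - s t) / eps) / eps ^+ 2).
pose f5 x := w3 x * (Z1 (-1 * (x - s t) / eps) / eps).
have cf1 : continuous f1 by move=> x; apply: cvgM; [exact: cw1|exact: cy].
have cf2 : continuous f2 by move=> x; apply: cvgM; [exact: cw1|exact: cy].
have cf3 : continuous f3 by move=> x; apply: cvgM; [exact: cw2|exact: cy2].
have cf4 : continuous f4 by move=> x; apply: cvgM; [exact: cw2|exact: cy2].
have cf5 : continuous f5 by move=> x; apply: cvgM; [exact: cw3|exact: cy].
have c12 : continuous (fun x => f1 x - f2 x) by move=> x; apply: cvgB; [exact: cf1|exact: cf2].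
have c123 : continuous (fun x => f1 x - f2 x + f3 x) by move=> x; apply: cvgD; [exact: c12|exact: cf3].
have c1234 : continuous (fun x => f1 x - f2 x + f3 x + f4 x) by move=> x; apply: cvgD; [exact: c123|exact: cf4].
have -> : flux_layer eps t = \int[mu]_(x in `[0, S]) (f1 x - f2 x + f3 x + f4 x + f5 x).
  apply: eq_Rintegral => x _; rewrite /cut1 /cut2 /f1 /f2 /f3 /f4 /f5 /w1 /w2 /w3.
  have -> : 1 * (x - 0) / eps = x / eps by ring.
  have -> : -1 * (x - s t) / eps = (s t - x) / eps by ring.
  by ring.
rewrite RintegralD_cont; [|exact: continuous_subspaceT..].
rewrite RintegralD_cont; [|exact: continuous_subspaceT..].
rewrite RintegralD_cont; [|exact: continuous_subspaceT..].
rewrite RintegralB_cont; [|exact: continuous_subspaceT..].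
have rgt (P : R -> Prop) x : (forall y, 0 <= y <= 2 * eps -> P (s t - y)) ->
    0 <= -1 * (x - s t) <= 2 * eps -> P x.
  by move=> HP /HP; rewrite (_ : s t - -1 * (x - s t) = x)//; ring.
have I1 : `|\int[mu]_(x in `[0, S]) f1 x - 0| <= 2 * eta1 * C1.
  apply: (layer1 dZ dZ1 Zl Zr C1P) => //; [by left|lra|lra|].
  by move=> x _; rewrite mul1r !subr0 => hx; exact: H2.
have I2 : `|\int[mu]_(x in `[0, S]) f2 x - 0| <= 2 * eta1 * C1.
  apply: (layer1 dZ dZ1 Zl Zr C1P) => //; [by right|lra|lra|lra|].
  by move=> x _; rewrite subr0; apply: (rgt (fun x => `|w1 x| <= eta1)); exact: H4.
have I5 : `|\int[mu]_(x in `[0, S]) f5 x - 0| <= 2 * eta1 * C1.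
  apply: (layer1 dZ dZ1 Zl Zr C1P) => //; [by right|lra|lra|lra|].
  by move=> x _; rewrite subr0; apply: (rgt (fun x => `|w3 x| <= eta1)); exact: H5.
have I3 : `|\int[mu]_(x in `[0, S]) f3 x + - h0| <= 4 * eta * C2.
  apply: (layer2 dZ dZ1 cZ2 Zl Zr C2P (w0 := U 0 t * c 0)) => //; [by left|lra|lra|].
  by move=> x _; rewrite mul1r subr0 mulNr opprK => hx; exact: H1.
have I4 : `|\int[mu]_(x in `[0, S]) f4 x + l| <= 4 * eta * C2.
  apply: (layer2 dZ dZ1 cZ2 Zl Zr C2P (w0 := 0)) => //; [by right|lra|lra|lra|].
  move=> x _; rewrite subr0; apply: (rgt (fun x => `|w2 x - l * (-1 * (x - s t))| <= eta * (-1 * (x - s t)))).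
  move=> y /H3; have -> : -1 * (s t - y - s t) = y by ring.
  by [].
set i1 := Rintegral _ _ _ in I1 *; set i2 := Rintegral _ _ _ in I2 *.
set i3 := Rintegral _ _ _ in I3 *; set i4 := Rintegral _ _ _ in I4 *.
set i5 := Rintegral _ _ _ in I5 *.
move: I1 I2 I3 I4 I5; rewrite !ler_norml => /andP[? ?] /andP[? ?] /andP[? ?] /andP[? ?] /andP[? ?].
by apply/andP; split; lra.
Qed.

(** As the layers shrink, only the fluxes through both ends survive. At [x = 0] the
    term [2 U c'] disappears because [c' 0 = 0]; on the front it does because [U]
    vanishes. *)
Lemma flux_layer_cvg t : 0 < t < theta -> forall e : R, 0 < e ->
  exists2 d : R, 0 < d & forall eps, 0 < eps < d -> 4 * eps <= b ->
  `|flux_layer eps t - (h t * c 0 - ds t * c (s t))| <= e.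
Proof.
move=> tt e ep.
have b0' := b0; have bS' := bS; have sb' := sb t; have sS' := sS t.
have [C C0 HC] := cbound.
have C10 : 0 <= C1 := le_trans (normr_ge0 _) (C1P 0).
have C20 : 0 <= C2 := le_trans (normr_ge0 _) (C2P 0).
pose eta := e / (16 * (C2 + 1)); pose eta1 := e / (12 * (C1 + 1)).
have eta_gt0 : 0 < eta by rewrite divr_gt0// mulr_gt0//; lra.
have eta1_gt0 : 0 < eta1 by rewrite divr_gt0// mulr_gt0//; lra.
have E1 : 8 * eta * C2 <= e / 2.
  have -> : 8 * eta * C2 = e / 2 * (C2 / (C2 + 1)) by rewrite /eta; field; lra.
  by rewrite ler_piMr ?ler_pdivrMr; lra.
have E2 : 6 * eta1 * C1 <= e / 2.
  have -> : 6 * eta1 * C1 = e / 2 * (C1 / (C1 + 1)) by rewrite /eta1; field; lra.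
  by rewrite ler_piMr ?ler_pdivrMr; lra.
pose D := C + `|h t| + `|U 0 t| + `|ds t| + 1.
have n1 := normr_ge0 (h t); have n2 := normr_ge0 (U 0 t); have n3 := normr_ge0 (ds t).
have D0 : 0 < D by rewrite /D; lra.
pose e' := eta / D; have e'0 : 0 < e' by rewrite divr_gt0.
have e'D : e' * D = eta by rewrite /e' mulfVK ?gt_eqF.
have [d1 d10 Hd1] := ext_flux sol tt e'0.
have [d2 d20 Hd2] := ext_front sol tt e'0.
have [d3 d30 Hd3] := is_derive_eps (dc 0) e'0.
have [d4 d40 Hd4] := (continuous_eps c 0).1 (@cc 0) e' e'0.
have [d5 d50 Hd5] := (continuous_eps c (s t)).1 (@cc (s t)) e' e'0.
have cw1 : continuous (fun x => 2 * (U x t * c1 x)) by move=> x; apply: cvgMr; apply: cvgM; [exact: cUx|exact: cc1].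
have cw3 : continuous (fun x => ds t * (U x t * c x)) by move=> x; apply: cvgMr; apply: cvgM; [exact: cUx|exact: cc].
have [d6 d60 Hd6] := (continuous_eps _ 0).1 (@cw1 0) eta1 eta1_gt0.
have [d7 d70 Hd7] := (continuous_eps _ (s t)).1 (@cw1 (s t)) eta1 eta1_gt0.
have [d8 d80 Hd8] := (continuous_eps _ (s t)).1 (@cw3 (s t)) eta1 eta1_gt0.
have Us : U (s t) t = 0 by apply: (ext_U_beyond sol); exact: lexx.
exists (\big[Num.min/1]_(d <- [:: d1; d2; d3; d4; d5; d6; d7; d8]) d / 2).
  by rewrite divr_gt0// !big_cons big_nil !lt_min d10 d20 d30 d40 d50 d60 d70 d80 ltr01.
move=> eps /andP[eps0]; rewrite ltr_pdivlMr// [eps * 2]mulrC !big_cons big_nil !lt_min.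
move=> /and5P[q1 q2 q3 q4 /and5P[q5 q6 q7 q8 _]] eb.
have es : 2 * eps <= s t by lra.
have eS : 2 * eps <= S := le_trans es sS'.
apply: le_trans (flux_layer_est (eta := eta) (eta1 := eta1) eps0 eb _ _ _ _ _) _; last by lra.
- move=> x /andP[x0 xe].
  have nx : `|x - 0| = x by rewrite subr0 ger0_norm.
  have a1 := Hd1 x ltac:(by rewrite x0 (le_lt_trans xe q1)).
  have a3 := Hd3 x ltac:(by rewrite nx (le_lt_trans xe q3)); rewrite c10 mul0r subr0 nx in a3.
  have a4 := Hd4 x ltac:(by rewrite nx (le_lt_trans xe q4)).
  have [a5 _] := HC x ltac:(by rewrite x0 (le_trans xe eS)).
  have -> : U x t * c x - U 0 t * c 0 + h t * c 0 * x =
    (U x t - U 0 t + h t * x) * c x - h t * x * (c x - c 0) + U 0 t * (c x - c 0) by ring.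
  apply: le_trans (ler_normD _ _) _; apply: le_trans (lerD (ler_normB _ _) (lexx _)) _.
  rewrite !normrM (ger0_norm x0).
  have m1 : `|U x t - U 0 t + h t * x| * `|c x| <= e' * x * C by apply: ler_pM.
  have m2 : `|h t| * x * `|c x - c 0| <= `|h t| * x * e'.
    by apply: ler_wpM2l; [exact: mulr_ge0|exact: ltW].
  have m3 : `|U 0 t| * `|c x - c 0| <= `|U 0 t| * (e' * x) by apply: ler_wpM2l.
  apply: le_trans (lerD (lerD m1 m2) m3) _.
  rewrite -e'D /D -subr_ge0.
  have -> : e' * (C + `|h t| + `|U 0 t| + `|ds t| + 1) * x - (e' * x * C + `|h t| * x * e' + `|U 0 t| * (e' * x))
    = e' * x * (`|ds t| + 1) by ring.
  by apply: mulr_ge0; [apply: mulr_ge0 => //; exact: ltW|exact: addr_ge0].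
- move=> x /andP[x0 xe].
  have := Hd6 x; rewrite subr0 ger0_norm// c10 !mulr0 subr0 => /(_ (le_lt_trans xe q6)); exact: ltW.
- move=> y /andP[y0 ye].
  have ny : `|s t - y - s t| = y by rewrite addrAC subrr add0r normrN ger0_norm.
  have a2 := Hd2 y ltac:(by rewrite y0 (le_lt_trans ye q2)).
  have a5 := Hd5 (s t - y) ltac:(by rewrite ny (le_lt_trans ye q5)).
  have [a6 _] := HC (s t - y) ltac:(by rewrite subr_ge0 (le_trans ye es) lerBlDr (le_trans sS') ?lerDl).
  have -> : U (s t - y) t * c (s t - y) - ds t * c (s t) * y =
    (U (s t - y) t - ds t * y) * c (s t - y) + ds t * y * (c (s t - y) - c (s t)) by ring.
  apply: le_trans (ler_normD _ _) _; rewrite !normrM (ger0_norm y0).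
  have m1 : `|U (s t - y) t - ds t * y| * `|c (s t - y)| <= e' * y * C by apply: ler_pM.
  have m2 : `|ds t| * y * `|c (s t - y) - c (s t)| <= `|ds t| * y * e'.
    by apply: ler_wpM2l; [exact: mulr_ge0|exact: ltW].
  apply: le_trans (lerD m1 m2) _.
  rewrite -e'D /D -subr_ge0.
  have -> : e' * (C + `|h t| + `|U 0 t| + `|ds t| + 1) * y - (e' * y * C + `|ds t| * y * e')
    = e' * y * (`|h t| + `|U 0 t| + 1) by ring.
  by apply: mulr_ge0; [apply: mulr_ge0 => //; exact: ltW|rewrite !addr_ge0].
- move=> y /andP[y0 ye].
  have ny : `|s t - y - s t| = y by rewrite addrAC subrr add0r normrN ger0_norm.
  by have := Hd7 (s t - y); rewrite ny Us mul0r !mulr0 subr0 => /(_ (le_lt_trans ye q7)); exact: ltW.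
- move=> y /andP[y0 ye].
  have ny : `|s t - y - s t| = y by rewrite addrAC subrr add0r normrN ger0_norm.
  by have := Hd8 (s t - y); rewrite ny Us mul0r !mulr0 subr0 => /(_ (le_lt_trans ye q8)); exact: ltW.
Qed.

(** The constant that dominates the layers in the time integral. The flux condition
    at [x = 0] holds at a rate that depends on the time, hence the use of
    [ext_lipschitz] there; the slope read off by the estimate is taken to be 0 on
    both sides, at the price of a bound that does not tend to 0. *)
Lemma flux_layer_bounded t1 t2 : 0 < t1 <= t2 -> t2 < theta ->
  exists B d : R, 0 < d /\ forall eps t, t1 <= t <= t2 -> 0 < eps < d -> 4 * eps <= b ->
  `|flux_layer eps t| <= B.
Proof.
move=> t12 t2th; have /andP[t10 t1t2] := t12.
have [L [d [d0 HL]]] := ext_lipschitz sol t12 t2th.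
have b0' := b0; have bS' := bS; have K0' := K0; have S0' := S0.
have [C C0 HC] := cbound.
have L0 : 0 <= L * d.
  by apply: le_trans (HL d t1 _ _); rewrite ?normr_ge0//; apply/andP; split; lra.
have {}L0 : 0 <= L by rewrite -(pmulr_lge0 _ d0).
pose eta := L * C + K * S * C + K * C; pose eta1 := 2 * (K * S * C) + K * (K * S * C).
have KS0 : 0 <= K * S by exact: mulr_ge0.
have KSC0 : 0 <= K * S * C by exact: mulr_ge0.
have p1 : 0 <= K * (K * S * C) by exact: mulr_ge0.
have p2 : 0 <= L * C by exact: mulr_ge0.
have p3 : 0 <= K * C by exact: mulr_ge0.
exists (8 * eta * C2 + 6 * eta1 * C1), (d / 2); split; first by rewrite divr_gt0.
move=> eps t tt /andP[eps0 epsd] eb; have sb' := sb t; have sS' := sS t.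
have tth : 0 < t < theta by lra.
have es : 2 * eps <= s t by lra.
have eS : 2 * eps <= S := le_trans es sS'.
have ed : 2 * eps <= d by lra.
have inS y : 0 <= y <= 2 * eps -> 0 <= s t - y <= S.
  by move=> /andP[y0 ye]; rewrite subr_ge0 (le_trans ye es) lerBlDr (le_trans sS') ?lerDl.
have /andP[ds0 dsK] := ext_ds_bound sol tth.
have clip x : 0 <= x <= S -> `|c x - c 0| <= C * x.
  move=> /andP[]; rewrite le_eqVlt => /predU1P[<- _|x0 xS]; first by rewrite subrr normr0 mulr0.
  have [|y] := @MVT R c c1 0 x x0 (fun y _ => dc y); first exact: continuous_subspaceT cc.
  rewrite in_itv/= => /andP[y0 yx] ->.
  rewrite normrM subr0 (gtr0_norm x0) ler_pM2r//.
  by have [] := HC y ltac:(lra).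
have uc x : 0 <= x <= S -> `|2 * (U x t * c1 x)| <= eta1.
  move=> xS; have [_ h2] := HC x xS; have h1 := U_le t xS.
  have : `|U x t| * `|c1 x| <= K * S * C by apply: ler_pM.
  by rewrite !normrM (ger0_norm (_ : 0 <= 2)) /eta1; lra.
have uc3 x : 0 <= x <= S -> `|ds t * (U x t * c x)| <= eta1.
  move=> xS; have [h2 _] := HC x xS; have h1 := U_le t xS.
  have h3 : `|U x t| * `|c x| <= K * S * C by apply: ler_pM.
  have : `|ds t| * (`|U x t| * `|c x|) <= K * (K * S * C).
    by apply: ler_pM; rewrite ?mulr_ge0 ?normr_ge0 ?(ger0_norm ds0).
  by rewrite !normrM /eta1; lra.
have := @flux_layer_est eps t 0 0 eta eta1 eps0 eb; rewrite subrr subr0; apply.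
- move=> x /andP[x0 xe]; rewrite mul0r addr0.
  have xS : 0 <= x <= S by rewrite x0 (le_trans xe eS).
  have a1 := HL x t tt ltac:(by rewrite x0 (le_trans xe ed)).
  have [a2 _] := HC x xS; have a3 := clip x xS; have a4 := @U_le 0 t ltac:(by rewrite lexx S0').
  have -> : U x t * c x - U 0 t * c 0 = (U x t - U 0 t) * c x + U 0 t * (c x - c 0) by ring.
  apply: le_trans (ler_normD _ _) _; rewrite !normrM.
  have m1 : `|U x t - U 0 t| * `|c x| <= L * x * C by apply: ler_pM.
  have m2 : `|U 0 t| * `|c x - c 0| <= K * S * (C * x) by apply: ler_pM.
  apply: le_trans (lerD m1 m2) _; rewrite -subr_ge0 /eta.
  have -> : (L * C + K * S * C + K * C) * x - (L * x * C + K * S * (C * x)) = K * C * x by ring.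
  exact: mulr_ge0.
- by move=> x /andP[x0 xe]; apply: uc; rewrite x0 (le_trans xe eS).
- move=> y /andP[y0 ye]; rewrite mul0r subr0 normrM.
  have /andP[u1 u2] := ext_U_bound sol (x := s t - y) (t := t) ltac:(by rewrite subr_ge0 (le_trans ye es) gerBl).
  have [a2 _] := HC (s t - y) (inS y ltac:(by rewrite y0)).
  have m1 : `|U (s t - y) t| * `|c (s t - y)| <= K * y * C.
    by apply: ler_pM => //; rewrite ger0_norm//; apply: le_trans u2 _; rewrite opprB addrCA subrr addr0.
  apply: le_trans m1 _; rewrite -subr_ge0 /eta.
  have -> : (L * C + K * S * C + K * C) * y - K * y * C = (L * C + K * S * C) * y by ring.
  by apply: mulr_ge0 => //; exact: addr_ge0.
- by move=> y /inS; exact: uc.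
- by move=> y /inS; exact: uc3.
Qed.

Hypothesis Z01 : forall x : R, 0 <= Z x <= 1.

Let moment t := \int[mu]_(x in `[0, S]) (U x t * c x).

(** The cutoff differs from 1 on two layers of width [2 eps] only. *)
Lemma cut_moment_cvg t : exists2 B : R, 0 <= B & forall eps, 0 < eps -> 4 * eps <= b ->
  `|\int[mu]_(x in `[0, S]) cut_density eps t x - moment t| <= B * eps.
Proof.
have b0' := b0; have bS' := bS; have sb' := sb t; have sS' := sS t; have S0' := S0.
have [C C0 HC] := cbound.
have KS0 : 0 <= K * S by apply: mulr_ge0 => //; exact: K0.
exists (4 * (K * S * C)); first by apply: mulr_ge0 => //; exact: mulr_ge0.
move=> eps e0 eb.
pose g1 x := U x t * c x * (Z (x / eps) - 1).
pose g2 x := U x t * c x * (Z ((s t - x) / eps) - 1).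
have cUc : continuous (fun x => U x t * c x) by move=> x; apply: cvgM; [exact: cUx|exact: cc].
have cz1 : continuous (fun x : R => Z (x / eps)).
  by move=> x; apply: (continuous_comp (f := fun x : R => x / eps)); [apply: cvgMl; exact: cvg_id|exact: cZ].
have cz2 : continuous (fun x : R => Z ((s t - x) / eps)).
  move=> x; apply: (continuous_comp (f := fun x : R => (s t - x) / eps)); last exact: cZ.
  by apply: cvgMl; apply: cvgB; [exact: cvg_cst|exact: cvg_id].
have cg1 : continuous g1.
  by move=> x; apply: cvgM; [exact: cUc|apply: cvgB; [exact: cz1|exact: cvg_cst]].
have cg2 : continuous g2.
  by move=> x; apply: cvgM; [exact: cUc|apply: cvgB; [exact: cz2|exact: cvg_cst]].
have cgg : continuous (fun x => g1 x + g2 x) by move=> x; apply: cvgD; [exact: cg1|exact: cg2].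
have kE : \int[mu]_(x in `[0, S]) cut_density eps t x = moment t +
    (\int[mu]_(x in `[0, S]) g1 x + \int[mu]_(x in `[0, S]) g2 x).
  rewrite -RintegralD_cont; [|exact: continuous_subspaceT..].
  rewrite -RintegralD_cont; [|exact: continuous_subspaceT..].
  by apply: eq_Rintegral => x _; rewrite /cut_density /phi /cut /g1 /g2; ring.
rewrite kE addrAC subrr add0r.
have Zm y : `|Z y - 1| <= 1.
  by have /andP[z0 z1] := Z01 y; rewrite ler_norml; apply/andP; split; lra.
have bd x y : 0 <= x <= S -> `|U x t * c x * (Z y - 1)| <= K * S * C.
  move=> xS; have [h2 _] := HC x xS; have h1 := U_le t xS.
  rewrite -[leRHS]mulr1 normrM; apply: ler_pM => //.
  by rewrite normrM; exact: ler_pM.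
have I1 : `|\int[mu]_(x in `[0, S]) g1 x| <= K * S * C * (2 * eps - 0).
  apply: Rintegral_left_layer_le => //; [lra|lra| |].
    move=> x /andP[xe _]; rewrite /g1.
    have [-> _ _] := @Zr (x / eps) ltac:(by rewrite ler_pdivlMr).
    by rewrite subrr mulr0.
  by move=> x xe; apply: bd; lra.
have I2 : `|\int[mu]_(x in `[0, S]) g2 x| <= K * S * C * (s t - (s t - 2 * eps)).
  apply: Rintegral_layer_le => //; [lra|lra| |].
    move=> x xS [xe|xe]; rewrite /g2; last by rewrite (ext_U_beyond sol xe) !mul0r.
    have [-> _ _] := @Zr ((s t - x) / eps) ltac:(by rewrite ler_pdivlMr//; lra).
    by rewrite subrr mulr0.
  by move=> x xe; apply: bd; lra.
apply: le_trans (ler_normD _ _) _; apply: le_trans (lerD I1 I2) _.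
by rewrite -subr_ge0 le_eqVlt; apply/orP; left; apply/eqP; ring.
Qed.

Let wt (t : R) := expR (- lam2 * t).

Let dwt (t : R) : is_derive t 1 wt (- lam2 * wt t).
Proof.
have d1 : is_derive t 1 (fun t : R => - lam2 * t) (- lam2).
  by apply: is_derive_eq; rewrite /GRing.scale/=; ring.
apply: (is_derive_eq (@is_derive1_comp _ expR (fun t : R => - lam2 * t) t _ _ (is_derive_expR _) d1)).
by rewrite mulrC.
Qed.

(** Integrate [moment_derive] in time for a fixed width of the cutoff, then let the
    width tend to 0 by dominated convergence. *)
Lemma enthalpy_identity_cutoff t1 t2 : 0 < t1 <= t2 -> t2 < theta ->
  expR (- lam2 * t2) * (\int[mu]_(x in `[0, S]) (U x t2 * c x) + c1 (s t2) / lam2) -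
  expR (- lam2 * t1) * (\int[mu]_(x in `[0, S]) (U x t1 * c x) + c1 (s t1) / lam2) =
  \int[mu]_(t in `[t1, t2]) (expR (- lam2 * t) * (h t * c 0 - c1 (s t))).
Proof.
move=> t12 t2th; have /andP[t10 t1t2] := t12.
have b0' := b0; have lN0 : lam2 != 0 by rewrite gt_eqF.
have [B [d [d0 HB]]] := flux_layer_bounded t12 t2th.
pose e1 := Num.min (d / 2) (b / 4).
have e1d : e1 <= d / 2 by rewrite /e1 ge_min lexx.
have e1b : e1 <= b / 4 by rewrite /e1 ge_min lexx orbT.
have e10 : 0 < e1 by rewrite lt_min; apply/andP; split; lra.
(* A sequence of admissible widths tending to 0. *)
pose ep n := e1 / n.+1%:R.
have n1 n : 1 <= n.+1%:R :> R by rewrite ler1n.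
have ep0 n : 0 < ep n by rewrite divr_gt0// (lt_le_trans ltr01).
have ep1 n : ep n <= e1.
  by rewrite ler_pdivrMr ?ler_peMr ?(ltW e10)// (lt_le_trans ltr01).
have epb n : 4 * ep n <= b by have := ep1 n; lra.
have epd n : 0 < ep n < d by have := ep1 n; have := ep0 n; lra.
have ep_small r : 0 < r -> exists N, forall n, (N <= n)%N -> ep n <= r.
  move=> r0; exists (Num.truncn (e1 / r)) => n Nn.
  rewrite ler_pdivrMr ?(lt_le_trans ltr01)// mulrC -ler_pdivrMr//.
  have /andP[_] : (Num.truncn (e1 / r))%:R <= e1 / r < (Num.truncn (e1 / r)).+1%:R.
    by apply: Num.Theory.truncn_itv; rewrite divr_ge0// ltW.
  by move=> /ltW /le_trans; apply; rewrite ler_nat ltnS.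
pose f n t := wt t * (flux_layer (ep n) t - c1 (s t) + c (s t) * ds t).
pose E n t := wt t * (\int[mu]_(x in `[0, S]) cut_density (ep n) t x + c1 (s t) / lam2).
have inI t : t1 <= t <= t2 -> 0 < t < theta by lra.
have dE n (t : R) : t1 <= t <= t2 -> is_derive t 1 (E n) (f n t).
  move=> /inI tt; have [dm _] := moment_derive (ep0 n) (epb n) tt.
  have d1 : is_derive t 1 (c1 \o s) (lam2 * c (s t) * ds t).
    exact: is_derive1_comp (dc1 (s t)) (ext_s_t sol tt).
  have -> : E n = wt * ((fun t => \int[mu]_(x in `[0, S]) cut_density (ep n) t x) + lam2^-1 *: (c1 \o s)).
    by apply/funext => tau; rewrite /E /GRing.scale !fctE/= /GRing.scale/= [_^-1 * _]mulrC.
  have d2 := is_deriveM (dwt t) (is_deriveD dm (is_deriveZ lam2^-1 d1)).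
  apply: (is_derive_eq d2); rewrite /f !fctE /GRing.scale/= /GRing.scale/=; field => //.
have cf n t : t1 <= t <= t2 -> {for t, continuous (f n)}.
  move=> /inI tt; have [_ cfl] := moment_derive (ep0 n) (epb n) tt.
  apply: cvgM; first exact: derive_continuous_for (dwt t).
  apply: cvgD.
    apply: cvgB => //; apply: (continuous_comp (f := s)); [exact: cs|exact: cc1].
  apply: cvgM; last exact: (ext_ds_cont sol tt).
  apply: (continuous_comp (f := s)); [exact: cs|exact: cc].
have FTC n : E n t2 - E n t1 = \int[mu]_(t in `[t1, t2]) f n t.
  symmetry; apply: FTC2_within => //; first exact: within_continuous_for (cf n).
    by apply: within_continuous_for => t tt; exact: derive_continuous_for (dE n t tt).
  by move=> t /andP[ta tb]; apply: dE; rewrite !ltW.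
have Ecvg t : E n t @[n --> \oo] --> wt t * (moment t + c1 (s t) / lam2).
  apply: cvgMr; apply: cvgD; last exact: cvg_cst.
  have [A A0 HA] := cut_moment_cvg t.
  apply/cvgrPdist_le => e e0.
  have A1 : 0 < A + 1 by lra.
  have [|N HN] := ep_small (e / (A + 1)); first exact: divr_gt0.
  exists N => // n /= Nn; rewrite distrC; apply: le_trans (HA _ (ep0 n) (epb n)) _.
  have := HN n Nn; rewrite ler_pdivlMr// => h1.
  have := ep0 n; nra.
have cwt : continuous wt by move=> t; exact: derive_continuous_for (dwt t).
pose fl t := wt t * (h t * c 0 - c1 (s t)).
have cfl : continuous fl.
  move=> t; apply: cvgM; first exact: cwt.
  apply: cvgB; first by apply: cvgMl; exact: (ext_h_cont sol).
  by apply: (continuous_comp (f := s)); [exact: cs|exact: cc1].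
have [W W0 HW] := continuous_compact_ubound (@segment_compact _ t1 t2) (continuous_subspaceT cwt).
have [V V0 HV] := continuous_compact_ubound (@segment_compact _ t1 t2) (f := fun t => c1 (s t))
  (continuous_subspaceT (fun t => continuous_comp (@cs t) (@cc1 (s t)))).
have [V' V'0 HV'] := continuous_compact_ubound (@segment_compact _ t1 t2) (f := fun t => c (s t))
  (continuous_subspaceT (fun t => continuous_comp (@cs t) (@cc (s t)))).
have Icvg : \int[mu]_(t in `[t1, t2]) f n t @[n --> \oo] --> \int[mu]_(t in `[t1, t2]) fl t.
  apply: (cvg_Rintegral_bounded (M := W * (B + V + V' * K))) => //.
  - by move=> n; exact: within_continuous_for (cf n).
  - exact: continuous_subspaceT.
  - move=> n t tt; have tI : `[t1, t2]%classic t by rewrite /= in_itv.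
    have /andP[ds0 dsK] := ext_ds_bound sol (inI t tt).
    rewrite normrM; apply: ler_pM => //; first exact: HW.
    apply: le_trans (ler_normD _ _) _; apply: lerD.
      by apply: le_trans (ler_normB _ _) _; apply: lerD; [exact: HB|exact: HV].
    by rewrite normrM; apply: ler_pM => //; [exact: HV'|rewrite ger0_norm].
  - move=> t tt; apply: cvgMr.
    apply/cvgrPdist_le => e e0.
    have [r r0 Hr] := flux_layer_cvg (inI t tt) e0.
    have [|N HN] := ep_small (r / 2); first exact: divr_gt0.
    exists N => // n /= Nn.
    have := Hr (ep n) _ (epb n); have := ep0 n; have := HN n Nn => q1 q2.
    move=> /(_ ltac:(lra)); rewrite distrC; congr (`|_| <= _); ring.
have Ecvg2 : E n t2 - E n t1 @[n --> \oo] -->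
    wt t2 * (moment t2 + c1 (s t2) / lam2) - wt t1 * (moment t1 + c1 (s t1) / lam2).
  by apply: cvgB; exact: Ecvg.
have Ecvg3 : E n t2 - E n t1 @[n --> \oo] --> \int[mu]_(t in `[t1, t2]) fl t.
  by rewrite (_ : (fun n => _) = fun n => \int[mu]_(t in `[t1, t2]) f n t)//; exact/funext.
exact: (cvg_unique _ Ecvg2 Ecvg3).
Qed.

End Green.

(** [int U c] is the heat content and [c1 (s t) / lam2], the integral of [c] over
    [[0, s t]], the latent heat; their sum changes only through the flux at [x = 0],
    diffusion being accounted for by the exponential weight. *)
Lemma enthalpy_identity {R : realType} (b theta K S : R) (h u0 : R -> R)
    (U Ux Uxx : R -> R -> R) (s ds : R -> R) (lam2 : R) (c c1 : R -> R) (t1 t2 : R) :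
  extended_solution b theta K S h u0 U Ux Uxx s ds -> 0 < lam2 ->
  (forall x : R, is_derive x 1 c (c1 x)) -> (forall x : R, is_derive x 1 c1 (lam2 * c x)) ->
  c1 0 = 0 -> 0 < t1 <= t2 -> t2 < theta ->
  expR (- lam2 * t2) * (\int[lebesgue_measure]_(x in `[0, S]) (U x t2 * c x) + c1 (s t2) / lam2) -
  expR (- lam2 * t1) * (\int[lebesgue_measure]_(x in `[0, S]) (U x t1 * c x) + c1 (s t1) / lam2) =
  \int[lebesgue_measure]_(t in `[t1, t2]) (expR (- lam2 * t) * (h t * c 0 - c1 (s t))).
Proof.
move=> sol lam20 dc dc1 c10 t12 t2th.
have [Z [Z1 [Z2 [_ Z01 [dZ dZ1 cZ2 Zl Zr]]]]] := @cutoff_exists R.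
have [|C1 C1P] := @bounded_of_support R Z1 (is_derive_continuous dZ1).
  by move=> x [/Zl|/Zr] [].
have [|C2 C2P] := @bounded_of_support R Z2 cZ2.
  by move=> x [/Zl|/Zr] [].
exact: (enthalpy_identity_cutoff sol lam20 dc dc1 c10 dZ dZ1 cZ2 Zl Zr C1P C2P Z01 t12 t2th).
Qed.

(** * A Lipschitz bound at the flux boundary *)

Section Doubling.
Context {R : realType}.

Lemma continuous_comp2 (T : topologicalType) (F : R * R -> R) (f g : T -> R) (p : T) :
  {for p, continuous f} -> {for p, continuous g} -> {for (f p, g p), continuous F} ->
  {for p, continuous (fun q => F (f q, g q))}.
Proof.
move=> cf cg cF; apply: (@continuous_comp _ _ _ (fun q => (f q, g q)) F p) => //.
exact: (@cvg_pair _ _ _ _ (nbhs (f p)) (nbhs (g p)) _ _ _ f g cf cg).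
Qed.

(** Doubling the space variable: [U x t - U y t] solves the heat equation in two
    space variables, vanishes on the diagonal and has a bounded normal derivative on
    [y = 0]. A concave function of [x - y] is therefore an upper barrier; this
    requires nothing of the trace of [U] at [x = 0] nor of the initial values, whose
    influence is paid for by the term [E * (t0 - t)]. *)
Lemma lipschitz_at_flux_boundary (b theta M Hh : R) (h : R -> R) (U Ux Uxx : R -> R -> R) (t1 t2 : R) :
  0 < b -> 0 <= M -> continuous (fun p : R * R => U p.1 p.2) ->
  (forall x t : R, 0 < t < theta -> 0 < x < b -> is_derive t 1 (U x) (Uxx x t)) ->
  (forall x t : R, 0 < t < theta -> 0 < x < b -> is_derive x 1 (U^~ t) (Ux x t)) ->
  (forall x t : R, 0 < t < theta -> 0 < x < b -> is_derive x 1 (Ux^~ t) (Uxx x t)) ->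
  (forall t : R, 0 < t < theta -> forall e : R, 0 < e -> exists2 d : R, 0 < d &
    forall x : R, 0 <= x < d -> `|U x t - U 0 t + h t * x| <= e * x) ->
  (forall t : R, 0 < t < theta -> 0 <= h t <= Hh) ->
  (forall x t : R, 0 <= x <= b -> 0 <= t < theta -> `|U x t| <= M) ->
  0 < t1 <= t2 -> t2 < theta ->
  exists L d : R, 0 < d /\
    forall x t : R, t1 <= t <= t2 -> 0 <= x <= d -> `|U x t - U 0 t| <= L * x.
Proof.
move=> b0 M0 cU U_t U_x U_xx flux hH UM /andP[t10 t12] t2th.
(* The barrier [Phi] below dominates the oscillation [2 M] at [x = de] through [D]
   and at the initial time through [E]; [B] makes it a strict supersolution, and [A]
   makes it increase with [x - y] and beats the flux. *)
pose de := b / 2; have de0 : 0 < de by rewrite divr_gt0.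
have [E [E0 EM]] : exists E : R, 0 <= E /\ E * t1 = 2 * M.
  exists (2 * M / t1); split; first by apply: divr_ge0; lra.
  by rewrite mulfVK// gt_eqF.
have [D [D0 DM]] : exists D : R, 0 <= D /\ D * de ^+ 2 = 2 * M.
  exists (2 * M / de ^+ 2); split; first by apply: divr_ge0; [lra|exact: sqr_ge0].
  by rewrite mulfVK// gt_eqF// exprn_gt0.
have Hh0 : 0 <= Hh by have /andP[] := hH t1 ltac:(lra); apply: le_trans.
have [B [B0 BE]] : exists B : R, 0 < B /\ E + 4 * D < 4 * B.
  by exists ((E + 4 * D) / 4 + 1); split; lra.
have [A AE] : exists A : R, A = 2 * B * de + Hh + 1 by exists (2 * B * de + Hh + 1).
have Bd0 : 0 < B * de by exact: mulr_gt0.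
exists (A + D * de), de; split => // x0 t0 t0I x0I.
pose Phi x y t := A * (x - y) - B * (x - y) ^+ 2 + D * (x ^+ 2 + y ^+ 2) + E * (t0 - t).
suff key sg : sg = 1 \/ sg = -1 -> 0 <= Phi x0 0 t0 - sg * (U x0 t0 - U 0 t0).
  have k1 := key 1 ltac:(by left); have k2 := key (-1) ltac:(by right).
  have : Phi x0 0 t0 <= (A + D * de) * x0.
    rewrite /Phi !subr0 subrr mulr0 addr0 expr0n/= addr0.
    have /andP[x00 x0d] := x0I.
    have : D * x0 ^+ 2 <= D * (de * x0) by apply: ler_wpM2l => //; rewrite expr2 ler_wpM2r.
    have : 0 <= B * x0 ^+ 2 by rewrite mulr_ge0 ?sqr_ge0// ltW.
    by lin.
  by move: k1 k2; rewrite ler_norml; clear => k1 k2 k3; apply/andP; split; lra.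
move=> sg1; have sg2 : sg * sg = 1 by case: sg1 => ->; ring.
(* Replacing [y] by [min y x] turns the triangle [y <= x] into a box. *)
pose G (p : (R * R) * R) := Phi p.1.1 (Num.min p.1.2 p.1.1) p.2 - sg * (U p.1.1 p.2 - U (Num.min p.1.2 p.1.1) p.2).
pose box : set ((R * R) * R) := (`[0, de]%classic `*` `[0, de]%classic) `*` `[t0 - t1, t0]%classic.
have cbox : compact box.
  by apply: compact_prod; [apply: compact_prod|]; exact: segment_compact.
have cG : continuous G.
  move=> p.
  have c1 : {for p, continuous (fun p : (R * R) * R => p.1.1)}.
    by apply: (@continuous_comp _ _ _ fst fst p); exact: cvg_fst.
  have c2 : {for p, continuous (fun p : (R * R) * R => p.1.2)}.
    by apply: (@continuous_comp _ _ _ fst snd p); [exact: cvg_fst|exact: cvg_snd].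
  have c3 : {for p, continuous (fun p : (R * R) * R => p.2)} by exact: cvg_snd.
  have c4 : {for p, continuous (fun p : (R * R) * R => Num.min p.1.2 p.1.1)} by exact: continuous_min.
  have cUU (f g : (R * R) * R -> R) : {for p, continuous f} -> {for p, continuous g} ->
      {for p, continuous (fun q => U (f q) (g q))}.
    by move=> cf cg; apply: (@continuous_comp2 _ (fun p : R * R => U p.1 p.2) f g p cf cg); exact: cU.
  have csq (f : (R * R) * R -> R) : {for p, continuous f} -> {for p, continuous (fun q => f q ^+ 2)}.
    by move=> cf; exact: (cvgM cf cf).
  apply: cvgB; last first.
    by apply: cvgMr; apply: cvgB; apply: cUU.
  apply: cvgD; last by apply: cvgMr; apply: cvgB => //; exact: cvg_cst.
  apply: cvgD; last by apply: cvgMr; apply: cvgD; apply: csq.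
  apply: cvgB; first by apply: cvgMr; apply: cvgB.
  by apply: cvgMr; apply: (csq (fun q => q.1.1 - Num.min q.1.2 q.1.1)); apply: cvgB.
have p0b : box ((x0, 0), t0).
  by split; [split|] => /=; rewrite in_itv/=; move: x0I t10 de0; lin.
have [[[x y'] t] /set_mem [[/=]]] := compact_EVT_min (ex_intro _ _ p0b) cbox (continuous_subspaceT cG).
rewrite !in_itv/= => xI y'I tI Gmin.
have {}Gmin z w tau : 0 <= w <= z -> z <= de -> t0 - t1 <= tau <= t0 ->
    G ((x, y'), t) <= Phi z w tau - sg * (U z tau - U w tau).
  move=> /andP[w0 wz] zde tauI.
  have : ((z, w), tau) \in box.
    by apply/mem_set; split; [split|] => //=; rewrite in_itv/=; move: w0 wz zde; lin.
  by move=> /Gmin; rewrite /G/= (min_l wz).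
have /andP[x00 x0d] := x0I.
apply: le_trans (Gmin x0 0 t0 _ _ _) => //; last 2 first.
- by rewrite lexx.
- by move: t10; lin.
rewrite leNgt; apply/negP; rewrite {1}/G/=.
have Gm : G ((x, y'), t) = Phi x (Num.min y' x) t - sg * (U x t - U (Num.min y' x) t) by [].
rewrite Gm in Gmin.
have : 0 <= Num.min y' x <= x.
  by rewrite le_min ge_min lexx orbT andbT; case/andP: xI => -> _; case/andP: y'I => ->.
move: (Num.min y' x) Gmin {Gm} => y Gmin yx.
move=> Gneg; have /andP[y0 yx'] := yx; have /andP[x0' xde] := xI; have /andP[ta tb] := tI.
have osc : `|sg * (U x t - U y t)| <= 2 * M.
  have tt : 0 <= t < theta by move: ta tb t0I t2th; lin.
  have h1 : `|U x t| <= M by apply: UM => //; move: xde x0' b0; rewrite /de; lin.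
  have h2 : `|U y t| <= M by apply: UM => //; move: xde y0 yx' b0; rewrite /de; lin.
  have : `|U x t - U y t| <= 2 * M by apply: le_trans (ler_normB _ _) _; move: h1 h2; lin.
  by rewrite normrM; case: sg1 => ->; rewrite ?normrN normr1 mul1r.
have /andP[osc1 osc2] : - (2 * M) <= sg * (U x t - U y t) <= 2 * M by rewrite -ler_norml.
have q1 : 0 <= D * (x ^+ 2 + y ^+ 2) by rewrite mulr_ge0// addr_ge0// sqr_ge0.
have q2 : 0 <= E * (t0 - t) by rewrite mulr_ge0// subr_ge0.
have q3 : 0 <= A * (x - y) - B * (x - y) ^+ 2.
  have -> : A * (x - y) - B * (x - y) ^+ 2 = (x - y) * (A - B * (x - y)) by ring.
  apply: mulr_ge0; first by rewrite subr_ge0.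
  have : B * (x - y) <= B * de by apply: ler_wpM2l; [exact: ltW|move: y0 xde; lin].
  by move: AE Bd0 Hh0; lin.
have xy : y < x.
  rewrite lt_neqAle yx' andbT; apply/eqP => yE; move: Gneg q1 q3.
  by rewrite yE subrr mulr0 subr0 /Phi subrr; move: q2; lin.
have xde' : x < de.
  rewrite lt_neqAle xde andbT; apply/eqP => xE; move: Gneg; rewrite /Phi.
  have : D * de ^+ 2 <= D * (x ^+ 2 + y ^+ 2) by rewrite xE ler_wpM2l// lerDl sqr_ge0.
  by move: DM osc2 q2 q3; lin.
have tt : t0 - t1 < t.
  rewrite lt_neqAle ta andbT; apply/eqP => tE; move: Gneg; rewrite /Phi.
  have -> : t0 - t = t1 by rewrite -tE; ring.
  by move: EM osc2 q1 q3; lin.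
have tth : 0 < t < theta by move: tt tb t0I t2th; lin.
have xb : 0 < x < b by move: xy y0 xde' b0; rewrite /de; lin.
have hl := hH _ tth.
have ypos : 0 < y.
  rewrite lt_neqAle y0 andbT; apply/eqP => yE; rewrite -yE in Gmin Gneg.
  have [d d0 Hd] := flux _ tth (1 / 4) ltac:(lin).
  pose m := Num.min (Num.min (d / 2) x) (1 / (4 * (D + 1))).
  have D1 : 0 < 4 * (D + 1) by move: D0; lin.
  have m1 : m <= d / 2 by rewrite /m !ge_min lexx.
  have m2 : m <= x by rewrite /m !ge_min lexx orbT.
  have m3 : m <= 1 / (4 * (D + 1)) by rewrite /m !ge_min lexx orbT.
  have m0 : 0 < m by rewrite /m !lt_min divr_gt0//= andbC divr_gt0//=; move: xy y0; lin.
  have m4 : D * m <= 1 / 4.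
    by move: m3 m0; rewrite ler_pdivlMr//; clear; nra.
  have h1 := Gmin x m t ltac:(move: m0 m2; lin) xde tI.
  have h2 := Hd m ltac:(move: m0 m1 d0; lin).
  have h3 : sg * (U m t - U 0 t) <= Hh * m + 1 / 4 * m.
    have /andP[hl1 hl2] := hl.
    have : h t * m <= Hh * m by apply: ler_wpM2r => //; exact: ltW.
    have : 0 <= h t * m by apply: mulr_ge0 => //; exact: ltW.
    by move: h2; rewrite ler_norml => /andP[]; case: sg1 => ->; lin.
  have h4 : B * x * m <= B * de * m by apply: ler_wpM2r; [exact: ltW|apply: ler_wpM2l => //; exact: ltW].
  have h5 : D * m * m <= 1 / 4 * m by apply: ler_wpM2r => //; exact: ltW.
  have h6 : 0 <= B * (m * m) by apply: mulr_ge0; [exact: ltW|exact: mulr_ge0 (ltW m0) (ltW m0)].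
  have e1 : Phi x m t - Phi x 0 t = - A * m + 2 * (B * x * m) - B * (m * m) + D * m * m.
    by rewrite /Phi; ring.
  have e2 : sg * (U x t - U m t) = sg * (U x t - U 0 t) - sg * (U m t - U 0 t) by ring.
  rewrite e2 in h1.
  have : A * m = 2 * (B * de * m) + Hh * m + m by rewrite AE; ring.
  by move: m0 h1 e1 h3 h4 h5 h6; lin.
have yb : 0 < y < b by move: xy ypos xb; lin.
pose r := Num.min (Num.min (x - y) y) (Num.min (de - x) (t - (t0 - t1))).
have r0 : 0 < r by rewrite /r !lt_min !subr_gt0 xy ypos xde' tt.
have r1 : r <= x - y by rewrite /r !ge_min lexx.
have r2 : r <= y by rewrite /r !ge_min lexx orbT.
have r3 : r <= de - x by rewrite /r !ge_min lexx !orbT.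
have r4 : r <= t - (t0 - t1) by rewrite /r !ge_min lexx !orbT.
have tr : t - r >= t0 - t1 by move: r4; lin.
have dt : - E - sg * (Uxx x t - Uxx y t) <= 0.
  have du := is_deriveZ sg (is_deriveB (U_t _ _ tth xb) (U_t _ _ tth yb)).
  have dP : is_derive t 1 (fun tau => Phi x y tau) (- E).
    by apply: is_derive_eq; rewrite /GRing.scale/=; ring.
  have dG := is_deriveB dP du.
  apply: (left_min_derive_le0 r0 dG) => tau /andP[h1 h2].
  apply: Gmin => //.
  by move: h1 h2 tr tb; lin.
have near0 z c : `|z - c| < r -> c - r < z < c + r.
  by rewrite ltr_norml; clear => /andP[? ?]; apply/andP; split; lra.
have dx : - 2 * B + 2 * D - sg * Uxx x t >= 0.
  have d1 z : `|z - x| < r -> is_derive z 1 ((fun z => Phi z y t) - sg *: ((U^~ t) - cst (U y t)))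
      (A - 2 * B * (z - y) + 2 * D * z - sg *: (Ux z t - 0)).
    move=> /near0 /andP[z1 z2].
    have zb : 0 < z < b by move: z1 z2 r1 r3 ypos xb xde'; rewrite /de; lin.
    have dP : is_derive z 1 (fun z => Phi z y t) (A - 2 * B * (z - y) + 2 * D * z).
      by apply: is_derive_eq; rewrite /GRing.scale/=; ring.
    exact: is_deriveB dP (is_deriveZ sg (is_deriveB (U_x _ _ tth zb) (is_derive_cst (U y t) z 1))).
  have d2 : is_derive x 1 (fun z => A - 2 * B * (z - y) + 2 * D * z - sg *: (Ux z t - 0)) (- 2 * B + 2 * D - sg * Uxx x t).
    have dP : is_derive x 1 (fun z => A - 2 * B * (z - y) + 2 * D * z) (- 2 * B + 2 * D).
      by apply: is_derive_eq; rewrite /GRing.scale/=; ring.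
    have d3 := is_deriveB dP (is_deriveZ sg (U_xx _ _ tth xb)).
    rewrite (_ : (fun z => _) = (fun z => A - 2 * B * (z - y) + 2 * D * z) - sg *: (Ux^~ t)) //.
    by apply/funext => z; rewrite !fctE subr0.
  apply: (second_derive_min r0 d1 d2) => z /near0 /andP[z1 z2].
  by apply: Gmin => //; move: z1 z2 r1 r3 ypos; lin.
have dy : - 2 * B + 2 * D + sg * Uxx y t >= 0.
  have d1 z : `|z - y| < r -> is_derive z 1 ((fun z => Phi x z t) - sg *: (cst (U x t) - (U^~ t)))
      (- A + 2 * B * (x - z) + 2 * D * z - sg *: (0 - Ux z t)).
    move=> /near0 /andP[z1 z2].
    have zb : 0 < z < b by move: z1 z2 r1 r2 xb; lin.
    have dP : is_derive z 1 (fun z => Phi x z t) (- A + 2 * B * (x - z) + 2 * D * z).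
      by apply: is_derive_eq; rewrite /GRing.scale/=; ring.
    exact: is_deriveB dP (is_deriveZ sg (is_deriveB (is_derive_cst (U x t) z 1) (U_x _ _ tth zb))).
  have d2 : is_derive y 1 (fun z => - A + 2 * B * (x - z) + 2 * D * z - sg *: (0 - Ux z t)) (- 2 * B + 2 * D + sg * Uxx y t).
    have dP : is_derive y 1 (fun z => - A + 2 * B * (x - z) + 2 * D * z) (- 2 * B + 2 * D).
      by apply: is_derive_eq; rewrite /GRing.scale/=; ring.
    have d3 := is_deriveD dP (is_deriveZ sg (U_xx _ _ tth yb)).
    rewrite (_ : (fun z => _) = (fun z => - A + 2 * B * (x - z) + 2 * D * z) + sg *: (Ux^~ t)) //.
    by apply/funext => z; rewrite !fctE sub0r scalerN opprK.
  apply: (second_derive_min r0 d1 d2) => z /near0 /andP[z1 z2].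
  by apply: Gmin => //; move: z1 z2 r1 r2; lin.
by move: dt dx dy BE; lin.
Qed.

End Doubling.

(** * Extension of a solution beyond its domain *)

Section Extension.
Context {R : realType}.

Definition front_ext (theta : R) (s : R -> R) (t : R) : R := s (Num.max 0 (Num.min t theta)).

Definition temp_ext (theta : R) (u : R * R -> R) (s : R -> R) (x t : R) : R :=
  u (Num.max 0 (Num.min x (front_ext theta s t)), Num.max 0 (Num.min t theta)).

Lemma front_cont_in (b T : R) h u0 u s t : stefan_solution b T h u0 u s -> 0 <= t <= T ->
  forall e : R, 0 < e -> exists2 d : R, 0 < d & forall tau : R, 0 <= tau <= T ->
    `|tau - t| < d -> `|s tau - s t| < e.
Proof.
move=> sol tT e e0.
have /within_continuous_eps H := stefan_s_cont sol.
have tI : `[0, T]%classic t by rewrite /= in_itv.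
by have [d d0 Hd] := H t tI e e0; exists d.
Qed.

(** The continuity of [u] is given on the closure of the open domain; the lateral
    boundary and the initial segment are to be found in it. *)
Lemma closure_domain (b T : R) h u0 u s x t : stefan_solution b T h u0 u s ->
  0 < T -> 0 <= t < T -> 0 <= x <= s t -> closure (stefan_domain s T) (x, t).
Proof.
move=> sol T0 /andP[t0 tT] /andP[x0 xs] B /nbhs_ballP [r /= r0 Br].
have st0 : 0 < s t by apply: (stefan_s_gt0 sol); rewrite t0 ltW.
pose m := Num.min (r / 2) (s t / 2).
have m0 : 0 < m by rewrite /m lt_min !divr_gt0.
have mr : m <= r / 2 by rewrite /m ge_min lexx.
have ms : m <= s t / 2 by rewrite /m ge_min lexx orbT.
have [y [y0 ys yx]] : exists y, [/\ 0 < y, y < s t & `|x - y| < r].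
  have [hx|hx] := lerP x (s t / 2).
    exists (x + m / 2); split; [by move: x0 m0; lin|by move: hx ms m0; lin|].
    by rewrite opprD addrA subrr add0r normrN gtr0_norm ?divr_gt0//; move: mr m0 r0; lin.
  exists (x - m / 2); split; [by move: hx ms m0; lin|by move: xs m0; lin|].
  by rewrite opprB addrC subrK gtr0_norm ?divr_gt0//; move: mr m0 r0; lin.
have tTT : 0 <= t <= T by rewrite t0 ltW.
have sy0 : 0 < s t - y by rewrite subr_gt0.
have [d d0 Hd] := front_cont_in sol tTT sy0.
pose q := Num.min (Num.min (r / 2) (d / 2)) (T - t).
have q0 : 0 < q by rewrite /q !lt_min !divr_gt0//= subr_gt0.
have q1 : q <= r / 2 by rewrite /q !ge_min lexx.
have q2 : q <= d / 2 by rewrite /q !ge_min lexx orbT.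
have q3 : q <= T - t by rewrite /q !ge_min lexx !orbT.
pose tau := t + q / 2.
have tauI : 0 < tau < T by rewrite /tau; move: t0 q0 q3; lin.
have tauT : 0 <= tau <= T by rewrite /tau; move: t0 q0 q3; lin.
have taut : `|tau - t| = q / 2 by rewrite /tau addrAC subrr add0r gtr0_norm ?divr_gt0.
have sty : y < s tau.
  have : `|s tau - s t| < s t - y by apply: Hd => //; rewrite taut; move: q2 d0 q0; lin.
  by rewrite ltr_norml => /andP[]; lin.
exists (y, tau); split; first by split => //=; rewrite y0.
apply: Br; split => //=; rewrite /ball/= distrC taut.
by move: q1 q0 r0; lin.
Qed.

Lemma temp_ext_continuous (b T : R) h u0 u s theta : stefan_solution b T h u0 u s ->
  0 <= theta < T -> continuous (front_ext theta s) /\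
  continuous (fun p : R * R => temp_ext theta u s p.1 p.2).
Proof.
move=> sol /andP[th0 thT].
have T0 : 0 < T by apply: le_lt_trans thT.
have cf : continuous (front_ext theta s).
  apply: (clamp_continuous th0); apply: continuous_subspaceW (stefan_s_cont sol).
  by move=> x; rewrite /= !in_itv/= => /andP[-> /le_trans->//]; exact: ltW.
split => //; move=> [x t].
apply/(continuous2_eps (fun p : R * R => temp_ext theta u s p.1 p.2)) => e e0.
have cl y tau : closure (stefan_domain s T)
    (Num.max 0 (Num.min y (front_ext theta s tau)), Num.max 0 (Num.min tau theta)).
  have /andP[c1 c2] := clamp_itv tau th0.
  apply: (closure_domain sol T0); first by rewrite c1 (le_lt_trans c2).
  apply: clamp_itv; apply: ltW; apply: (stefan_s_gt0 sol).
  by rewrite c1 (le_trans c2)// ltW.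
have /within2_continuous_eps H := stefan_u_cont sol.
have [d d0 Hd] := H _ _ (cl x t) e e0.
have d2 : 0 < d / 2 by rewrite divr_gt0.
have [r r0 Hr] := (continuous_eps _ t).1 (cf t) (d / 2) d2.
exists (Num.min r (d / 2)); first by rewrite lt_min r0.
move=> y tau; rewrite !lt_min => /andP[y1 y2] /andP[t1 t2].
apply: Hd => //; last first.
  by apply: le_lt_trans (clamp_lip _ _ _ _) _; apply: lt_trans t2 _; move: d0; lin.
have fl := Hr tau t1.
set a := front_ext theta s tau in fl *; set c := front_ext theta s t in fl *.
have : `|Num.min y a - Num.min x c| <= `|y - x| + `|a - c|.
  rewrite ler_norml; have := ler_norm (y - x); have := ler_norm (- (y - x)).
  have := ler_norm (a - c); have := ler_norm (- (a - c)).
  rewrite !normrN /Num.min; clear.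
  by case: (ltP y a) => ?; case: (ltP x c) => ? ? ? ? ?; apply/andP; split; lra.
have : `|Num.max 0 (Num.min y a) - Num.max 0 (Num.min x c)| <= `|Num.min y a - Num.min x c|.
  move: (Num.min y a) (Num.min x c) => p q; clear.
  rewrite ler_norml; have := ler_norm (p - q); have := ler_norm (- (p - q)).
  rewrite normrN /Num.max.
  by case: (ltP 0 p) => ?; case: (ltP 0 q) => ? ? ?; apply/andP; split; lra.
by move: fl y2; lin.
Qed.

Lemma front_extE (theta : R) s t : 0 <= t <= theta -> front_ext theta s t = s t.
Proof. by move=> tI; rewrite /front_ext clamp_id. Qed.

Lemma temp_extE (theta : R) u s x t : 0 <= t <= theta -> 0 <= x <= s t ->
  temp_ext theta u s x t = u (x, t).
Proof. by move=> tI xI; rewrite /temp_ext front_extE// !clamp_id. Qed.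

Lemma domain_nbhs (b T : R) h u0 u s x t : stefan_solution b T h u0 u s ->
  0 < t < T -> 0 < x < s t -> exists2 r : R, 0 < r & forall y tau : R,
  `|y - x| < r -> `|tau - t| < r -> 0 < tau < T /\ 0 < y < s tau.
Proof.
move=> sol /andP[t0 tT] /andP[x0 xs].
have tTT : 0 <= t <= T by rewrite !ltW.
pose e := (s t - x) / 2; have e0 : 0 < e by rewrite divr_gt0// subr_gt0.
have [d d0 Hd] := front_cont_in sol tTT e0.
exists (Num.min (Num.min d e) (Num.min x (Num.min t (T - t)))).
  by rewrite !lt_min d0 e0 x0 t0 subr_gt0.
move=> y tau; rewrite !lt_min => /andP[/andP[y1 y2] /and3P[y3 y4 y5]] /andP[/andP[z1 z2] /and3P[z3 z4 z5]].
have tauI : 0 < tau < T by move: z4 z5; rewrite !ltr_norml => /andP[? ?] /andP[? ?]; apply/andP; split; lra.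
split => //.
have : `|s tau - s t| < e by apply: Hd => //; case/andP: tauI => *; rewrite !ltW.
move: y2 y3; rewrite /e !ltr_norml; clear => /andP[? ?] /andP[? ?] /andP[? ?].
by apply/andP; split; lra.
Qed.

Lemma front_derive (b T : R) h u0 u s : stefan_solution b T h u0 u s ->
  exists ds : R -> R, forall t : R, 0 < t < T ->
    [/\ is_derive t 1 s (ds t), {for t, continuous ds} & s^`()%classic t = ds t].
Proof.
move=> sol; have [ds [cds dds]] := stefan_s_C1 sol; exists ds => t /andP[t0 tT].
have tI : `]0, T]%classic t by rewrite /= in_itv/= t0 ltW.
have m0 : 0 < Num.min t (T - t) by rewrite lt_min t0 subr_gt0.
have inI y : `|y - t| < Num.min t (T - t) -> `]0, T]%classic y.
  rewrite lt_min /= in_itv/= !ltr_norml; clear => /andP[/andP[? ?] /andP[? ?]].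
  by apply/andP; split; lra.
have dst : is_derive t 1 s (ds t).
  apply: is_derive_of_eps => e e0; have [d d0 Hd] := has_deriv_within_eps (dds t tI) e0.
  exists (Num.min d (Num.min t (T - t))); first by rewrite lt_min d0.
  by move=> y; rewrite lt_min => /andP[yd /inI yI]; exact: Hd.
split => //; last by rewrite derive1E derive_val.
apply/continuous_eps => e e0; have /within_continuous_eps H := cds.
have [d d0 Hd] := H t tI e e0.
exists (Num.min d (Num.min t (T - t))); first by rewrite lt_min d0.
by move=> y; rewrite lt_min => /andP[yd /inI yI]; exact: Hd.
Qed.

Lemma box_nonneg (G : R -> R -> R) (S theta : R) : 0 <= S -> 0 <= theta ->
  continuous (fun p : R * R => G p.1 p.2) ->
  (forall x t : R, 0 <= x <= S -> 0 <= t <= theta -> G x t < 0 ->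
     (forall y tau : R, 0 <= y <= S -> 0 <= tau <= theta -> G x t <= G y tau) -> False) ->
  forall x t : R, 0 <= x <= S -> 0 <= t <= theta -> 0 <= G x t.
Proof.
move=> S0 th0 cG noneg x t xS tt.
have p0 : (`[0, S]%classic `*` `[0, theta]%classic : set (R * R)) (x, t).
  by split; rewrite /= in_itv.
have cb := compact_prod (@segment_compact _ 0 S) (@segment_compact _ 0 theta).
have [[x1 t1] /set_mem [/=]] := compact_EVT_min (ex_intro _ _ p0) cb (continuous_subspaceT cG).
rewrite !in_itv/= => x1S t1t Gmin.
have {}Gmin y tau : 0 <= y <= S -> 0 <= tau <= theta -> G x1 t1 <= G y tau.
  by move=> yS tautt; apply: (Gmin (y, tau)); apply/mem_set; split; rewrite /= in_itv.
apply: le_trans (Gmin x t xS tt); rewrite leNgt; apply/negP => G0.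
exact: noneg G0 Gmin.
Qed.

End Extension.

(** * The maximum principle *)

Section MaximumPrinciple.
Context {R : realType}.

Lemma point_near (a x e : R) : 0 < a -> 0 <= x <= a -> 0 < e ->
  exists y, 0 < y < a /\ `|y - x| < e.
Proof.
move=> a0 /andP[x0 xa] e0.
pose m := Num.min (e / 2) (a / 2).
have m0 : 0 < m by rewrite /m lt_min !divr_gt0.
have me : m <= e / 2 by rewrite /m ge_min lexx.
have ma : m <= a / 2 by rewrite /m ge_min lexx orbT.
have [hx|hx] := lerP x (a / 2).
  exists (x + m / 2); split; first by move: hx ma m0 x0; lin.
  by rewrite addrAC subrr add0r gtr0_norm ?divr_gt0//; move: me m0 e0; lin.
exists (x - m / 2); split; first by move: hx ma m0 xa; lin.
by rewrite addrAC subrr add0r normrN gtr0_norm ?divr_gt0//; move: me m0 e0; lin.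
Qed.

(** At a negative minimum the time derivative is at most 0 and the second space
    derivative at least 0, which a strict supersolution excludes; the minimum is not
    on [x = 0], where [g] decreases into the domain, nor on the rest of the
    parabolic boundary. Working with the extension makes the domain a box. *)
Lemma moving_min_principle (b T : R) h u0 u s (theta : R) (g gx : R -> R -> R) :
  stefan_solution b T h u0 u s -> 0 < b -> 0 < theta < T ->
  continuous (fun p : R * R => g (Num.max 0 (Num.min p.1 (front_ext theta s p.2)))
                                 (Num.max 0 (Num.min p.2 theta))) ->
  (forall x : R, 0 < x < b -> 0 <= g x 0) ->
  (forall t : R, 0 < t <= theta -> 0 <= g (s t) t) ->
  (forall t : R, 0 < t <= theta -> exists x : R, 0 < x < s t /\ g x t < g 0 t) ->
  (forall x t : R, 0 < t <= theta -> 0 < x < s t -> is_derive x 1 (g^~ t) (gx x t)) ->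
  (forall x t : R, 0 < t <= theta -> 0 < x < s t -> exists gt gxx : R,
    [/\ is_derive t 1 (g x) gt, is_derive x 1 (gx^~ t) gxx & gxx < gt]) ->
  forall x t : R, 0 <= t <= theta -> 0 <= x <= s t -> 0 <= g x t.
Proof.
move=> sol b0 /andP[th0 thT] cG init front flux dgx heat.
have th0' := ltW th0.
have [cf _] := temp_ext_continuous sol (theta := theta) ltac:(by rewrite th0').
have [S S0 HS] := continuous_compact_ubound (@segment_compact _ 0 theta) (continuous_subspaceT cf).
have sS t : 0 <= t <= theta -> s t <= S.
  move=> tI; have := HS t; rewrite /= in_itv/= => /(_ tI).
  by rewrite front_extE//; apply: le_trans; exact: ler_norm.
have sp t : 0 <= t <= theta -> 0 < s t.
  by move=> /andP[t0 tth]; apply: (stefan_s_gt0 sol); rewrite t0 (le_trans tth)// ltW.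
pose G x t := g (Num.max 0 (Num.min x (front_ext theta s t))) (Num.max 0 (Num.min t theta)).
have GE x t : 0 <= t <= theta -> 0 <= x <= s t -> G x t = g x t.
  by move=> tI xI; rewrite /G front_extE// !clamp_id.
suff key : forall x t : R, 0 <= x <= S -> 0 <= t <= theta -> 0 <= G x t.
  move=> x t tI xI; rewrite -GE//; apply: key => //.
  by case/andP: xI => -> /le_trans; apply; exact: sS.
apply: (box_nonneg S0 th0' cG) => x1 t xS tI G0 Gmin.
have /andP[t0 tth] := tI.
have [x [xI G0' Gx]] : exists x, [/\ 0 <= x <= s t, g x t < 0 & g x t = G x1 t].
  exists (Num.max 0 (Num.min x1 (s t))); have E : g (Num.max 0 (Num.min x1 (s t))) t = G x1 t.
    by rewrite /G front_extE// (clamp_id tI).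
  by rewrite E; split => //; apply: clamp_itv; rewrite ltW// sp.
rewrite -Gx in Gmin.
have {}Gmin y tau : 0 <= tau <= theta -> 0 <= y <= s tau -> g x t <= g y tau.
  move=> tauI /andP[y0 ys]; rewrite -(GE y tau)//; last by rewrite y0.
  by apply: Gmin => //; rewrite y0 (le_trans ys)// sS.
have [tz|tpos] : t = 0 \/ 0 < t by move: t0; rewrite le_eqVlt => /predU1P[<-|]; [left|right].
  have sb : s 0 = b := stefan_s_init sol.
  subst t; have xb : 0 <= x <= b by rewrite -sb.
  have Gneg : 0 < - g x 0 by rewrite oppr_gt0.
  have /continuous2_eps /(_ _ Gneg) [d d0 Hd] := cG (x, 0).
  have [y [yb yx]] := point_near b0 xb d0.
  have := Hd y 0 yx; rewrite subrr normr0 => /(_ d0); rewrite -/(G y 0) -/(G x 0) !GE//.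
    have := init y yb; rewrite ltr_norml; move: Gneg; clear => ? ? /andP[? ?]; lra.
  by rewrite sb; case/andP: yb => *; rewrite !ltW.
have tI' : 0 < t <= theta by rewrite tpos.
have [xE|[xE|xin]] : x = s t \/ x = 0 \/ 0 < x < s t.
  move: xI => /andP[]; rewrite le_eqVlt => /predU1P[<-|x0]; first by right; left.
  by rewrite le_eqVlt => /predU1P[->|xs]; [left|right; right; rewrite x0].
- by have := front t tI'; rewrite -xE leNgt G0'.
- have [y [/andP[y0 ys] gy]] := flux t tI'; rewrite -xE in gy.
  by have := Gmin y t tI ltac:(by rewrite !ltW); rewrite leNgt gy.
have [gt [gxx [dgt dgxx lt]]] := heat x t tI' xin.
have tT : 0 < t < T by rewrite tpos (le_lt_trans tth).
have [r r0 Hr] := domain_nbhs sol tT xin.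
have nn (z c : R) : c - r < z < c -> `|z - c| < r.
  by move: r0; clear => r0 /andP[? ?]; rewrite ltr_norml; apply/andP; split; lra.
have gt0 : gt <= 0.
  apply: (left_min_derive_le0 r0 dgt) => tau taur.
  have [tau0 xtau] := Hr x tau ltac:(by rewrite subrr normr0) (nn _ _ taur).
  case/andP: taur => _ taut; case/andP: xtau => *; case/andP: tau0 => *.
  by apply: Gmin; rewrite !ltW// (lt_le_trans taut).
have gxx0 : 0 <= gxx.
  have inx y : `|y - x| < r -> 0 < y < s t.
    by move=> yr; have [] := Hr y t yr ltac:(by rewrite subrr normr0).
  apply: (second_derive_min r0 (f := g^~ t) (f1 := gx^~ t) _ dgxx) => y /inx yI.
    exact: dgx.
  by apply: Gmin => //; case/andP: yI => *; rewrite !ltW.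
by move: lt gt0 gxx0; lin.
Qed.

Lemma stefan_derivatives (b T : R) (h u0 : R -> R) (u : R * R -> R) (s : R -> R) x t : stefan_solution b T h u0 u s -> 0 < t < T -> 0 < x < s t ->
  [/\ is_derive x 1 (fun x => u (x, t)) (partial_x u (x, t)),
      is_derive x 1 (fun x => partial_x u (x, t)) (partial_x (partial_x u) (x, t)) &
      is_derive t 1 (fun t => u (x, t)) (partial_x (partial_x u) (x, t))].
Proof.
move=> sol tT xs; have [H _] := stefan_u_C21 sol.
have Q : stefan_domain s T (x, t) by split.
have [/= d1 d2 d3] := H _ Q; split.
- by apply: (DeriveDef d1); rewrite -derive1E.
- by apply: (DeriveDef d2); rewrite -derive1E.
- have := stefan_heat sol Q => /eqP; rewrite subr_eq0 => /eqP <-.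
  by apply: (DeriveDef d3); rewrite -derive1E.
Qed.

Lemma continuous_time_clamp (theta kappa : R) : continuous (fun p : R * R => kappa * Num.max 0 (Num.min p.2 theta)).
Proof.
move=> p; apply: cvgMr; apply: (@continuous_comp _ _ _ (fun p : R * R => p.2)
   (fun t => Num.max 0 (Num.min t theta)) p); first exact: cvg_snd.
apply: continuous_max; first exact: cvg_cst.
by apply: continuous_min; [exact: cvg_id|exact: cvg_cst].
Qed.

(** Adding [kappa * t] makes [u] a strict supersolution; then [kappa] tends to 0. *)
Lemma temp_ge0 (b T : R) (h u0 : R -> R) (u : R * R -> R) (s : R -> R) (theta : R) :
  stefan_solution b T h u0 u s -> 0 < b -> 0 < theta < T ->
  (forall t : R, 0 <= t <= T -> 0 < h t) -> (forall x : R, 0 <= x <= b -> 0 <= u0 x) ->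
  forall x t : R, 0 <= t <= theta -> 0 <= x <= s t -> 0 <= u (x, t).
Proof.
move=> sol b0 thT h0 u00 x t tI xI.
have th0' : 0 <= theta by case/andP: thT => /ltW.
have inT tau : 0 < tau <= theta -> 0 < tau < T.
  by case/andP: thT => _ ? /andP[-> /le_lt_trans]; apply.
apply/ler_addgt0Pl => e e0.
pose kappa := e / (theta + 1).
have k0 : 0 < kappa by rewrite divr_gt0// ltr_wpDl.
have kth : kappa * t <= e.
  rewrite /kappa mulrAC ler_pdivrMr ?ltr_wpDl// ler_pM2l//.
  by case/andP: tI => _ /le_trans; apply; rewrite lerDl.
suff : 0 <= u (x, t) + kappa * t by move: kth; lin.
apply: (@moving_min_principle b T h u0 u s theta (fun x t => u (x, t) + kappa * t)
  (fun x t => partial_x u (x, t)) sol b0 thT _ _ _ _ _ _ x t tI xI).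
- have [_ cu] := temp_ext_continuous sol (theta := theta) ltac:(by rewrite th0'; case/andP: thT).
  by move=> p; apply: cvgD; [exact: cu|exact: continuous_time_clamp].
- move=> y yb; rewrite mulr0 addr0 (stefan_init sol yb); apply: u00.
  by case/andP: yb => *; rewrite !ltW.
- move=> tau tauI; rewrite (stefan_dirichlet sol (inT _ tauI)) add0r.
  by rewrite mulr_ge0 ?ltW//; case/andP: tauI.
- move=> tau /inT tauT.
  have ht : 0 < h tau by apply: h0; case/andP: tauT => *; rewrite !ltW.
  have st : 0 < s tau by apply: (stefan_s_gt0 sol); case/andP: tauT => *; rewrite !ltW.
  have [d d0 Hd] := has_deriv_within_eps (stefan_flux sol tauT) (e := h tau / 2) ltac:(by rewrite divr_gt0).
  pose m := Num.min d (s tau); have m0 : 0 < m by rewrite lt_min d0.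
  have md : m <= d by rewrite ge_min lexx.
  have ms : m <= s tau by rewrite ge_min lexx orbT.
  exists (m / 2); split; first by rewrite divr_gt0//=; move: m0 ms; lin.
  have := Hd (m / 2); rewrite /= in_itv/= !subr0 ger0_norm; last by rewrite ltW// divr_gt0.
  move=> /(_ ltac:(move: m0 ms; lin) ltac:(move: m0 md; lin)).
  rewrite ltrD2r ler_norml => /andP[_].
  have : 0 < h tau * m by apply: mulr_gt0.
  by lin.
- move=> y tau /inT tauT yI; have [d1 _ _] := stefan_derivatives sol tauT yI.
  by apply: (is_derive_eq (is_deriveD d1 (@is_derive_cst R R R (kappa * tau) y 1))); rewrite addr0.
- move=> y tau /inT tauT yI; have [_ d2 d3] := stefan_derivatives sol tauT yI.
  exists (partial_x (partial_x u) (y, tau) + kappa), (partial_x (partial_x u) (y, tau)); split => //.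
    have dk : is_derive tau 1 (fun t : R => kappa * t) kappa.
      by apply: is_derive_eq; rewrite /GRing.scale/=; ring.
    exact: is_deriveD d3 dk.
  by rewrite ltrDl.
Qed.

(** [u] is nonnegative and vanishes on the front, where its slope is [- s']. *)
Lemma front_deriv_ge0 (b T : R) (h u0 : R -> R) (u : R * R -> R) (s : R -> R) (ds t : R) :
  stefan_solution b T h u0 u s -> 0 < b -> 0 < t < T ->
  (forall t : R, 0 <= t <= T -> 0 < h t) -> (forall x : R, 0 <= x <= b -> 0 <= u0 x) ->
  s^`()%classic t = ds -> 0 <= ds.
Proof.
move=> sol b0 tT h0 u00 dsE.
have st : 0 < s t by apply: (stefan_s_gt0 sol); case/andP: tT => *; rewrite !ltW.
have un := temp_ge0 sol b0 tT h0 u00.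
rewrite leNgt; apply/negP => dneg.
have := stefan_front sol tT; rewrite dsE => dd.
have [d d0 Hd] := has_deriv_within_eps dd (e := - ds / 2) ltac:(by rewrite divr_gt0// oppr_gt0).
pose m := Num.min d (s t); have m0 : 0 < m by rewrite lt_min d0.
have md : m <= d by rewrite ge_min lexx.
have ms : m <= s t by rewrite ge_min lexx orbT.
have := Hd (s t - m / 2); have -> : s t - m / 2 - s t = - (m / 2) by ring.
rewrite normrN ger0_norm; last by rewrite ltW// divr_gt0.
rewrite (stefan_dirichlet sol tT) subr0 /= in_itv/=.
move=> /(_ ltac:(move: m0 ms; lin) ltac:(move: m0 md; lin)).
have : 0 <= u (s t - m / 2, t).
  by apply: un; [case/andP: tT => *; rewrite lexx ltW|move: m0 ms; lin].
rewrite ler_norml => q1 /andP[_ q2]; move: q1 q2.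
have : 0 < - ds * m by apply: mulr_gt0 => //; rewrite oppr_gt0.
by lin.
Qed.

(** The barrier [K (s t - x)] is a supersolution because the front advances, and its
    slope at [x = 0] exceeds the flux [h]. *)
Lemma temp_le (b T : R) (h u0 : R -> R) (u : R * R -> R) (s : R -> R) (theta K : R) :
  stefan_solution b T h u0 u s -> 0 < b -> 0 < theta < T ->
  (forall t : R, 0 <= t <= T -> 0 < h t < K) -> 0 <= K ->
  (forall x : R, 0 <= x <= b -> 0 <= u0 x <= K * (b - x)) ->
  forall x t : R, 0 <= t <= theta -> 0 <= x <= s t -> u (x, t) <= K * (s t - x).
Proof.
move=> sol b0 thT hK K0 u0K x t tI xI.
have h0 tau : 0 <= tau <= T -> 0 < h tau by move=> /hK /andP[].
have u00 y : 0 <= y <= b -> 0 <= u0 y by move=> /u0K /andP[].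
have th0' : 0 <= theta by case/andP: thT => /ltW.
have inT tau : 0 < tau <= theta -> 0 < tau < T.
  by case/andP: thT => _ ? /andP[-> /le_lt_trans]; apply.
have [ds Hds] := front_derive sol.
rewrite -subr_ge0; apply/ler_addgt0Pl => e e0.
pose kappa := e / (theta + 1).
have k0 : 0 < kappa by rewrite divr_gt0// ltr_wpDl.
have kth : kappa * t <= e.
  rewrite /kappa mulrAC ler_pdivrMr ?ltr_wpDl// ler_pM2l//.
  by case/andP: tI => _ /le_trans; apply; rewrite lerDl.
suff : 0 <= K * (s t - x) - u (x, t) + kappa * t by move: kth; lin.
apply: (@moving_min_principle b T h u0 u s theta (fun x t => K * (s t - x) - u (x, t) + kappa * t)
  (fun x t => - K - partial_x u (x, t)) sol b0 thT _ _ _ _ _ _ x t tI xI).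
- have [cf cu] := temp_ext_continuous sol (theta := theta) ltac:(by rewrite th0'; case/andP: thT).
  have cf2 : continuous (fun p : R * R => front_ext theta s p.2).
    by move=> p; apply: (@continuous_comp _ _ _ (fun p : R * R => p.2) (front_ext theta s) p);
      [exact: cvg_snd|exact: cf].
  move=> p; apply: cvgD; last exact: continuous_time_clamp.
  apply: cvgB; last exact: cu.
  apply: cvgMr; apply: cvgB; first exact: cf2.
  have cm : {for p, continuous ((fun p : R * R => p.1) \min (fun p => front_ext theta s p.2))}.
    by apply: continuous_min; [exact: cvg_fst|exact: cf2].
  by have : {for p, continuous ((fun=> 0) \max ((fun p : R * R => p.1) \min (fun p => front_ext theta s p.2)))}
    by apply: continuous_max cm; exact: cvg_cst.
- move=> y yb; rewrite mulr0 addr0 (stefan_init sol yb) (stefan_s_init sol) subr_ge0.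
  by have /andP[] : 0 <= u0 y <= K * (b - y) by apply: u0K; case/andP: yb => *; rewrite !ltW.
- move=> tau tauI; rewrite (stefan_dirichlet sol (inT _ tauI)) subrr mulr0 subr0 add0r.
  by rewrite mulr_ge0 ?ltW//; case/andP: tauI.
- move=> tau /inT tauT.
  have /andP[_ ht] : 0 < h tau < K by apply: hK; case/andP: tauT => *; rewrite !ltW.
  have st : 0 < s tau by apply: (stefan_s_gt0 sol); case/andP: tauT => *; rewrite !ltW.
  have [d d0 Hd] := has_deriv_within_eps (stefan_flux sol tauT) (e := (K - h tau) / 2)
    ltac:(by rewrite divr_gt0// subr_gt0).
  pose m := Num.min d (s tau); have m0 : 0 < m by rewrite lt_min d0.
  have md : m <= d by rewrite ge_min lexx.
  have ms : m <= s tau by rewrite ge_min lexx orbT.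
  exists (m / 2); split; first by rewrite divr_gt0//=; move: m0 ms; lin.
  have := Hd (m / 2); rewrite /= in_itv/= !subr0 ger0_norm; last by rewrite ltW// divr_gt0.
  move=> /(_ ltac:(move: m0 ms; lin) ltac:(move: m0 md; lin)).
  rewrite ltrD2r ler_norml => /andP[q1 _]; move: q1.
  have : 0 < (K - h tau) * m by apply: mulr_gt0; rewrite ?subr_gt0.
  by lin.
- move=> y tau /inT tauT yI; have [d1 _ _] := stefan_derivatives sol tauT yI.
  have dK : is_derive y 1 (fun y : R => K * (s tau - y)) (- K).
    by apply: is_derive_eq; rewrite /GRing.scale/=; ring.
  by apply: (is_derive_eq (is_deriveD (is_deriveB dK d1) (@is_derive_cst R R R (kappa * tau) y 1))); rewrite addr0.
- move=> y tau /inT tauT yI; have [_ d2 d3] := stefan_derivatives sol tauT yI.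
  have [dst _ dsE] := Hds tau tauT.
  have ds0 : 0 <= ds tau := front_deriv_ge0 sol b0 tauT h0 u00 dsE.
  exists (K * ds tau - partial_x (partial_x u) (y, tau) + kappa), (- partial_x (partial_x u) (y, tau)); split.
  + have dk : is_derive tau 1 (fun t : R => kappa * t) kappa.
      by apply: is_derive_eq; rewrite /GRing.scale/=; ring.
    have dK : is_derive tau 1 (fun t : R => K * (s t - y)) (K * ds tau).
      apply: (is_derive_eq (is_deriveZ K (is_deriveB dst (@is_derive_cst R R R y tau 1)))).
      by rewrite subr0.
    exact: is_deriveD (is_deriveB dK d3) dk.
  + by apply: (is_derive_eq (is_deriveB (@is_derive_cst R R R (- K) y 1) d2)); rewrite sub0r.
  + have : 0 <= K * ds tau by apply: mulr_ge0.
    by move: k0; lin.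
Qed.

End MaximumPrinciple.

(** * Bounds on a Stefan solution *)

Section StefanExtended.
Context {R : realType}.

Lemma sup_norm_ge (a b : R) (h : R -> R) : {within `[a, b], continuous h} ->
  forall t, a <= t <= b -> `|h t| <= sup_norm a b h.
Proof.
move=> ch t tab; rewrite /sup_norm.
have [M M0 HM] := continuous_compact_ubound (@segment_compact _ a b) ch.
apply: sup_upper_bound; last by exists t => //=; rewrite in_itv.
split; first by exists `|h t|; exists t => //=; rewrite in_itv.
by exists M => _ [x xab <-]; exact: HM.
Qed.

(** The barrier [K (s t - x)] touches [u] on the front from above, which compares
    the slopes there. *)
Lemma front_deriv_le (b T : R) (h u0 : R -> R) (u : R * R -> R) (s : R -> R) (K ds t : R) :
  stefan_solution b T h u0 u s -> 0 < t < T ->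
  (forall x : R, 0 <= x <= s t -> u (x, t) <= K * (s t - x)) ->
  s^`()%classic t = ds -> ds <= K.
Proof.
move=> sol tT uK dsE.
have st : 0 < s t by apply: (stefan_s_gt0 sol); case/andP: tT => *; rewrite !ltW.
rewrite leNgt; apply/negP => dneg.
have := stefan_front sol tT; rewrite dsE => dd.
have [d d0 Hd] := has_deriv_within_eps dd (e := (ds - K) / 2) ltac:(by rewrite divr_gt0// subr_gt0).
pose m := Num.min d (s t); have m0 : 0 < m by rewrite lt_min d0.
have md : m <= d by rewrite ge_min lexx.
have ms : m <= s t by rewrite ge_min lexx orbT.
have := Hd (s t - m / 2); have -> : s t - m / 2 - s t = - (m / 2) by ring.
rewrite normrN ger0_norm; last by rewrite ltW// divr_gt0.
rewrite (stefan_dirichlet sol tT) subr0 /= in_itv/=.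
move=> /(_ ltac:(move: m0 ms; lin) ltac:(move: m0 md; lin)).
have : u (s t - m / 2, t) <= K * (s t - (s t - m / 2)).
  by apply: uK; move: m0 ms; lin.
rewrite ler_norml => q1 /andP[q2 _]; move: q1 q2.
have : 0 < (ds - K) * m by apply: mulr_gt0; rewrite ?subr_gt0.
by lin.
Qed.

Lemma front_bounds (b T : R) (h u0 : R -> R) (u : R * R -> R) (s ds : R -> R) (K t : R) :
  stefan_solution b T h u0 u s -> (forall t, 0 < t < T -> is_derive t 1 s (ds t)) ->
  (forall t : R, 0 < t < T -> 0 <= ds t <= K) -> 0 <= t < T ->
  b <= s t <= b + K * t.
Proof.
move=> sol dst dsK /andP[]; rewrite le_eqVlt => /predU1P[<- _|t0 tT].
  by rewrite (stefan_s_init sol) mulr0 addr0 lexx.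
have inT x : x \in `]0, t[ -> 0 < x < T.
  by rewrite in_itv/= => /andP[-> /lt_trans]; apply.
have [||x xI] := @MVT R s ds 0 t t0.
- by move=> x /inT; exact: dst.
- apply: continuous_subspaceW (stefan_s_cont sol).
  by move=> x; rewrite /= !in_itv/= => /andP[-> /le_trans->//]; exact: ltW.
rewrite (stefan_s_init sol) subr0 => /eqP; rewrite subr_eq => /eqP ->.
have /andP[d0 dK] := dsK x (inT x xI).
by rewrite addrC lerDl lerD2l mulr_ge0 ?(ltW t0)//= ler_wpM2r// ltW.
Qed.

(** Half of the time interval suffices for the moment estimate; it stays away from
    the final time, where no equation is posed. *)
Lemma stefan_extended (b T H Hhat : R) (h u0 : R -> R) (u : R * R -> R) (s : R -> R) :
  0 < b -> 0 < T -> 0 < H -> 1 <= Hhat -> {within `[0, T], continuous h} ->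
  (forall t : R, 0 <= t <= T -> 0 < h t) -> sup_norm 0 T h <= Hhat ->
  (forall x : R, 0 <= x <= b -> 0 <= u0 x <= H * (b - x)) ->
  stefan_solution b T h u0 u s ->
  exists ds, extended_solution b (T / 2) (H + Hhat + 1) (b + (H + Hhat + 1) * T)
    (fun t => h (Num.max 0 (Num.min t (T / 2)))) u0
    (temp_ext (T / 2) u s) (fun x t => partial_x u (x, t))
    (fun x t => partial_x (partial_x u) (x, t)) (front_ext (T / 2) s) ds.
Proof.
move=> b0 T0 H0 Hh1 ch h0 hH u0H sol.
set K := H + Hhat + 1; set th := T / 2.
have K0 : 0 < K by rewrite /K; move: H0 Hh1; lin.
have thT : 0 < th < T by rewrite /th; move: T0; lin.
have /andP[th0 thT'] := thT; have th0' := ltW th0.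
have hK t : 0 <= t <= T -> 0 < h t < K.
  move=> tI; rewrite h0//=; apply: le_lt_trans (_ : Hhat < K); last by rewrite /K; move: H0; lin.
  by apply: le_trans hH; apply: le_trans (ler_norm _) _; exact: sup_norm_ge.
have u00 x : 0 <= x <= b -> 0 <= u0 x by move=> /u0H /andP[].
have u0K x : 0 <= x <= b -> 0 <= u0 x <= K * (b - x).
  move=> xI; have /andP[-> h2] := u0H x xI; apply: le_trans h2 _.
  by case/andP: xI => _ xb; rewrite ler_wpM2r ?subr_ge0// /K; move: H0 Hh1; lin.
have [ds Hds] := front_derive sol.
have uge t : 0 < t < T -> forall x tau : R, 0 <= tau <= t -> 0 <= x <= s tau -> 0 <= u (x, tau).
  by move=> tT; exact: (temp_ge0 sol b0 tT h0 u00).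
have ule t : 0 < t < T -> forall x tau : R, 0 <= tau <= t -> 0 <= x <= s tau -> u (x, tau) <= K * (s tau - x).
  by move=> tT; exact: (temp_le sol b0 tT hK (ltW K0) u0K).
have dsb t : 0 < t < T -> 0 <= ds t <= K.
  move=> tT; have [_ _ dsE] := Hds t tT; have /andP[t0 _] := tT.
  rewrite (front_deriv_ge0 sol b0 tT h0 u00 dsE) (front_deriv_le sol tT _ dsE)// => x xI.
  by apply: (ule t tT) => //; rewrite lexx ltW.
have dst t : 0 < t < T -> is_derive t 1 s (ds t) by move=> /Hds [].
have sb t : 0 <= t < T -> b <= s t <= b + K * t := front_bounds sol dst dsb.
have clI t : 0 <= Num.max 0 (Num.min t th) <= th by exact: clamp_itv.
have clT t : 0 <= Num.max 0 (Num.min t th) < T.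
  by case/andP: (clI t) => -> /le_lt_trans; apply.
have inT t : 0 < t < th -> 0 < t < T by case/andP=> -> /lt_trans; apply.
have inth t : 0 < t < th -> 0 <= t <= th by case/andP=> *; rewrite !ltW.
have spos t : 0 <= t < T -> 0 < s t by move=> /sb /andP[+ _]; exact: lt_le_trans.
have [cf cu] := temp_ext_continuous sol (theta := th) ltac:(by rewrite th0').
have near_t t : 0 < t < th -> exists2 r : R, 0 < r & forall tau, `|tau - t| < r -> 0 < tau < th.
  move=> /andP[t0 tth]; exists (Num.min t (th - t)); first by rewrite lt_min t0 subr_gt0.
  move=> tau; rewrite lt_min !ltr_norml; clear => /andP[/andP[? ?] /andP[? ?]].
  by apply/andP; split; lra.
have fE t : 0 <= t <= th -> front_ext th s t = s t by exact: front_extE.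
have Uge x t : 0 <= x <= front_ext th s t -> 0 <= temp_ext th u s x t <= K * (front_ext th s t - x).
  move=> xI; rewrite /temp_ext clamp_id//.
  by rewrite (uge _ thT)//= (ule _ thT).
have fb t : b <= front_ext th s t <= b + K * T.
  have /andP[-> h2] := sb _ (clT t); apply: le_trans h2 _; rewrite lerD2l ler_pM2l//.
  by case/andP: (clT t) => _ /ltW.
have S0 : 0 <= b + K * T by rewrite addr_ge0 ?mulr_ge0// ltW.
have flux t : 0 < t < th -> forall e : R, 0 < e -> exists2 d : R, 0 < d &
    forall x : R, 0 <= x < d -> `|temp_ext th u s x t - temp_ext th u s 0 t + h t * x| <= e * x.
  move=> tt e e0; have st := spos t ltac:(by case/andP: (inT t tt) => /ltW ->).
  have [d d0 Hd] := has_deriv_within_eps (stefan_flux sol (inT t tt)) e0.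
  exists (Num.min d (s t)); first by rewrite lt_min d0.
  move=> x; rewrite lt_min => /and3P[x0 xd xs].
  have tI := inth t tt.
  have -> : temp_ext th u s x t = u (x, t) by apply: temp_extE => //; rewrite x0 ltW.
  have -> : temp_ext th u s 0 t = u (0, t) by apply: temp_extE => //; rewrite lexx ltW.
  have := Hd x; rewrite /= in_itv/= subr0 ger0_norm// x0 (ltW xs) => /(_ erefl xd).
  by rewrite mulNr opprK.
have DUt x t : 0 < t < th -> 0 < x < front_ext th s t ->
    is_derive t 1 (temp_ext th u s x) (partial_x (partial_x u) (x, t)).
  move=> tt; rewrite (fE t (inth t tt)) => xI.
  have [r r0 Hr] := domain_nbhs sol (inT t tt) xI.
  have [r' r'0 Hr'] := near_t t tt.
  have [_ _ d3] := stefan_derivatives sol (inT t tt) xI.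
  apply: (is_derive_local (r := Num.min r r') _ _ d3); first by rewrite lt_min r0.
  move=> tau; rewrite lt_min => /andP[h1 h2].
  have [_ /andP[x0 xs]] := Hr x tau ltac:(by rewrite subrr normr0) h1.
  by rewrite temp_extE//; [exact: inth (Hr' _ h2)|rewrite !ltW].
have DUx x t : 0 < t < th -> 0 < x < front_ext th s t ->
    is_derive x 1 ((temp_ext th u s)^~ t) (partial_x u (x, t)).
  move=> tt; rewrite (fE t (inth t tt)) => xI.
  have [r r0 Hr] := domain_nbhs sol (inT t tt) xI.
  have [d1 _ _] := stefan_derivatives sol (inT t tt) xI.
  apply: (is_derive_local r0 _ d1) => y yr.
  have [_ /andP[x0 xs]] := Hr y t yr ltac:(by rewrite subrr normr0).
  by rewrite temp_extE//; [exact: inth|rewrite !ltW].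
have DUxx x t : 0 < t < th -> 0 < x < front_ext th s t ->
    is_derive x 1 (fun x => partial_x u (x, t)) (partial_x (partial_x u) (x, t)).
  move=> tt; rewrite (fE t (inth t tt)) => xI.
  by have [_ d2 _] := stefan_derivatives sol (inT t tt) xI.
exists ds; split => //.
- exact: ltW.
- apply: (clamp_continuous th0'); apply: continuous_subspaceW ch.
  by move=> x; rewrite /= !in_itv/= => /andP[-> /le_trans->//]; exact: ltW.
- move=> x t fx; rewrite /temp_ext (min_r fx) max_r; last first.
    by case/andP: (fb t) => + _; apply: le_trans; exact: ltW.
  have := Uge (front_ext th s t) t; rewrite lexx andbT subrr mulr0 /temp_ext clamp_id; last first.
    by rewrite lexx andbT; case/andP: (fb t) => + _; apply: le_trans; exact: ltW.
  move=> /(_ ltac:(by case/andP: (fb t) => + _; apply: le_trans; exact: ltW)) h1.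
  by apply/eqP; rewrite eq_le andbC.
- move=> x t tt; rewrite (fE t (inth t tt)) => xI.
  have [_ [_ _ cxx _]] := stefan_u_C21 sol.
  have /within2_continuous_eps Hc := cxx.
  have [r r0 Hr] := domain_nbhs sol (inT t tt) xI.
  apply/(continuous2_eps (fun p : R * R => partial_x (partial_x u) (p.1, p.2))) => e e0.
  have [d d0 Hd] := Hc x t ltac:(by split; [exact: xI|exact: inT]) e e0.
  exists (Num.min d r); first by rewrite lt_min d0.
  move=> y tau; rewrite !lt_min => /andP[y1 y2] /andP[t1 t2].
  by apply: Hd => //; have [? ?] := Hr y tau y2 t2; split.
- move=> t tt; have [r' r'0 Hr'] := near_t t tt.
  apply: (is_derive_local r'0 _ (dst t (inT t tt))) => tau /Hr' ttau.
  exact: fE (inth _ ttau).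
- by move=> t tt; have [] := Hds t (inT t tt).
- by move=> t /inT; exact: dsb.
- move=> t tt e e0; have [d d0 Hd] := flux t tt e e0; exists d => // x xI.
  by rewrite clamp_id ?inth//; exact: Hd.
- move=> t tt e e0; have st := spos t ltac:(by case/andP: (inT t tt) => /ltW ->).
  have [_ _ dsE] := Hds t (inT t tt).
  have := stefan_front sol (inT t tt); rewrite dsE => dd.
  have [d d0 Hd] := has_deriv_within_eps dd e0.
  exists (Num.min d (s t)); first by rewrite lt_min d0.
  move=> y; rewrite lt_min => /and3P[y0 yd ys].
  have tI := inth t tt; rewrite fE//.
  have yI : 0 <= s t - y <= s t by move: y0 ys; lin.
  have := Hd (s t - y); have -> : s t - y - s t = - y by ring.
  rewrite temp_extE// (stefan_dirichlet sol (inT t tt)) subr0 mulrNN normrN ger0_norm//.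
  by rewrite /= in_itv/= => /(_ yI yd).
- move=> x /andP[x0 xb]; rewrite temp_extE ?lexx//.
    by apply: (stefan_init sol); rewrite x0.
  by rewrite (stefan_s_init sol) !ltW.
- move=> t1 t2 t12 t2th.
  apply: (@lipschitz_at_flux_boundary R b th (K * (b + K * T)) K h (temp_ext th u s)
    (fun x t => partial_x u (x, t)) (fun x t => partial_x (partial_x u) (x, t)) t1 t2 b0 _ cu _ _ _ flux _ _ t12 t2th).
  + by rewrite mulr_ge0// ltW.
  + move=> x t tt /andP[x0 xb]; apply: DUt => //; rewrite x0/=.
    by apply: lt_le_trans xb _; case/andP: (fb t).
  + move=> x t tt /andP[x0 xb]; apply: DUx => //; rewrite x0/=.
    by apply: lt_le_trans xb _; case/andP: (fb t).
  + move=> x t tt /andP[x0 xb]; apply: DUxx => //; rewrite x0/=.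
    by apply: lt_le_trans xb _; case/andP: (fb t).
  + by move=> t /inT /andP[t0 tT]; have /andP[? ?] := hK t ltac:(by rewrite !ltW); rewrite !ltW.
  + move=> x t /andP[x0 xb] tt; have xf : 0 <= x <= front_ext th s t.
      by rewrite x0 (le_trans xb)//; case/andP: (fb t).
    have /andP[u1 u2] := Uge x t xf; rewrite ger0_norm//.
    apply: le_trans u2 _; rewrite ler_pM2l//.
    by case/andP: (fb t) => _; move: x0; lin.
Qed.

End StefanExtended.

(** * Exponential moments of the initial data *)

Section MomentEstimate.
Context {R : realType}.
Notation mu := (@lebesgue_measure R).

(** Twice the hyperbolic cosine of [l x]; [esinh l] is its derivative. *)
Definition ecosh (l x : R) : R := expR (l * x) + expR (- (l * x)).
Definition esinh (l x : R) : R := l * (expR (l * x) - expR (- (l * x))).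

Lemma is_derive_expR_lin (l x : R) : is_derive x 1 (fun x : R => expR (l * x)) (l * expR (l * x)).
Proof.
have d1 : is_derive x 1 (fun x : R => l * x) l.
  by apply: is_derive_eq; rewrite /GRing.scale/=; ring.
apply: (is_derive_eq (@is_derive1_comp _ expR (fun x : R => l * x) x _ _ (is_derive_expR _) d1)).
by rewrite mulrC.
Qed.

Lemma is_derive_ecosh (l x : R) : is_derive x 1 (ecosh l) (esinh l x).
Proof.
have d2 := is_derive_expR_lin (- l) x.
have -> : ecosh l = (fun x => expR (l * x)) + (fun x => expR (- l * x)).
  by apply/funext => y; rewrite /ecosh !fctE mulNr.
by apply: (is_derive_eq (is_deriveD (is_derive_expR_lin l x) d2)); rewrite /esinh !mulNr; ring.
Qed.

Lemma is_derive_esinh (l x : R) : is_derive x 1 (esinh l) (l ^+ 2 * ecosh l x).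
Proof.
have d2 := is_derive_expR_lin (- l) x.
have -> : esinh l = l *: ((fun x => expR (l * x)) - (fun x => expR (- l * x))).
  by apply/funext => y; rewrite /esinh !fctE mulNr.
apply: (is_derive_eq (is_deriveZ l (is_deriveB (is_derive_expR_lin l x) d2))).
by rewrite /ecosh /GRing.scale/= !mulNr; ring.
Qed.

Lemma ecosh_le (l x S : R) : 0 <= l -> 0 <= x <= S -> 0 <= ecosh l x <= 2 * expR (l * S).
Proof.
move=> l0 /andP[x0 xS]; have lx : l * x <= l * S by apply: ler_wpM2l.
have lx0 : 0 <= l * x by apply: mulr_ge0.
have h1 : expR (l * x) <= expR (l * S) by rewrite ler_expR.
have h2 : expR (- (l * x)) <= expR (l * S) by rewrite ler_expR; move: lx lx0; lin.
rewrite /ecosh addr_ge0 ?expR_ge0//=.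
by move: h1 h2; lin.
Qed.

Lemma esinh_lipschitz (l x y S d : R) : 0 <= l -> 0 <= x <= S -> 0 <= y <= S ->
  `|x - y| <= d -> `|esinh l x - esinh l y| <= 2 * l ^+ 2 * expR (l * S) * d.
Proof.
move=> l0; wlog xy : x y / y <= x => [wl xS yS xyd|].
  have [h|/ltW h] := lerP y x; first exact: wl.
  by rewrite distrC; apply: wl => //; rewrite distrC.
move=> /andP[x0 xS] /andP[y0 yS] xyd.
have c0 : 0 <= 2 * l ^+ 2 * expR (l * S) by rewrite !mulr_ge0 ?sqr_ge0 ?expR_ge0.
move: xy; rewrite le_eqVlt => /predU1P[E|xy].
  by rewrite E subrr normr0 mulr_ge0//; apply: le_trans xyd; exact: normr_ge0.
have [|z] := @MVT R (esinh l) (fun x => l ^+ 2 * ecosh l x) y x xy (fun z _ => is_derive_esinh l z).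
  exact: continuous_subspaceT (is_derive_continuous (is_derive_esinh l)).
rewrite in_itv/= => /andP[yz zx] ->.
have zS : 0 <= z <= S by rewrite (le_trans y0 (ltW yz)) (le_trans (ltW zx)).
have /andP[e0 e1] := ecosh_le l0 zS.
rewrite normrM; apply: ler_pM => //.
rewrite ger0_norm ?mulr_ge0 ?sqr_ge0//.
have -> : 2 * l ^+ 2 * expR (l * S) = l ^+ 2 * (2 * expR (l * S)) by ring.
by apply: ler_wpM2l => //; exact: sqr_ge0.
Qed.

(** The enthalpy identities of the two solutions have the same flux term, so their
    difference only involves the fronts, through [d], and the heat contents at time
    [tf], which carry the weight [exp (- l^2 tf)]. *)
Lemma moment_estimate (b theta K S : R) (h u01 u02 : R -> R)
    (U1 U1x U1xx : R -> R -> R) (s1 ds1 : R -> R) (U2 U2x U2xx : R -> R -> R) (s2 ds2 : R -> R)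
    (tf l d : R) :
  extended_solution b theta K S h u01 U1 U1x U1xx s1 ds1 ->
  extended_solution b theta K S h u02 U2 U2x U2xx s2 ds2 ->
  s1 0 = s2 0 ->
  0 < tf < theta -> 0 < l -> (forall t : R, 0 < t <= tf -> `|s1 t - s2 t| <= d) ->
  `|\int[mu]_(x in `[0, S]) ((U1 x 0 - U2 x 0) * ecosh l x)| <=
    2 * K * S ^+ 2 * expR (l * S - l ^+ 2 * tf) + 2 * (1 + tf) * (1 + l ^+ 2) * expR (l * S) * d.
Proof.
move=> sol1 sol2 s12 /andP[tf0 tfth] l0 sd.
have b0 := ext_b_gt0 sol1; have K0 := ext_K_ge0 sol1.
have sI1 t : 0 <= s1 t <= S.
  by have /andP[h1 ->] := ext_s_bound sol1 t; rewrite (le_trans _ h1)// ltW.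
have sI2 t : 0 <= s2 t <= S.
  by have /andP[h1 ->] := ext_s_bound sol2 t; rewrite (le_trans _ h1)// ltW.
have S0 : 0 <= S by have /andP[] := sI1 0; exact: le_trans.
have l20 : 0 < l ^+ 2 by rewrite exprn_gt0.
have l0' := ltW l0.
have esinh0 : esinh l 0 = 0 by rewrite /esinh mulr0 oppr0 subrr mulr0.
have ce : continuous (ecosh l) := is_derive_continuous (is_derive_ecosh l).
have cse : continuous (esinh l) := is_derive_continuous (is_derive_esinh l).
have cs1 := ext_s_cont sol1; have cs2 := ext_s_cont sol2.
have cV1 x := continuous_slicer (x := x) (ext_U_cont sol1).
have cV2 x := continuous_slicer (x := x) (ext_U_cont sol2).
have cU1 t := continuous_slicel (t := t) (ext_U_cont sol1).
have cU2 t := continuous_slicel (t := t) (ext_U_cont sol2).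
pose g (t x : R) := (U1 x t - U2 x t) * ecosh l x.
have cg t : continuous (g t).
  by move=> x; apply: cvgM; [apply: cvgB; [exact: cU1|exact: cU2]|exact: ce].
have gle t x : 0 <= x <= S -> `|g t x| <= K * S * (2 * expR (l * S)).
  move=> xS; have /andP[e0 e1] := ecosh_le l0' xS.
  have /andP[a1 a2] := ext_temp_le t sol1 xS; have /andP[a3 a4] := ext_temp_le t sol2 xS.
  rewrite normrM; apply: ler_pM => //; last by rewrite ger0_norm.
  by rewrite ler_norml; move: a1 a2 a3 a4; clear => *; apply/andP; split; lra.
pose wt (t : R) := expR (- l ^+ 2 * t).
have wt1 t : 0 <= t -> 0 <= wt t <= 1.
  by move=> t0; rewrite expR_ge0 -expR0 ler_expR mulNr oppr_le0 mulr_ge0// ltW.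
pose D (t : R) := wt t * (\int[mu]_(x in `[0, S]) g t x + (esinh l (s1 t) - esinh l (s2 t)) / l ^+ 2).
have d0 : 0 <= d.
  by have := sd tf; rewrite tf0 lexx => /(_ isT); apply: le_trans; exact: normr_ge0.
pose C := 2 * l ^+ 2 * expR (l * S) * d.
have sdiff (t : R) : 0 < t <= tf -> `|esinh l (s1 t) - esinh l (s2 t)| <= C.
  by move=> tt; apply: esinh_lipschitz => //; exact: sd.
have Dtf : `|D tf| <= 2 * K * S ^+ 2 * expR (l * S - l ^+ 2 * tf) + 2 * expR (l * S) * d.
  have /andP[w0 w1] := wt1 tf (ltW tf0).
  rewrite /D mulrDr; apply: le_trans (ler_normD _ _) _; apply: lerD; rewrite normrM (ger0_norm w0).
    have -> : 2 * K * S ^+ 2 * expR (l * S - l ^+ 2 * tf) =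
        wt tf * (K * S * (2 * expR (l * S)) * (S - 0)).
      by rewrite expRD /wt mulNr; ring.
    apply: ler_wpM2l => //; apply: Rintegral_norm_le => //; first exact: continuous_subspaceT (@cg tf).
    exact: gle.
  have hC : `|(esinh l (s1 tf) - esinh l (s2 tf)) / l ^+ 2| <= 2 * expR (l * S) * d.
    rewrite normrM normfV (gtr0_norm l20) ler_pdivrMr//.
    have -> : 2 * expR (l * S) * d * l ^+ 2 = C by rewrite /C; ring.
    by apply: sdiff; rewrite tf0 lexx.
  by rewrite -[leRHS]mul1r; apply: ler_pM.
have Dt (t : R) : 0 < t <= tf -> `|D t| <= `|D tf| + C * tf.
  move=> /andP[t0 ttf].
  have tt : 0 < t <= tf by rewrite t0.
  have id1 := enthalpy_identity sol1 l20 (is_derive_ecosh l) (is_derive_esinh l) esinh0 tt tfth.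
  have id2 := enthalpy_identity sol2 l20 (is_derive_ecosh l) (is_derive_esinh l) esinh0 tt tfth.
  have sE (U0 u1 : R -> R) : continuous U0 -> continuous u1 ->
      \int[mu]_(x in `[0, S]) ((U0 x - u1 x) * ecosh l x) =
      \int[mu]_(x in `[0, S]) (U0 x * ecosh l x) - \int[mu]_(x in `[0, S]) (u1 x * ecosh l x).
    move=> cU0 cu1; rewrite -RintegralB_cont; last 2 first.
    - by apply: continuous_subspaceT => x; apply: cvgM; [exact: cU0|exact: ce].
    - by apply: continuous_subspaceT => x; apply: cvgM; [exact: cu1|exact: ce].
    by apply: eq_Rintegral => x _; rewrite mulrBl.
  have cw : continuous wt := is_derive_continuous (is_derive_expR_lin (- l ^+ 2)).
  have cf (s : R -> R) : continuous s -> continuous (fun tau => wt tau * (h tau * ecosh l 0 - esinh l (s tau))).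
    move=> cs tau; apply: cvgM; first exact: cw.
    apply: cvgB; first by apply: cvgMl; exact: (ext_h_cont sol1).
    by apply: (continuous_comp (f := s)); [exact: cs|exact: cse].
  have cf1 := cf s1 (ext_s_cont sol1); have cf2 := cf s2 (ext_s_cont sol2).
  have DD : D t = D tf - \int[mu]_(tau in `[t, tf]) (wt tau * (h tau * ecosh l 0 - esinh l (s1 tau)) -
      wt tau * (h tau * ecosh l 0 - esinh l (s2 tau))).
    rewrite RintegralB_cont; [|exact: continuous_subspaceT..].
    rewrite -id1 -id2 /D /g !sE//; try exact: cU1; try exact: cU2.
    by rewrite /wt; ring.
  rewrite DD; apply: le_trans (ler_normB _ _) _; rewrite lerD2l.
  have C0 : 0 <= C by rewrite /C !mulr_ge0 ?sqr_ge0 ?expR_ge0.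
  apply: (@le_trans _ _ (C * (tf - t))); last by apply: ler_wpM2l => //; move: t0; lin.
  apply: Rintegral_norm_le => //.
    by apply: continuous_subspaceT => x; apply: cvgB; [exact: cf1|exact: cf2].
  move=> tau /andP[ta tb]; have tau0 : 0 < tau by exact: lt_le_trans ta.
  have /andP[w0 w1] := wt1 tau (ltW tau0).
  have -> : wt tau * (h tau * ecosh l 0 - esinh l (s1 tau)) - wt tau * (h tau * ecosh l 0 - esinh l (s2 tau)) =
    wt tau * (esinh l (s2 tau) - esinh l (s1 tau)) by ring.
  rewrite normrM (ger0_norm w0) -[leRHS]mul1r.
  by apply: ler_pM => //; rewrite distrC; apply: sdiff; rewrite tau0.
(* The enthalpy identity holds at positive times; time 0 is reached by continuity. *)
have [tn [tn0 tnc]] : exists tn : nat -> R, (forall n, 0 < tn n <= tf) /\ tn n @[n --> \oo] --> 0.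
  exists (fun n => tf * (n.+1%:R)^-1); split.
    move=> n; rewrite mulr_gt0 ?invr_gt0//=.
    by rewrite ler_pdivrMr// ler_peMr ?ler1n// ltW.
  rewrite -[X in _ --> X](mulr0 tf); apply: cvgMr.
  exact: cvg_harmonic.
have Dc : D (tn n) @[n --> \oo] --> D 0.
  have cat (f : R -> R) : continuous f -> f (tn n) @[n --> \oo] --> f 0.
    by move=> cf; apply: (cvg_comp _ _ tnc); exact: cf.
  apply: cvgM; first by apply: cat; exact: is_derive_continuous (is_derive_expR_lin (- l ^+ 2)).
  apply: cvgD.
    apply: (cvg_Rintegral_bounded S0 (M := K * S * (2 * expR (l * S)))).
    - by move=> n; exact: continuous_subspaceT (@cg _).
    - exact: continuous_subspaceT (@cg 0).
    - by move=> n x; exact: gle.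
    - move=> x _; apply: cvgMl; apply: cvgB; apply: cat.
        exact: cV1.
      exact: cV2.
  apply: cvgMl; apply: cvgB.
    by apply: (cat (fun t => esinh l (s1 t))) => t; apply: (continuous_comp (f := s1)); [exact: cs1|exact: cse].
  by apply: (cat (fun t => esinh l (s2 t))) => t; apply: (continuous_comp (f := s2)); [exact: cs2|exact: cse].
have D0 : D 0 = \int[mu]_(x in `[0, S]) ((U1 x 0 - U2 x 0) * ecosh l x).
  by rewrite /D /wt mulr0 expR0 mul1r s12 subrr mul0r addr0.
rewrite -D0.
have le1 : `|D 0| <= `|D tf| + C * tf.
  rewrite -(cvg_lim (@Rhausdorff R) (cvg_norm Dc)).
  apply: limr_le; first by apply/cvg_ex; exists `|D 0|; exact: cvg_norm Dc.
  by apply: nearW => n; exact: Dt.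
apply: le_trans le1 _; apply: le_trans (lerD Dtf (lexx _)) _.
rewrite -addrA lerD2l /C -subr_ge0.
have -> : 2 * (1 + tf) * (1 + l ^+ 2) * expR (l * S) * d -
    (2 * expR (l * S) * d + 2 * l ^+ 2 * expR (l * S) * d * tf) =
    2 * expR (l * S) * d * (tf + l ^+ 2) by ring.
by rewrite !mulr_ge0 ?expR_ge0// addr_ge0// ltW.
Qed.

End MomentEstimate.

(** * From exponential moments to tail integrals *)

Section Tail.
Context {R : realType}.
Notation mu := (@lebesgue_measure R).

Lemma le_sqr_expR (z : R) : 0 <= z -> 1 + z ^+ 2 <= 2 * expR z.
Proof.
move=> z0; have := expR_ge1Dxn 1 z0; have := expR_ge1Dx z; have := sqr_ge0 z.
have -> : 2`!%:R = 2 :> R by [].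
by move=> h0 h1 h2; move: z0 h1 h2; lin.
Qed.

Lemma one_minus_pow_le (m : nat) (z : R) : (0 < m)%N -> z <= m%:R ->
  [/\ 0 <= (1 - z / m%:R) ^+ m, (1 - z / m%:R) ^+ m <= expR (- z) & 1 - z <= (1 - z / m%:R) ^+ m].
Proof.
move=> m0 zm; have m0' : 0 < m%:R :> R by rewrite ltr0n.
have zm' : z / m%:R <= 1 by rewrite ler_pdivrMr ?mul1r.
have e : m%:R * (z / m%:R) = z by rewrite mulrC divfK ?gt_eqF.
split; first by rewrite exprn_ge0// subr_ge0.
  have -> : - z = m%:R * (- (z / m%:R)) by rewrite mulrN e.
  rewrite expRM_natl lerXn2r ?nnegrE ?subr_ge0 ?expR_ge0//.
  exact: expR_ge1Dx.
rewrite -[X in 1 - X <= _]e; move: (z / m%:R) zm' => w w1 {m0 m0' zm e}.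
elim: m => [|m IH]; first by rewrite mul0r subr0 expr0.
rewrite exprS; apply: le_trans (ler_wpM2l _ IH); last by rewrite subr_ge0.
rewrite -natr1 -subr_ge0.
have -> : (1 - w) * (1 - m%:R * w) - (1 - (m%:R + 1) * w) = m%:R * w ^+ 2 by ring.
by rewrite mulr_ge0 ?sqr_ge0.
Qed.

(** A combination of the exponentials [exp (k y)], [1 <= k <= m], that stays close
    to the indicator of [y > 0] as long as [exp y <= m]. *)
Definition sigmoid (m : nat) (y : R) : R := 1 - (1 - expR y / m%:R) ^+ m.

Lemma sigmoid_bounds m (y : R) : (0 < m)%N -> expR y <= m%:R ->
  [/\ 0 <= sigmoid m y, sigmoid m y <= expR y, sigmoid m y <= 1 & 1 - sigmoid m y <= expR (- y)].
Proof.
move=> m0 ym; have [h0 h1 h2] := one_minus_pow_le m0 ym.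
have h3 : expR (- expR y) <= expR (- y).
  by rewrite ler_expR lerN2; apply: le_trans (expR_ge1Dx y); rewrite lerDr.
have h4 : expR (- expR y) <= 1 by rewrite expR_le1 oppr_le0 expR_ge0.
rewrite /sigmoid; split; by move: h0 h1 h2 h3 h4; lin.
Qed.

Lemma continuous_expR_affine (k r : R) : continuous (fun x : R => expR (k * x + r)).
Proof.
have -> : (fun x : R => expR (k * x + r)) = (fun x => expR (r + k * x)).
  by apply/funext => x; rewrite addrC.
by apply: (@affine_continuous _ expR); exact: continuous_expR.
Qed.

Lemma Rintegral_expR_affine (k r p q : R) : k != 0 -> p <= q ->
  \int[mu]_(x in `[p, q]) expR (k * x + r) = (expR (k * q + r) - expR (k * p + r)) / k.
Proof.
move=> k0 pq.
have dF (x : R) : is_derive x 1 (fun x : R => k^-1 * expR (k * x + r)) (expR (k * x + r)).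
  have d1 : is_derive x 1 (fun x : R => k * x + r) k.
    by apply: is_derive_eq; rewrite /GRing.scale/=; ring.
  have d2 := @is_derive1_comp _ expR (fun x : R => k * x + r) x _ _ (is_derive_expR _) d1.
  apply: (is_derive_eq (@is_deriveZ R _ _ _ k^-1 _ _ _ d2)).
  by rewrite /GRing.scale/= mulrCA mulVf ?mulr1.
by rewrite (FTC2_cont pq (@continuous_expR_affine k r) dF) -mulrBr mulrC.
Qed.

Lemma Rintegral_expR_le (k r p q M : R) : 0 < k -> 0 <= M -> p <= q ->
  (k * q + r <= 0 -> \int[mu]_(x in `[p, q]) (M * expR (k * x + r)) <= M / k) /\
  (- k * p + r <= 0 -> \int[mu]_(x in `[p, q]) (M * expR (- k * x + r)) <= M / k).
Proof.
move=> k0 M0 pq; have kn := gt_eqF k0.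
split=> h; (rewrite RintegralZ_cont; last by apply: continuous_subspaceT; exact: continuous_expR_affine);
  (rewrite Rintegral_expR_affine ?oppr_eq0 ?kn//).
  apply: ler_wpM2l => //; rewrite -[leRHS]mul1r ler_wpM2r ?invr_ge0 ?(ltW k0)//.
  have := expR_ge0 (k * p + r); have : expR (k * q + r) <= 1 by rewrite expR_le1.
  by lin.
rewrite invrN mulrN -mulNr opprB.
apply: ler_wpM2l => //; rewrite -[leRHS]mul1r ler_wpM2r ?invr_ge0 ?(ltW k0)//.
have := expR_ge0 (- k * q + r); have : expR (- k * p + r) <= 1 by rewrite expR_le1.
by lin.
Qed.

(** The mirror image [sigmoid m (l * (- x - a))] makes the weight even in [x], as
    moments against [cosh] require, and is at most [exp (- l x)] on [[0, S]]. Three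
    exponential tails, each of integral at most [Mg / l], bound the distance between
    the weight and the indicator of [x > a]. *)
Lemma tail_sigmoid (g : R -> R) (S l a Mg : R) (m : nat) :
  continuous g -> (forall x, 0 <= x <= S -> `|g x| <= Mg) ->
  0 <= a <= S -> 0 < l -> expR (l * S) <= m%:R ->
  `|\int[mu]_(x in `[a, S]) g x| <=
    `|\int[mu]_(x in `[0, S]) (g x * (sigmoid m (l * (x - a)) + sigmoid m (l * (- x - a))))| + 3 * (Mg / l).
Proof.
move=> cg gM /andP[a0 aS] l0 lm.
have S0 : 0 <= S by exact: le_trans aS.
have Mg0 : 0 <= Mg by apply: le_trans (gM 0 _); rewrite ?normr_ge0 ?lexx.
have m0 : (0 < m)%N by rewrite -(ltr0n R); apply: lt_le_trans lm; exact: expR_gt0.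
pose tau x := sigmoid m (l * (x - a)) + sigmoid m (l * (- x - a)).
have csig : continuous (sigmoid m).
  move=> x; apply: cvgB; first exact: cvg_cst.
  apply: (@continuous_comp R R R (fun y => 1 - expR y / m%:R) (fun z => z ^+ m)); last exact: exprn_continuous.
  apply: cvgB; first exact: cvg_cst.
  by apply: cvgMl; exact: continuous_expR.
have ctau : continuous tau.
  have c1 := @affine_continuous _ _ (- (l * a)) l csig; have c2 := @affine_continuous _ _ (- (l * a)) (- l) csig.
  have -> : tau = (fun x => sigmoid m (- (l * a) + l * x) + sigmoid m (- (l * a) + - l * x)).
    by apply/funext => x; rewrite /tau; congr (sigmoid m _ + sigmoid m _); ring.
  by move=> x; apply: cvgD; [exact: c1|exact: c2].
have la : 0 <= l * a by rewrite mulr_ge0// ltW.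
have lx x : 0 <= x <= S -> 0 <= l * x <= l * S.
  by move=> /andP[x0 xS]; rewrite mulr_ge0 ?(ltW l0)//= ler_wpM2l ?(ltW l0).
have sg1 x : 0 <= x <= S -> [/\ 0 <= sigmoid m (l * (x - a)), sigmoid m (l * (x - a)) <= expR (l * (x - a)), sigmoid m (l * (x - a)) <= 1
    & 1 - sigmoid m (l * (x - a)) <= expR (- (l * (x - a)))].
  move=> /lx/andP[x0 xS]; apply: sigmoid_bounds => //; apply: le_trans lm; rewrite ler_expR mulrBr.
  by move: la xS; lin.
have sg2 x : 0 <= x <= S -> 0 <= sigmoid m (l * (- x - a)) <= expR (- l * x + 0).
  move=> xx; have /andP[x0 xS] := lx x xx.
  have [||-> h _ _]/= := @sigmoid_bounds m (l * (- x - a)) => //.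
    by apply: le_trans lm; rewrite ler_expR mulrBr mulrN; move: la x0 xS; lin.
  by apply: le_trans h _; rewrite ler_expR mulrBr mulrN addr0 mulNr; move: la; lin.
have cgt : continuous (fun x => g x * tau x) by move=> x; apply: cvgM; [exact: cg|exact: ctau].
have cMe (k r : R) : continuous (fun x : R => Mg * expR (k * x + r)).
  by move=> x; apply: cvgMr; exact: continuous_expR_affine.
have i0 : `|\int[mu]_(x in `[0, a]) (g x * tau x)| <= Mg / l + \int[mu]_(x in `[0, a]) (Mg * expR (- l * x + 0)).
  apply: (@le_trans _ _ (\int[mu]_(x in `[0, a]) (Mg * expR (l * x + - (l * a)) + Mg * expR (- l * x + 0)))).
    apply: Rintegral_dominated => //.
      by move=> x; apply: cvgD; exact: cMe.
    move=> x /andP[x0 xa]; have xS : 0 <= x <= S by rewrite x0 (le_trans xa).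
    have [h0 h1 _ _] := sg1 x xS; have /andP[h2 h3] := sg2 x xS.
    rewrite normrM -mulrDr; apply: ler_pM => //; first exact: gM.
    have -> : l * x + - (l * a) = l * (x - a) by rewrite mulrBr.
    by rewrite ger0_norm; [exact: lerD|exact: addr_ge0].
  rewrite RintegralD_cont; [|exact: continuous_subspaceT..].
  by rewrite lerD2r; apply: (Rintegral_expR_le _ l0 Mg0 _).1 => //; rewrite subrr.
have i1 : `|\int[mu]_(x in `[a, S]) (g x - g x * tau x)| <= Mg / l + \int[mu]_(x in `[a, S]) (Mg * expR (- l * x + 0)).
  apply: (@le_trans _ _ (\int[mu]_(x in `[a, S]) (Mg * expR (- l * x + l * a) + Mg * expR (- l * x + 0)))).
    apply: Rintegral_dominated => //.
    - by move=> x; apply: cvgB; [exact: cg|exact: cgt].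
    - by move=> x; apply: cvgD; exact: cMe.
    move=> x /andP[x0 xa]; have xS : 0 <= x <= S by rewrite xa (le_trans a0).
    have [_ _ h0 h1] := sg1 x xS; have /andP[h2 h3] := sg2 x xS.
    rewrite -{1}[g x]mulr1 -mulrBr normrM -mulrDr; apply: ler_pM => //; first exact: gM.
    have -> : - l * x + l * a = - (l * (x - a)) by ring.
    rewrite /tau opprD addrA; apply: le_trans (ler_normB _ _) _.
    by rewrite ger0_norm ?subr_ge0// ger0_norm//; exact: lerD.
  rewrite RintegralD_cont; [|exact: continuous_subspaceT..].
  by rewrite lerD2r; apply: (Rintegral_expR_le _ l0 Mg0 _).2 => //; rewrite mulNr addrC subrr.
have i2 : \int[mu]_(x in `[0, a]) (Mg * expR (- l * x + 0)) + \int[mu]_(x in `[a, S]) (Mg * expR (- l * x + 0)) <= Mg / l.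
  rewrite -Rintegral_cat//.
  by apply: (Rintegral_expR_le _ l0 Mg0 _).2 => //; rewrite mulr0 addr0.
have e1 : \int[mu]_(x in `[a, S]) g x = \int[mu]_(x in `[0, S]) (g x * tau x)
   - \int[mu]_(x in `[0, a]) (g x * tau x) + \int[mu]_(x in `[a, S]) (g x - g x * tau x).
  rewrite RintegralB_cont ?(Rintegral_cat a0 aS)//; [ring|exact: continuous_subspaceT..].
rewrite e1; apply: le_trans (ler_normD _ _) _.
have := ler_normB (\int[mu]_(x in `[0, S]) (g x * tau x)) (\int[mu]_(x in `[0, a]) (g x * tau x)).
by move: i0 i1 i2; lin.
Qed.

End Tail.

Section Tail.
Context {R : realType}.
Notation mu := (@lebesgue_measure R).

Lemma expr1D_sub1 (m : nat) (w : R) :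
  (1 + w) ^+ m - 1 = \sum_(i < m) 'C(m, i.+1)%:R * w ^+ i.+1.
Proof.
rewrite exprDn big_ord_recl/= expr1n expr0 bin0 mulr1 mulr1n addrAC subrr add0r.
by apply: eq_bigr => i _; rewrite expr1n mul1r mulr_natl.
Qed.

(** Uniform in [m]: the left-hand side is [(1 + q / m)^m - 1]. *)
Lemma sum_bin_le (m : nat) (q : R) : (0 < m)%N -> 0 <= q ->
  \sum_(i < m) 'C(m, i.+1)%:R * (m%:R)^-1 ^+ i.+1 * q ^+ i.+1 <= expR q - 1.
Proof.
move=> m0 q0; under eq_bigr do rewrite -mulrA -exprMn.
rewrite -expr1D_sub1 lerD2r.
have {2}-> : q = m%:R * (m%:R^-1 * q) by rewrite mulVKf// pnatr_eq0 -lt0n.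
rewrite expRM_natl lerXn2r ?nnegrE ?expR_ge0//; last exact: expR_ge1Dx.
by rewrite addr_ge0// mulr_ge0// invr_ge0.
Qed.

Lemma sigmoid_ecosh (m : nat) (l a x : R) :
  sigmoid m (l * (x - a)) + sigmoid m (l * (- x - a)) =
  \sum_(i < m) (- ('C(m, i.+1)%:R * (- m%:R^-1) ^+ i.+1 * expR (- (l * a)) ^+ i.+1)) * ecosh (i.+1%:R * l) x.
Proof.
have sE (y : R) : sigmoid m y = \sum_(i < m) - ('C(m, i.+1)%:R * (- m%:R^-1) ^+ i.+1 * expR y ^+ i.+1).
  rewrite sumrN; under eq_bigr do rewrite -mulrA -exprMn.
  by rewrite -(expr1D_sub1 m (- m%:R^-1 * expR y)) /sigmoid opprB mulNr [expR y / _]mulrC.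
rewrite !sE -big_split/=; apply: eq_bigr => i _.
have -> : l * (x - a) = l * x + - (l * a) by ring.
have -> : l * (- x - a) = - (l * x) + - (l * a) by ring.
have -> : ecosh (i.+1%:R * l) x = expR (l * x) ^+ i.+1 + expR (- (l * x)) ^+ i.+1.
  by rewrite /ecosh -!expRM_natl mulrN mulrA.
by rewrite !expRD !exprMn; ring.
Qed.

(** Expand the even weight of [tail_sigmoid] by the binomial formula and sum the
    bounds on the moments of order [k l]. As [k^2 >= k], both kinds of terms are
    bounded by a [k]-th power, so that [sum_bin_le] applies; the growth of the
    moments becomes the double exponential. *)
Lemma tail_of_moments (g : R -> R) (S l tf d a Mg A1 A2 : R) :
  continuous g -> (forall x, 0 <= x <= S -> `|g x| <= Mg) ->
  0 <= a <= S -> 0 < l -> 0 <= tf -> 0 <= d -> 0 <= A1 -> 0 <= A2 ->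
  (forall k, 0 < k -> `|\int[mu]_(x in `[0, S]) (g x * ecosh k x)| <=
     A1 * expR (k * S - k ^+ 2 * tf) + A2 * (1 + k ^+ 2) * expR (k * S) * d) ->
  `|\int[mu]_(x in `[a, S]) g x| <=
    A1 * (expR (expR (l * S - l ^+ 2 * tf)) - 1) + 2 * A2 * d * expR (expR (l * (S + 1))) + 3 * (Mg / l).
Proof.
move=> cg gM aS l0 tf0 d0 A10 A20 mom.
pose m := (Num.truncn (expR (l * S))).+1.
have lm : expR (l * S) <= m%:R by rewrite ltW// truncnS_gt.
have m0 : (0 < m)%N by [].
have /andP[a0 _] := aS.
apply: le_trans (tail_sigmoid cg gM aS l0 lm) _; rewrite lerD2r.
set q := expR (l * S - _); set X := expR (l * (S + 1)).
pose c (i : nat) := - ('C(m, i.+1)%:R * (- m%:R^-1) ^+ i.+1 * expR (- (l * a)) ^+ i.+1).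
have ce k : continuous (ecosh k : R -> R) := is_derive_continuous (is_derive_ecosh k).
have cge k : continuous (fun x => g x * ecosh k x).
  by move=> x; apply: cvgM; [exact: cg|exact: ce].
have -> : \int[mu]_(x in `[0, S]) (g x * (sigmoid m (l * (x - a)) + sigmoid m (l * (- x - a)))) =
    \sum_(i < m) c i * \int[mu]_(x in `[0, S]) (g x * ecosh (i.+1%:R * l) x).
  under eq_Rintegral do rewrite sigmoid_ecosh mulr_sumr.
  under eq_Rintegral do under eq_bigr do rewrite mulrCA.
  rewrite (Rintegral_sum_cont 0 S m (F := fun i x => c i * (g x * ecosh (i.+1%:R * l) x))).
    by apply: eq_bigr => i _; rewrite RintegralZ_cont//; apply: continuous_subspaceT; exact: cge.
  by move=> i x; apply: cvgMr; exact: cge.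
apply: le_trans (ler_norm_sum _ _ _) _.
pose w (i : nat) : R := 'C(m, i.+1)%:R * m%:R^-1 ^+ i.+1.
apply: (@le_trans _ _ (\sum_(i < m) (A1 * (w i * q ^+ i.+1) + 2 * A2 * d * (w i * X ^+ i.+1)))).
  apply: ler_sum => i _; set k := i.+1%:R * l.
  have k1 : 1 <= i.+1%:R :> R by rewrite ler1n.
  have k0 : 0 < k by rewrite mulr_gt0// ltr0n.
  have w0 : 0 <= w i by rewrite mulr_ge0// exprn_ge0// invr_ge0.
  have cw : `|c i| <= w i.
    rewrite normrN !normrM normrX normrN (ger0_norm (ler0n _ _)) (ger0_norm (_ : 0 <= m%:R^-1)) ?invr_ge0//.
    rewrite -/(w i) -[leRHS]mulr1 ler_wpM2l//.
    rewrite normrX exprn_ile1// ger0_norm ?expR_ge0// expR_le1 oppr_le0 mulr_ge0//.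
    exact: ltW.
  have qk : expR (k * S - k ^+ 2 * tf) <= q ^+ i.+1.
    rewrite /q -expRM_natl ler_expR mulrBr /k mulrA lerD2l lerN2 exprMn mulrA ler_wpM2r//.
    by rewrite ler_wpM2r ?sqr_ge0// expr2 ler_peMr.
  have Xk : (1 + k ^+ 2) * expR (k * S) <= 2 * X ^+ i.+1.
    have -> : X ^+ i.+1 = expR k * expR (k * S).
      by rewrite /X -expRM_natl -expRD; congr expR; rewrite /k; ring.
    by rewrite mulrA ler_wpM2r ?expR_ge0// le_sqr_expR// ltW.
  rewrite normrM.
  have -> : A1 * (w i * q ^+ i.+1) + 2 * A2 * d * (w i * X ^+ i.+1) =
    w i * (A1 * q ^+ i.+1 + A2 * d * (2 * X ^+ i.+1)) by ring.
  apply: ler_pM => //; apply: le_trans (mom k k0) _; apply: lerD.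
    exact: ler_wpM2l.
  have -> : A2 * (1 + k ^+ 2) * expR (k * S) * d = A2 * d * ((1 + k ^+ 2) * expR (k * S)) by ring.
  by apply: ler_wpM2l => //; exact: mulr_ge0.
rewrite big_split/= -!mulr_sumr; apply: lerD.
  by apply: ler_wpM2l => //; apply: sum_bin_le => //; exact: expR_ge0.
apply: ler_wpM2l; first by rewrite !mulr_ge0.
by apply: le_trans (sum_bin_le m0 (expR_ge0 _)) _; rewrite gerBl.
Qed.

End Tail.

(** * From tail integrals to pointwise bounds *)

Section Recover.
Context {R : realType}.
Notation mu := (@lebesgue_measure R).

Lemma expRN_le_inv (y : R) : 0 < y -> expR (- y) <= y^-1.
Proof.
move=> y0; rewrite expRN lef_pV2 ?posrE ?expR_gt0//.
by apply: le_trans (expR_ge1Dx y); rewrite lerDr.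
Qed.

Lemma expR_sub1_le (q : R) : 0 <= q <= 2^-1 -> expR q - 1 <= 2 * q.
Proof.
move=> /andP[q0 q1]; have h := expR_ge1Dx (- q).
have e : expR q * expR (- q) = 1 by rewrite -expRD subrr expR0.
have := expR_gt0 q; move: h e q0 q1; move: (expR q) (expR (- q)) => u v h e q0 q1 u0.
have h1 : u * (1 - q) <= 1 by rewrite -[leRHS]e ler_wpM2l// ltW.
have h2 : 0 <= u * (2^-1 - q) by rewrite mulr_ge0 ?(ltW u0)// subr_ge0.
have h3 : 0 <= (2 - u) * q by rewrite mulr_ge0// subr_ge0; move: h1 h2; clear => *; lra.
by move: h1 h3; clear => *; lra.
Qed.

(** The summand [2] gives [kappa^3 <= kappa^4 / 2], the next one absorbs the double
    exponential, [(S + 1) / tf] lets the diffusion factor win, and [2 / b] leaves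
    room for the averaging interval. *)
Definition kappa0 (b S tf : R) : R := 2 + 2 * (S + 1) + (S + 1) / tf + 2 / b.

(** With [l = kappa^3] the inner exponent [l S - l^2 tf] is at most [- l]. Moreover
    [exp (l (S + 1)) <= Y] for [Y = exp (kappa^4 / 2)], while [d <= exp (- Y^2)], so
    the double exponential is absorbed with room to spare. *)
Lemma tail_decay (g : R -> R) (b S tf d a Mg A1 A2 kappa : R) :
  0 < b -> continuous g -> (forall x, 0 <= x <= S -> `|g x| <= Mg) ->
  0 <= a <= S -> 0 < tf -> 0 <= d -> 0 <= A1 -> 0 <= A2 ->
  (forall k, 0 < k -> `|\int[mu]_(x in `[0, S]) (g x * ecosh k x)| <=
     A1 * expR (k * S - k ^+ 2 * tf) + A2 * (1 + k ^+ 2) * expR (k * S) * d) ->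
  kappa0 b S tf <= kappa -> d <= expR (- expR (kappa ^+ 4)) ->
  `|\int[mu]_(x in `[a, S]) g x| <= (3 * Mg + 2 * A1 + 2 * A2) / kappa ^+ 3.
Proof.
move=> b0 cg gM aS tf0 d0 A10 A20 mom k0k dk.
have S0 : 0 <= S by have /andP[h1 h2] := aS; exact: le_trans h2.
have [k2 [kS ktf]] : 2 <= kappa /\ 2 * (S + 1) <= kappa /\ (S + 1) / tf <= kappa.
  have h1 : 0 <= (S + 1) / tf by rewrite divr_ge0 ?(ltW tf0)//; move: S0; lin.
  have h2 : 0 <= 2 / b by rewrite divr_ge0// ltW.
  by move: h1 h2 k0k S0; rewrite /kappa0; clear => *; split; [lra|split; lra].
have k1 : 1 <= kappa by move: k2; lin.
have kp : 0 < kappa by move: k1; lin.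
have ltf : S + 1 <= kappa * tf by rewrite -ler_pdivrMr.
pose l := kappa ^+ 3; have l0 : 0 < l by rewrite exprn_gt0.
have l1 : 1 <= l by rewrite exprn_ege1.
have kl : kappa <= l by rewrite /l exprS ler_peMr ?(ltW kp)// exprn_ege1.
have el : expR (- l) <= l^-1 by exact: expRN_le_inv.
apply: le_trans (tail_of_moments cg gM aS l0 (ltW tf0) d0 A10 A20 mom) _.
have q1 : expR (l * S - l ^+ 2 * tf) <= expR (- l).
  rewrite ler_expR -subr_ge0.
  have -> : - l - (l * S - l ^+ 2 * tf) = l * (l * tf - (S + 1)) by ring.
  rewrite mulr_ge0 ?(ltW l0)// subr_ge0; apply: le_trans ltf _.
  by rewrite ler_wpM2r// ltW.
have q2 : expR (expR (l * S - l ^+ 2 * tf)) - 1 <= 2 / l.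
  apply: (@le_trans _ _ (2 * expR (l * S - l ^+ 2 * tf))).
    apply: expR_sub1_le; rewrite expR_ge0/= (le_trans q1)// (le_trans el)//.
    by rewrite lef_pV2 ?posrE// (le_trans k2).
  by rewrite ler_wpM2l// (le_trans q1).
have X1 : d * expR (expR (l * (S + 1))) <= l^-1.
  apply: le_trans el; pose Y := expR (kappa ^+ 4 / 2).
  have XY : expR (l * (S + 1)) <= Y.
    rewrite ler_expR -subr_ge0.
    have -> : kappa ^+ 4 / 2 - l * (S + 1) = l / 2 * (kappa - 2 * (S + 1)).
      by rewrite /l; field.
    by rewrite mulr_ge0 ?subr_ge0// divr_ge0// ltW.
  have YY : expR (kappa ^+ 4) = Y ^+ 2.
    by rewrite /Y -expRM_natl; congr expR; field.
  have Yl : 1 + l <= Y.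
    apply: le_trans (expR_ge1Dx _); rewrite lerD2l -subr_ge0.
    have -> : kappa ^+ 4 / 2 - l = l / 2 * (kappa - 2) by rewrite /l; field.
    by rewrite mulr_ge0 ?subr_ge0// divr_ge0// ltW.
  apply: (@le_trans _ _ (expR (- expR (kappa ^+ 4)) * expR Y)).
    by apply: ler_pM; [exact: d0|exact: expR_ge0|exact: dk|rewrite ler_expR; exact: XY].
  rewrite -expRD ler_expR YY.
  have h : 0 <= Y * (Y - (1 + l)) by rewrite mulr_ge0 ?expR_ge0// subr_ge0.
  have h' : 0 <= (Y - 1) * l by rewrite mulr_ge0 ?(ltW l0)// subr_ge0; move: Yl l1; lin.
  by move: h h'; clear => *; lra.
have -> : (3 * Mg + 2 * A1 + 2 * A2) / l = A1 * (2 / l) + 2 * A2 * l^-1 + 3 * (Mg / l) by ring.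
rewrite lerD2r; apply: lerD; first exact: ler_wpM2l.
by rewrite -mulrA ler_wpM2l// mulr_ge0.
Qed.

Lemma value_le_average (g : R -> R) (x p q e : R) : continuous g -> p <= q ->
  (forall z, p <= z <= q -> `|g x - g z| <= e) ->
  `|g x| * (q - p) <= e * (q - p) + `|\int[mu]_(z in `[p, q]) g z|.
Proof.
move=> cg pq ge; have cc : continuous (fun z => g x - g z).
  by move=> z; apply: cvgB; [exact: cvg_cst|exact: cg].
have h := Rintegral_norm_le pq (continuous_subspaceT cc) ge.
have qp : 0 <= q - p by rewrite subr_ge0.
have e1 : g x * (q - p) = \int[mu]_(z in `[p, q]) (g x - g z) + \int[mu]_(z in `[p, q]) g z.
  rewrite RintegralB_cont ?subrK ?Rintegral_cst_itv//.
  - by apply: continuous_subspaceT => z; exact: cvg_cst.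
  - exact: continuous_subspaceT.
have -> : `|g x| * (q - p) = `|g x * (q - p)| by rewrite normrM (ger0_norm qp).
by rewrite e1; apply: le_trans (ler_normD _ _) _; rewrite lerD2r.
Qed.

(** Average over an interval of length [r = kappa^-2] containing [x]: the Hoelder
    bound gives an error [L sqrt r = L / kappa], and the integral, a difference of
    two tails of order [kappa^-3], is divided by [r]. *)
Lemma sup_of_moments (g : R -> R) (b S tf d Mg A1 A2 L kappa : R) :
  0 < b <= S -> continuous g -> (forall x, 0 <= x <= S -> `|g x| <= Mg) ->
  (forall x y, 0 < x -> x < y -> y < b -> `|g y - g x| <= L * Num.sqrt (y - x)) -> 0 <= L ->
  0 < tf -> 0 <= d -> 0 <= A1 -> 0 <= A2 ->
  (forall k, 0 < k -> `|\int[mu]_(x in `[0, S]) (g x * ecosh k x)| <=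
     A1 * expR (k * S - k ^+ 2 * tf) + A2 * (1 + k ^+ 2) * expR (k * S) * d) ->
  kappa0 b S tf <= kappa -> d <= expR (- expR (kappa ^+ 4)) ->
  forall x, 0 < x < b -> `|g x| <= (L + 2 * (3 * Mg + 2 * A1 + 2 * A2)) / kappa.
Proof.
move=> /andP[b0 bS] cg gM gL L0 tf0 d0 A10 A20 mom k0k dk x /andP[x0 xb].
have tail a : 0 <= a <= S -> `|\int[mu]_(x in `[a, S]) g x| <= (3 * Mg + 2 * A1 + 2 * A2) / kappa ^+ 3.
  by move=> aS; exact: tail_decay b0 cg gM aS tf0 d0 A10 A20 mom k0k dk.
set C := 3 * Mg + 2 * A1 + 2 * A2 in tail *.
have S0 : 0 < S by exact: lt_le_trans bS.
have [k2 kb] : 2 <= kappa /\ 2 / b < kappa.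
  have h1 : 0 <= (S + 1) / tf by rewrite divr_ge0 ?(ltW tf0)//; move: S0; lin.
  have h2 : 0 <= 2 / b by rewrite divr_ge0// ltW.
  by move: h1 h2 k0k S0; rewrite /kappa0; clear => *; split; lra.
have kp : 0 < kappa by move: k2; lin.
pose r := kappa ^- 2; have r0 : 0 < r by rewrite invr_gt0 exprn_gt0.
have sr : Num.sqrt r = kappa^-1 by rewrite /r -exprVn sqrtr_sqr ger0_norm// invr_ge0 ltW.
have rb : r < b / 2.
  apply: (@le_lt_trans _ _ kappa^-1).
    rewrite /r lef_pV2 ?posrE ?exprn_gt0// expr2 ler_peMr ?(ltW kp)//.
    by move: k2; lin.
  by rewrite -[b / 2]invrK ltf_pV2 ?posrE ?invf_div// divr_gt0.
(* The interval extends to the side of [x] on which the room is at least [b / 2]. *)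
have [p [p0 px xp pb]] : exists p, [/\ 0 < p, p <= x, x <= p + r & p + r < b].
  have [xb2|xb2] := ltP x (b / 2).
    by exists x; split => //; [rewrite lerDl ltW|move: xb2 rb; lin].
  exists (x - r); split; last 2 first.
  - by rewrite subrK.
  - by rewrite subrK.
  - by move: xb2 rb; lin.
  - by move: r0; lin.
have gz z : p <= z <= p + r -> `|g x - g z| <= L * kappa^-1.
  move=> /andP[pz zp]; rewrite -sr.
  have sq u v : v - u <= r -> L * Num.sqrt (v - u) <= L * Num.sqrt r.
    by move=> uv; apply: ler_wpM2l => //; apply: ler_wsqrtr.
  have [zx|xz|->] := ltgtP z x.
  - apply: le_trans (gL z x (lt_le_trans p0 pz) zx xb) _; apply: sq.
    by move: xp pz; lin.
  - rewrite distrC; apply: le_trans (gL x z x0 xz (le_lt_trans zp pb)) _; apply: sq.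
    by move: px zp; lin.
  - by rewrite subrr normr0 mulr_ge0// sqrtr_ge0.
have pq : p <= p + r by rewrite lerDl ltW.
have av := value_le_average cg pq gz.
have i1 : `|\int[mu]_(z in `[p, p + r]) g z| <= 2 * (C / kappa ^+ 3).
  have pS : 0 <= p + r <= S by move: p0 pb bS r0; clear => *; apply/andP; split; lra.
  have pS' : 0 <= p <= S by move: p0 pb bS r0; clear => *; apply/andP; split; lra.
  have -> : \int[mu]_(z in `[p, p + r]) g z =
     \int[mu]_(z in `[p, S]) g z - \int[mu]_(z in `[p + r, S]) g z.
    by have /andP[_ h] := pS; rewrite (Rintegral_cat pq h cg) addrK.
  by apply: le_trans (ler_normB _ _) _; rewrite mulr2n mulrDl mul1r; apply: lerD; exact: tail.
have av2 := le_trans av (lerD (lexx _) i1).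
move: av2; rewrite addrAC subrr add0r.
have -> : L * kappa^-1 * r + 2 * (C / kappa ^+ 3) = (L + 2 * C) / kappa * r.
  by rewrite /r; field; exact: lt0r_neq0.
by rewrite ler_pM2r.
Qed.

End Recover.

(** * From the fronts to the initial data *)

Section Norms.
Context {R : realType}.
Notation mu := (@lebesgue_measure R).

(** An excess over the essential supremum at one point persists, by continuity, on
    an interval, whose measure is positive. *)
Lemma Loo_norm_ge (a b N : R) (f : R -> R) : {within `[a, b], continuous f} ->
  (Lp_norm +oo a b f <= N%:E)%E -> forall x, a < x < b -> `|f x| <= N.
Proof.
move=> cf; have muT : (0 < mu (setT : set R))%E.
  apply: (@lt_le_trans _ _ (mu `]0, 1[%classic)).
    by rewrite lebesgue_measure_itv/= lte_fin ltr01 oppr0 adde0 lte_fin ltr01.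
  by apply: le_measure; rewrite ?inE//; exact: measurable_itv.
rewrite /Lp_norm unlock ifT; last exact: muT.
move=> /ess_supP [A [mA A0 HA]] x /andP[ax xb].
rewrite leNgt; apply/negP => Nf.
have xI : `[a, b]%classic x by rewrite /= in_itv/= !ltW.
have /within_continuous_eps /(_ x xI (`|f x| - N)) := cf.
rewrite subr_gt0 => /(_ Nf) [d d0 Hd].
pose r := Num.min d (b - x); have r0 : 0 < r by rewrite lt_min d0 subr_gt0.
have rA : `]x, x + r[%classic `<=` A.
  move=> z; rewrite /= in_itv/= => /andP[xz]; rewrite -ltrBlDl lt_min => /andP[zd zb].
  apply: HA => /= zN; move: zN; apply/negP; rewrite -ltNge patchE.
  have zb' : z < b by move: zb; rewrite ltrBlDr subrK.
  have zI : z \in `]a, b[%classic by rewrite inE/= in_itv/= (lt_trans ax xz).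
  rewrite zI lte_fin.
  have := Hd z; rewrite /= in_itv/= (ltW zb') (ltW (lt_trans ax xz)) gtr0_norm ?subr_gt0// => /(_ erefl zd).
  have := ler_dist_dist (f z) (f x); rewrite ler_norml => /andP[h1 _] h2.
  by move: h1 h2; lin.
have : (mu `]x, (x + r)%R[%classic <= 0)%E.
  by rewrite -[leRHS]A0; apply: le_measure; rewrite ?inE//; exact: measurable_itv.
by rewrite lebesgue_measure_itv/= lte_fin ltrDl r0 -EFinD addrAC subrr add0r lee_fin leNgt r0.
Qed.

Lemma W1oo_norm_ge (T d : R) (f : R -> R) : {within `[0, T], continuous f} ->
  (W1oo_norm 0 T f <= d%:E)%E -> forall t, 0 < t < T -> `|f t| <= d.
Proof.
move=> cf fd; apply: Loo_norm_ge => //; apply: le_trans fd.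
by rewrite leeDl// Lnorm_ge0.
Qed.

(** The parameter [kappa] is left free, subject to [d <= exp (- exp (kappa^4))], so
    that the case of equal fronts is covered by letting it grow. *)
Lemma L2_bound (b T H Hhat Mhat d kappa : R) (h u01 u02 : R -> R) (u1 u2 : R * R -> R) (s1 s2 : R -> R) :
  0 < b -> 0 < T -> 0 < H -> 1 <= Hhat -> 1 <= Mhat -> {within `[0, T], continuous h} ->
  (forall t : R, 0 <= t <= T -> 0 < h t) -> sup_norm 0 T h <= Hhat ->
  {within `[0, b], continuous u01} -> {within `[0, b], continuous u02} ->
  in_H1 0 b u01 -> in_H1 0 b u02 ->
  (forall x : R, 0 <= x <= b -> 0 <= u01 x <= H * (b - x)) ->
  (forall x : R, 0 <= x <= b -> 0 <= u02 x <= H * (b - x)) ->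
  (H1_norm 0 b u01 <= Mhat%:E)%E -> (H1_norm 0 b u02 <= Mhat%:E)%E ->
  stefan_solution b T h u01 u1 s1 -> stefan_solution b T h u02 u2 s2 ->
  (forall t, 0 < t < T -> `|s1 t - s2 t| <= d) ->
  let K := H + Hhat + 1 in let S := b + K * T in let tf := T / 4 in
  kappa0 b S tf <= kappa -> d <= expR (- expR (kappa ^+ 4)) ->
  (Lp_norm 2%:E 0 b (u01 \- u02)%R <=
   ((2 * Mhat + 2 * (3 * (K * S) + 2 * (2 * K * S ^+ 2) + 2 * (2 * (1 + tf)))) * Num.sqrt b / kappa)%:E)%E.
Proof.
move=> b0 T0 H0 Hh1 Mh1 ch h0 hH c1 c2 H11 H12 b1 b2 n1 n2 sol1 sol2 sd K S tf k0k dk.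
have [ds1 e1] := stefan_extended b0 T0 H0 Hh1 ch h0 hH b1 sol1.
have [ds2 e2] := stefan_extended b0 T0 H0 Hh1 ch h0 hH b2 sol2.
rewrite -/K -/S in e1 e2.
have K0 := ext_K_ge0 e1.
have S0 : b <= S by rewrite /S lerDl mulr_ge0// ltW.
have tf0 : 0 < tf by rewrite divr_gt0.
have d0 : 0 <= d.
  by apply: le_trans (sd (T / 2) _); [exact: normr_ge0|move: T0; lin].
pose g x := temp_ext (T / 2) u1 s1 x 0 - temp_ext (T / 2) u2 s2 x 0.
have cg : continuous g.
  have cU1 := continuous_slicel (t := 0) (ext_U_cont e1).
  have cU2 := continuous_slicel (t := 0) (ext_U_cont e2).
  by move=> x; apply: cvgB; [exact: cU1|exact: cU2].
have gE x : 0 < x < b -> g x = u01 x - u02 x.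
  by move=> xI; rewrite /g (ext_init e1 xI) (ext_init e2 xI).
have gM x : 0 <= x <= S -> `|g x| <= K * S.
  move=> xS; have /andP[a1 a2] := ext_temp_le 0 e1 xS; have /andP[a3 a4] := ext_temp_le 0 e2 xS.
  by rewrite /g ler_norml; move: a1 a2 a3 a4; clear => *; apply/andP; split; lra.
have gL x y : 0 < x -> x < y -> y < b -> `|g y - g x| <= 2 * Mhat * Num.sqrt (y - x).
  move=> x0 xy yb; have M0 : 0 <= Mhat by exact: le_trans Mh1.
  rewrite !gE ?x0 ?yb ?(lt_trans xy)// ?(lt_trans x0 xy)//.
  have k1 := H1_hoelder M0 c1 H11 n1 x0 xy yb; have k2 := H1_hoelder M0 c2 H12 n2 x0 xy yb.
  have -> : u01 y - u02 y - (u01 x - u02 x) = (u01 y - u01 x) - (u02 y - u02 x) by ring.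
  by apply: le_trans (ler_normB _ _) _; move: k1 k2; lin.
have mom k : 0 < k -> `|\int[mu]_(x in `[0, S]) (g x * ecosh k x)| <=
     2 * K * S ^+ 2 * expR (k * S - k ^+ 2 * tf) + 2 * (1 + tf) * (1 + k ^+ 2) * expR (k * S) * d.
  move=> k0; apply: (moment_estimate e1 e2) => //.
  - by rewrite !front_extE ?(stefan_s_init sol1) ?(stefan_s_init sol2)// lexx divr_ge0// ltW.
  - by rewrite tf0 /tf; move: T0; lin.
  - move=> t /andP[t0 ttf]; rewrite !front_extE; last 2 first.
    + by move: t0 ttf T0; rewrite /tf; lin.
    + by move: t0 ttf T0; rewrite /tf; lin.
    by apply: sd; move: t0 ttf T0; rewrite /tf; lin.
have S00 : 0 < S by exact: lt_le_trans S0.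
have M0 : 0 <= Mhat by exact: le_trans Mh1.
have A10 : 0 <= 2 * K * S ^+ 2 by apply: mulr_ge0; [exact: mulr_ge0|exact: sqr_ge0].
have A20 : 0 <= 2 * (1 + tf) by rewrite mulr_ge0// addr_ge0// ltW.
set B := 2 * Mhat + _.
have sup x : 0 < x < b -> `|g x| <= B / kappa.
  apply: (sup_of_moments _ cg gM gL _ tf0 d0 A10 A20 mom k0k dk).
    by rewrite b0.
  by rewrite mulr_ge0.
have -> : B * Num.sqrt b / kappa = B / kappa * Num.sqrt (b - 0) by rewrite subr0; ring.
have [[m1 _] _] := H11; have [[m2 _] _] := H12.
apply: L2_norm_le.
- apply: le_trans (sup (b / 2) _); first exact: normr_ge0.
  by move: b0; lin.
- exact: ltW.
- exact: measurable_funB.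
- by move=> x xI; have := sup x xI; rewrite gE.
- by move=> x /andP[x0 xb] [] xh; [move: x0|move: xb]; rewrite ltNge xh.
Qed.

End Norms.

Section Rate.
Context {R : realType}.

Lemma loglog_rateE (C d k0 : R) : 0 < d -> 0 < k0 -> d < expR (- expR (k0 ^+ 4)) ->
  exists kappa : R, [/\ k0 <= kappa, d = expR (- expR (kappa ^+ 4)) & loglog_rate C d = C / kappa].
Proof.
move=> d0 k00 dk.
have l1 : expR (k0 ^+ 4) < - ln d by rewrite ltrNr -[X in _ < X]expRK ltr_ln ?posrE ?expR_gt0.
have ld0 : 0 < - ln d by apply: lt_trans l1; exact: expR_gt0.
pose w := ln (- ln d).
have kw : k0 ^+ 4 < w by rewrite -[X in X < _]expRK ltr_ln ?posrE ?expR_gt0.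
have w0 : 0 < w by apply: lt_trans kw; rewrite exprn_gt0.
have k4 : (w `^ 4^-1) ^+ 4 = w.
  by rewrite -powR_mulrn ?powR_ge0// -powRrM mulVf ?pnatr_eq0// powRr1// ltW.
exists (w `^ 4^-1); split.
- rewrite leNgt; apply/negP => h.
  have : (w `^ 4^-1) ^+ 4 < k0 ^+ 4 by apply: ltrXn2r => //; rewrite ?nnegrE ?powR_ge0// ltW.
  by rewrite k4 ltNge (ltW kw).
- by rewrite k4 /w !lnK ?posrE// opprK lnK.
- rewrite /loglog_rate gt_eqF//; congr (_ / _).
  by rewrite -[`|ln d|]normrN gtr0_norm// -/w gtr0_norm.
Qed.

End Rate.

Theorem theorem3p1 (R : realType) (b T H Hhat Mhat : R)
    (b_gt0 : 0 < b) (T_gt0 : 0 < T) (H_gt0 : 0 < H)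
    (Hhat_ge1 : 1 <= Hhat) (Mhat_ge1 : 1 <= Mhat)
    (u0 : R -> R)
    (u0_cont : {within `[0, b], continuous u0})
    (u0_H1 : in_H1 0 b u0)
    (u0_bound : forall x, 0 <= x <= b -> 0 <= u0 x <= H * (b - x))
    (u0_norm : (H1_norm 0 b u0 <= Mhat%:E)%E) :
  exists eps0 C : R, [/\ 0 < eps0, 0 < C &
    forall (h : R -> R)
      (h_cont : {within `[0, T], continuous h})
      (h_gt0 : forall t, 0 <= t <= T -> 0 < h t)
      (h_norm : sup_norm 0 T h <= Hhat)
      (u0' : R -> R)
      (u0'_cont : {within `[0, b], continuous u0'})
      (u0'_H1 : in_H1 0 b u0')
      (u0'_bound : forall x, 0 <= x <= b -> 0 <= u0' x <= H * (b - x))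
      (u0'_norm : (H1_norm 0 b u0' <= Mhat%:E)%E)
      (u u' : R * R -> R) (s s' : R -> R)
      (sol : stefan_solution b T h u0 u s)
      (sol' : stefan_solution b T h u0' u' s'),
    (W1oo_norm 0 T (s \- s')%R < eps0%:E)%E ->
    (Lp_norm 2%:E 0 b (u0 \- u0')%R <=
       (loglog_rate C (fine (W1oo_norm 0 T (s \- s')%R)))%:E)%E].
Proof.
pose K := H + Hhat + 1; pose S := b + K * T; pose tf := T / 4.
pose k0 := kappa0 b S tf.
pose C := (2 * Mhat + 2 * (3 * (K * S) + 2 * (2 * K * S ^+ 2) + 2 * (2 * (1 + tf)))) * Num.sqrt b.
have K0 : 0 < K by rewrite /K; move: H_gt0 Hhat_ge1; lin.
have S0 : 0 < S by rewrite /S addr_gt0// mulr_gt0.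
have tf0 : 0 < tf by rewrite divr_gt0.
have k00 : 0 < k0.
  have h1 : 0 <= (S + 1) / tf by rewrite divr_ge0 ?(ltW tf0)//; move: S0; lin.
  have h2 : 0 <= 2 / b by rewrite divr_ge0// ltW.
  by move: h1 h2 S0; rewrite /k0 /kappa0; clear => *; lra.
have C0 : 0 < C.
  rewrite /C mulr_gt0 ?sqrtr_gt0//.
  have h1 : 0 < K * S by rewrite mulr_gt0.
  have h2 : 0 < 2 * K * S ^+ 2 by rewrite mulr_gt0 ?exprn_gt0// mulr_gt0.
  by move: h1 h2 tf0 Mhat_ge1; move: (K * S) (2 * K * S ^+ 2); clear => *; lra.
exists (expR (- expR (k0 ^+ 4))), C; split; [exact: expR_gt0|exact: C0|].
move=> h hc h0 hH u0' c2 H12 b2 n2 u u' s s' sol sol'.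
set W := W1oo_norm _ _ _ => We.
have W0 : (0 <= W)%E by rewrite /W /W1oo_norm adde_ge0// Lnorm_ge0.
have Wf : W \is a fin_num by rewrite ge0_fin_numE// (lt_trans We)// ltry.
have cd : {within `[0, T], continuous (s \- s')%R}.
  by move=> x; apply: cvgB; [exact: (stefan_s_cont sol)|exact: (stefan_s_cont sol')].
have sd t : 0 < t < T -> `|s t - s' t| <= fine W.
  by apply: (W1oo_norm_ge cd); rewrite fineK.
have bound d kappa : fine W <= d -> k0 <= kappa -> d <= expR (- expR (kappa ^+ 4)) ->
    (Lp_norm 2%:E 0 b (u0 \- u0')%R <= (C / kappa)%:E)%E.
  move=> Wd kk dk.
  apply: (L2_bound b_gt0 T_gt0 H_gt0 Hhat_ge1 Mhat_ge1 hc h0 hH u0_cont c2 u0_H1 H12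
    u0_bound b2 u0_norm n2 sol sol' _ kk dk).
  by move=> t /sd h1; exact: le_trans Wd.
have := fine_ge0 W0; rewrite le_eqVlt => /predU1P[Wz|Wp].
  rewrite -Wz /loglog_rate eqxx.
  apply/lee_addgt0Pr => e e0; rewrite add0e.
  (* The fronts agree: the bound holds for every large [kappa]. *)
  pose kappa := Num.max k0 (C / e).
  have kp : 0 < kappa by rewrite lt_max k00.
  apply: le_trans (bound 0 kappa _ _ _) _; rewrite -?Wz ?expR_ge0// ?le_max ?lexx//.
  by rewrite lee_fin ler_pdivrMr// mulrC -ler_pdivrMr// le_max lexx orbT.
have Wk : fine W < expR (- expR (k0 ^+ 4)) by rewrite -lte_fin fineK.
have [kappa [kk dk ->]] := loglog_rateE C Wp k00 Wk.
by apply: (bound _ kappa (lexx _) kk); rewrite -dk.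
Qed.
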